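(* Let $(\mathfrak{g},\mathcal{Q})$ be a quadratic Lie algebra. The meromorphic function $\mathfrak{r}^{\mathfrak{g}}:\mathfrak{g}\to\wedge^2\mathfrak{g}$, $\mathfrak{r}^{\mathfrak{g}}(\mu)=\lambda(f(\mathrm{ad}_\mu))$, with $f(z)=\frac12\coth(z/2)-\frac1z$, solves the classical dynamical Yang-Baxter equation for $\mathfrak{k}=\mathfrak{g}$ with coupling constant $\epsilon=\frac14$; that is, $$\sum_a\frac{\partial \mathfrak{r}^{\mathfrak{g}}}{\partial\mu^a}\wedge e^a+\frac12[\mathfrak{r}^{\mathfrak{g}},\mathfrak{r}^{\mathfrak{g}}]^{\mathfrak{g}}=\frac14\,\Theta,$$ where $e_a$ is a basis of $\mathfrak{g}$, $e^a$ is the dual basis with respect to $\mathcal{Q}$, and $\mu^a$ are the coordinates $\mu=\sum_a\mu^ae_a$ on $\mathfrak{g}$.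
   Context: A quadratic Lie algebra is a finite-dimensional real Lie algebra $\mathfrak{g}$ with Lie bracket $[\cdot,\cdot]^{\mathfrak{g}}$ and an invariant non-degenerate quadratic form $\mathcal{Q}$, with associated bilinear form $B(\mu,\mu')=\frac12(\mathcal{Q}(\mu+\mu')-\mathcal{Q}(\mu)-\mathcal{Q}(\mu'))$. Invariance means $\mathrm{ad}_\mu\in\mathfrak{o}(\mathfrak{g})$ for all $\mu$, where $\mathfrak{o}(\mathfrak{g})$ is the Lie algebra of endomorphisms skew-adjoint for $B$. $\mathfrak{g}^*$ is identified with $\mathfrak{g}$ via $B$; the dual basis satisfies $B(e_a,e^b)=\delta_a^b$. $\lambda:\mathfrak{o}(\mathfrak{g})\to\wedge^2\mathfrak{g}$ is $\lambda(A)=\frac12\sum_aA(e_a)\wedge e^a$. Functions of $\mathrm{ad}_\mu$ are defined by functional calculus; $f$ is extended holomorphically to $z=0$, so $f(\mathrm{ad}_\mu)$ is defined when $\mathrm{ad}_\mu$ has no eigenvalue in $2\pi\sqrt{-1}\,\mathbb{Z}\setminus\{0\}$. $[\cdot,\cdot]^{\mathfrak{g}}$ on $\wedge\mathfrak{g}$ is the Schouten bracket $\wedge^k\mathfrak{g}\times\wedge^l\mathfrak{g}\to\wedge^{k+l-1}\mathfrak{g}$ extending the Lie bracket; for $\mathfrak{r}=\frac12\sum_{ab}\mathfrak{r}^{ab}e_a\wedge e_b$, $[\mathfrak{r},\mathfrak{r}]^{\mathfrak{g}}=\sum_{abckl}\mathfrak{r}^{ak}f_{kl}^b\mathfrak{r}^{lc}\,e_a\wedge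 e_b\wedge e_c$, where $[e_k,e_l]^{\mathfrak{g}}=\sum_bf_{kl}^be_b$. $\Theta\in\wedge^3\mathfrak{g}$ is the cubic element $\Theta=-\frac16\sum_{abc}B(e^a,[e^b,e^c]^{\mathfrak{g}})\,e_a\wedge e_b\wedge e_c$. In general, for a Lie subalgebra $\mathfrak{k}\subset\mathfrak{g}$, the (modified) classical dynamical Yang-Baxter equation (CDYBE) with coupling constant $\epsilon\in\mathbb{R}$ for a meromorphic function $\mathfrak{r}:\mathfrak{k}^*\to\wedge^2\mathfrak{g}$ is $\sum_i\frac{\partial\mathfrak{r}}{\partial\mu_i}\wedge e_i+\frac12[\mathfrak{r},\mathfrak{r}]^{\mathfrak{g}}=\epsilon\Theta$, with $e_i$ a basis of $\mathfrak{k}$, $e^i$ the dual basis of $\mathfrak{k}^*$ and $\mu_i$ the corresponding coordinates on $\mathfrak{k}^*$; here $\mathfrak{k}=\mathfrak{g}$ and $\mathfrak{g}^*\cong\mathfrak{g}$. *)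

(* Defs.v *)
From HB Require Import structures.
From mathcomp Require Import all_boot all_order all_algebra.
From mathcomp Require Import complex ring.
From mathcomp Require Import all_classical all_reals all_analysis.

Set Implicit Arguments.
Unset Strict Implicit.
Unset Printing Implicit Defensive.

Import Order.TTheory GRing.Theory Num.Theory.
Import numFieldNormedType.Exports.

Local Open Scope classical_set_scope.
Local Open Scope complex_scope.
Local Open Scope ring_scope.

Definition polar (R : realType) (V : lmodType R) (Q : V -> R) (x y : V) : R :=
  2^-1 * (Q (x + y) - Q x - Q y).

Record quadLie (R : realType) := QuadLie {
  ql_vect :> vectType R;
  bracket : ql_vect -> ql_vect -> ql_vect;
  qform : ql_vect -> R;
  bracket_bilinear : bilinear_for *:%R *:%R bracket;
  bracket_alt : forall x, bracket x x = 0;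
  bracket_jacobi : forall x y z,
    bracket x (bracket y z) + bracket y (bracket z x)
      + bracket z (bracket x y) = 0;
  qform_scale : forall (c : R) x, qform (c *: x) = c ^+ 2 * qform x;
  qform_polar : bilinear_for *%R *%R (polar qform);
  qform_nondeg : forall x, (forall y, polar qform x y = 0) -> x = 0;
  qform_inv : forall mu x y,
    polar qform (bracket mu x) y = - polar qform x (bracket mu y) }.

Definition Bform (R : realType) (g : quadLie R) : g -> g -> R :=
  polar (@qform R g).

Definition ad (R : realType) (g : quadLie R) (mu : g) : 'End(g) :=
  linfun (bracket mu).

(* The exterior algebra of a space with basis e_0, ..., e_(n-1): an element is
   given by its coefficients on the monomials e_S = e_(s_1) /\ ... /\ e_(s_k),
   S = {s_1 < ... < s_k}.  R^o makes the coefficients an R-module; the product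
   is ext_wedge, not a pointwise one. *)
Section Exterior.
Variables (R : comNzRingType) (n : nat).

Definition ext := {ffun {set 'I_n} -> R^o}.

(* e_S /\ e_T = shuffle_sign S T *: e_(S :|: T) when S and T are disjoint *)
Definition shuffle_sign (S T : {set 'I_n}) : R :=
  (-1) ^+
    #|[pred p : 'I_n * 'I_n | [&& p.1 \in S, p.2 \in T & (p.2 < p.1)%N]]|.

Definition ext_wedge (x y : ext) : ext :=
  [ffun S : {set 'I_n} =>
     \sum_(T : {set 'I_n} | T \subset S)
        shuffle_sign T (S :\: T) * x T * y (S :\: T)].

Definition ext_gen (i : 'I_n) : ext :=
  [ffun S : {set 'I_n} => (S == [set i]%SET)%:R].

(* contraction by the i-th element of the dual basis: the odd derivation of
   ext_wedge sending e_j to (i == j)%:R *)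
Definition ext_contract (i : 'I_n) (x : ext) : ext :=
  [ffun S : {set 'I_n} =>
     if i \in S then 0 else shuffle_sign [set i]%SET S * x (i |: S)%SET].

End Exterior.

Notation "x *w y" := (ext_wedge x y)
  (at level 40, left associativity) : ring_scope.

Section ExteriorTheory.
Import mathcomp.boot.finset.
Variables (R : comNzRingType) (n : nat).
Implicit Types x y z : ext R n.

Lemma wedgeDl x y z : (x + y) *w z = x *w z + y *w z.
Proof.
by apply/ffunP=> S; rewrite !ffunE -big_split; apply: eq_bigr => T _;
  rewrite !ffunE mulrDr mulrDl.
Qed.

Lemma wedgeDr x y z : z *w (x + y) = z *w x + z *w y.
Proof.
by apply/ffunP=> S; rewrite !ffunE -big_split; apply: eq_bigr => T _;
  rewrite !ffunE mulrDr.
Qed.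

Lemma wedgeZl c x y : (c *: x) *w y = c *: (x *w y).
Proof.
apply/ffunP=> S; rewrite !ffunE scaler_sumr; apply: eq_bigr => T _.
rewrite !ffunE; have E (a b d : R) : a * (c * b) * d = c * (a * b * d) by ring.
exact: E.
Qed.

Lemma wedgeZr c x y : x *w (c *: y) = c *: (x *w y).
Proof.
apply/ffunP=> S; rewrite !ffunE scaler_sumr; apply: eq_bigr => T _.
rewrite !ffunE; have E (a b d : R) : a * b * (c * d) = c * (a * b * d) by ring.
exact: E.
Qed.

Lemma wedge0l y : 0 *w y = 0.
Proof. by have := wedgeZl 0 0 y; rewrite !scale0r. Qed.

Lemma wedge0r y : y *w 0 = 0.
Proof. by have := wedgeZr 0 y 0; rewrite !scale0r. Qed.

Lemma wedge_suml (I : finType) (P : pred I) (F : I -> ext R n) y :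
  (\sum_(i | P i) F i) *w y = \sum_(i | P i) F i *w y.
Proof. by elim/big_rec2: _ => [|i u v _ <-]; rewrite ?wedge0l ?wedgeDl. Qed.

Lemma wedge_sumr (I : finType) (P : pred I) (F : I -> ext R n) y :
  y *w (\sum_(i | P i) F i) = \sum_(i | P i) y *w F i.
Proof. by elim/big_rec2: _ => [|i u v _ <-]; rewrite ?wedge0r ?wedgeDr. Qed.

Lemma shuffle_sign1 (i : 'I_n) (S : {set 'I_n}) :
  shuffle_sign R [set i]%SET S = (-1) ^+ #|[set j in S | (j < i)%N]%SET|.
Proof.
rewrite /shuffle_sign; congr (_ ^+ _).
rewrite -(@card_imset _ _ (fun j => (i, j))) => [|? ? []//].
apply: eq_card => -[a b]; rewrite !inE /=.
apply/and3P/imsetP => [[/eqP -> bS ba]|[j]].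
  by exists b => //; rewrite !inE bS.
by rewrite !inE => /andP[? ?] [-> ->].
Qed.

Lemma ext_genE (i : 'I_n) S : ext_gen R i S = (S == [set i]%SET)%:R.
Proof. by rewrite /ext_gen ffunE. Qed.

Lemma wedge_gen (i : 'I_n) x : ext_gen R i *w x =
  [ffun S : {set 'I_n} =>
    if i \in S then shuffle_sign R [set i]%SET (S :\ i) * x (S :\ i) else 0].
Proof.
apply/ffunP=> S; rewrite !ffunE; case: ifPn => iS.
  rewrite (bigD1 [set i]%SET) /=; last by rewrite sub1set.
  rewrite ext_genE eqxx mulr1 big1 ?addr0 //.
  by move=> T /andP[_ /negbTE h]; rewrite ext_genE h mulr0 mul0r.
rewrite big1 // => T TS; rewrite ext_genE.
case: eqP => [E|]; last by rewrite mulr0 mul0r.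
by move: TS; rewrite E sub1set (negbTE iS).
Qed.

Lemma wedge_gen2 (a b : 'I_n) : ext_gen R a *w ext_gen R b =
  [ffun S : {set 'I_n} =>
     if (a != b) && (S == [set a; b]%SET) then (-1) ^+ (b < a)%N else 0].
Proof.
apply/ffunP=> S; rewrite wedge_gen !ffunE.
have [aS|naS] /= := boolP (a \in S); last first.
  by case: (S =P [set a; b]%SET); rewrite ?andbF // => E;
    move: naS; rewrite E !inE eqxx.
have [ab|ab] /= := eqVneq a b.
  rewrite -ab; case: eqP => [E|_]; last by rewrite mulr0.
  have := setD11 a S; by rewrite E set11.
have -> : (S :\ a == [set b]%SET) = (S == [set a; b]%SET).
  apply/eqP/eqP => [<-|->]; first by rewrite setD1K.
  by apply/setP=> j; rewrite !inE; case: (eqVneq j a) => //= ->;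
    rewrite (negbTE ab).
case: eqP => [->|_]; last by rewrite mulr0.
rewrite mulr1 shuffle_sign1; congr (_ ^+ _).
case: (ltnP b a) => h.
  rewrite (_ : [set _ in _ | _]%SET = [set b]%SET) ?cards1 //.
  apply/setP=> j; rewrite !inE.
  case: (eqVneq j b) => [->|jb] /=; last by case: (j == a).
  by rewrite h eq_sym ab /= ?orbT.
rewrite (_ : [set _ in _ | _]%SET = set0%SET) ?cards0 //.
apply/setP=> j; rewrite !inE; case: (eqVneq j b) => [->|jb] /=.
  by rewrite ltnNge h andbF.
by case: (j == a).
Qed.

Lemma wedge_genC (a b : 'I_n) :
  ext_gen R a *w ext_gen R b = - (ext_gen R b *w ext_gen R a).
Proof.
rewrite !wedge_gen2; apply/ffunP=> S; rewrite !ffunE setUC [b == a]eq_sym.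
case: eqVneq => /= ab; first by rewrite oppr0.
case: ifP => _; last by rewrite oppr0.
case: (ltngtP a b) => h /=; rewrite ?expr0 ?expr1 ?opprK //.
by move: ab; rewrite (val_inj h) eqxx.
Qed.

Lemma contractD (i : 'I_n) x y :
  ext_contract i (x + y) = ext_contract i x + ext_contract i y.
Proof. by apply/ffunP=> S; rewrite !ffunE; case: ifP; rewrite ?addr0 // mulrDr. Qed.

Lemma contractZ (i : 'I_n) (c : R) x :
  ext_contract i (c *: x) = c *: ext_contract i x.
Proof.
apply/ffunP=> S; rewrite !ffunE; case: ifP; rewrite ?scaler0 // => _.
exact: mulrCA.
Qed.

Lemma contract0 (i : 'I_n) : ext_contract i (0 : ext R n) = 0.
Proof. by have := contractZ i 0 0; rewrite !scale0r. Qed.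

Lemma contract_sum (i : 'I_n) (I : finType) (P : pred I) (F : I -> ext R n) :
  ext_contract i (\sum_(k | P k) F k) = \sum_(k | P k) ext_contract i (F k).
Proof. by elim/big_rec2: _ => [|k u v _ <-]; rewrite ?contract0 ?contractD. Qed.

Lemma contract_gen2 (i a b : 'I_n) :
  ext_contract i (ext_gen R a *w ext_gen R b) =
    (i == a)%:R *: ext_gen R b - (i == b)%:R *: ext_gen R a.
Proof.
have main (c d : 'I_n) : c != d ->
  ext_contract c (ext_gen R c *w ext_gen R d) = ext_gen R d.
  move=> cd; rewrite wedge_gen; apply/ffunP=> S; rewrite !ffunE setU11.
  have [cS|cS] := boolP (c \in S).
    case: eqP => // E; by move: cS; rewrite E inE (negbTE cd).
  by rewrite setU1K // mulrA -expr2 /shuffle_sign sqrr_sign mul1r.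
have [ab|ab] := eqVneq a b.
  rewrite -ab subrr wedge_gen2; apply/ffunP=> S; rewrite !ffunE eqxx /=.
  by rewrite mulr0 if_same.
have [->|ia] := eqVneq i a.
  by rewrite (negbTE ab) scale1r scale0r subr0 main.
have [->|ib] := eqVneq i b.
  rewrite scale0r scale1r sub0r wedge_genC -scaleN1r contractZ main ?scaleN1r //.
  by rewrite eq_sym.
rewrite !scale0r subr0 wedge_gen2; apply/ffunP=> S; rewrite !ffunE.
case: ifP => // _; case: (_ =P [set a; b]%SET); rewrite ?andbF ?mulr0 // => E.
by have := setU11 i S; rewrite E !inE (negbTE ia) (negbTE ib).
Qed.
End ExteriorTheory.

Section ExteriorLie.
Variables (R : realType) (g : quadLie R) (n : nat) (e e' : n.-tuple g).

Definition ext_inj (v : g) : ext R n := \sum_i coord e i v *: ext_gen R i.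

(* On decomposables this is the usual formula
     [x_1 /\ ... /\ x_k, y_1 /\ ... /\ y_l] =
       \sum_(i, j) (-1)^(i+j) [x_i, y_j] /\ x_1 .. (omit x_i) .. x_k
                                          /\ y_1 .. (omit y_j) .. y_l.
   See schouten_bivector below for the formula on bivectors. *)
Definition schouten (x y : ext R n) : ext R n :=
  \sum_(i < n) \sum_(j < n)
    ext_inj (bracket e`_i e`_j) *w ext_contract i x *w ext_contract j y.

(* e' is meant to be the basis dual to e with respect to Bform *)
Definition lambda_ext (A : 'End(g)) : ext R n :=
  2^-1 *: \sum_(a < n) ext_inj (A e`_a) *w ext_inj e'`_a.

Definition Theta_ext : ext R n :=
  - (6^-1 *: \sum_(a < n) \sum_(b < n) \sum_(c < n)
      Bform e'`_a (bracket e'`_b e'`_c) *: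
        (ext_inj e`_a *w ext_inj e`_b *w ext_inj e`_c)).

Definition partial (r : g -> ext R n) (a : 'I_n) (mu : g) : ext R n :=
  [ffun S => derive1 (fun t : R => r (mu + t *: e`_a) S) 0].

Definition has_partials (r : g -> ext R n) (mu : g) : Prop :=
  forall (a : 'I_n) (S : {set 'I_n}),
    derivable (fun t : R => r (mu + t *: e`_a) S) 0 1.

(* power series in the coordinates relative to e that converge absolutely
   everywhere; words t of length k index the monomials of degree k *)
Definition monomial (t : seq 'I_n) (x : g) : R := \prod_(i <- t) coord e i x.

Definition entire (F : g -> R) : Prop :=
  exists c : seq 'I_n -> R, forall x : g,
    cvgn (series (fun k => \sum_(t : k.-tuple 'I_n) `|c t * monomial t x|)) /\
    series (fun k => \sum_(t : k.-tuple 'I_n) c t * monomial t x) @ \oo --> F x.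

(* quotient of entire functions, with the denominator not vanishing on U *)
Definition meromorphic (U : set g) (r : g -> ext R n) : Prop :=
  exists (h : g -> R) (N : g -> ext R n),
    [/\ entire h, forall S, entire (fun x => N x S) &
        forall x, U x -> h x != 0 /\ h x *: r x = N x].

End ExteriorLie.

(* x is the bivector 1/2 sum_(ab) r^(ab) e_a /\ e_b, and
   coord e b (bracket e_k e_l) is the structure constant f_(kl)^b *)
Section SchoutenBivector.
Variables (R : realType) (g : quadLie R) (n : nat) (e : n.-tuple g).

Lemma contract_bivector (r : 'I_n -> 'I_n -> R) (i : 'I_n) :
  (forall a b, r b a = - r a b) ->
  ext_contract i (2^-1 *: \sum_(a < n) \sum_(b < n)
      r a b *: (ext_gen R a *w ext_gen R b)) = \sum_(b < n) r i b *: ext_gen R b.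
Proof.
move=> rC; rewrite contractZ contract_sum.
under eq_bigr => a _ do rewrite contract_sum.
under eq_bigr => a _ do under eq_bigr => b _ do
  rewrite contractZ contract_gen2 scalerBr !scalerA !mulr_natr.
under eq_bigr => a _ do rewrite sumrB.
rewrite sumrB exchange_big /=.
set S := \sum_(b < n) r i b *: _.
have E1 : \sum_(j < n) \sum_(k < n) (r k j *+ (i == k)) *: ext_gen R j = S.
  apply: eq_bigr => j _; rewrite (bigD1 i) //= eqxx big1 ?addr0 // => k ki.
  by rewrite eq_sym (negbTE ki) mulr0n scale0r.
rewrite E1.
have -> : \sum_(j < n) \sum_(k < n) (r j k *+ (i == k)) *: ext_gen R j = - S.
  rewrite -sumrN; apply: eq_bigr => j _.
  rewrite (bigD1 i) //= eqxx (rC i j) big1 ?addr0 ?mulr1n ?scaleNr // => k ki.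
  by rewrite eq_sym (negbTE ki) mulr0n scale0r.
rewrite opprK -[X in X + _]scale1r -[X in _ + X]scale1r -scalerDl scalerA mulVf ?scale1r //.
Qed.

Lemma schouten_bivector (r : 'I_n -> 'I_n -> R) :
  (forall a b, r b a = - r a b) ->
  let x := 2^-1 *: \sum_(a < n) \sum_(b < n)
             r a b *: (ext_gen R a *w ext_gen R b) in
  schouten e x x =
    \sum_(a < n) \sum_(b < n) \sum_(c < n) \sum_(k < n) \sum_(l < n)
      (r a k * coord e b (bracket e`_k e`_l) * r l c)
        *: (ext_gen R a *w ext_gen R b *w ext_gen R c).
Proof.
move=> rC x; rewrite /schouten.
transitivity (\sum_(k < n) \sum_(l < n) \sum_(a < n) \sum_(b < n) \sum_(c < n)
      (r a k * coord e b (bracket e`_k e`_l) * r l c)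
        *: (ext_gen R a *w ext_gen R b *w ext_gen R c)); last first.
  symmetry.
  have exch3 (F : 'I_n -> 'I_n -> 'I_n -> 'I_n -> ext R n) :
    \sum_(a < n) \sum_(b < n) \sum_(c < n) \sum_(k < n) F a b c k =
    \sum_(k < n) \sum_(a < n) \sum_(b < n) \sum_(c < n) F a b c k.
    under eq_bigr => a _ do under eq_bigr => b _ do rewrite exchange_big.
    under eq_bigr => a _ do rewrite exchange_big.
    by rewrite exchange_big.
  rewrite exch3; apply: eq_bigr => k _.
  by rewrite exch3.
apply: eq_bigr => k _; apply: eq_bigr => l _.
rewrite !contract_bivector // /ext_inj wedge_suml exchange_big /= wedge_suml.
apply: eq_bigr => b _; rewrite [X in X *w _]wedge_sumr wedge_suml; apply: eq_bigr => a _.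
rewrite wedge_sumr; apply: eq_bigr => c _.
rewrite !(wedgeZl, wedgeZr) wedge_genC -[X in X *w _]scaleN1r !(wedgeZl, wedgeZr).
rewrite !scalerA (rC a k); congr (_ *: _).
by ring.
Qed.

End SchoutenBivector.

Section FunctionalCalculus.
Variable R : realType.

(* M = f(A): on each generalized eigenspace ker (A - z)^m, M is the Taylor
   expansion of f at z applied to A.  (Row vectors: matrices act on the right.)
   The derivatives are complex derivatives. *)
Definition is_matrix_fun (f : R[i] -> R[i]) (n : nat) (A M : 'M[R[i]]_n) :=
  forall (z : R[i]) (m : nat) (v : 'rV[R[i]]_n),
    v *m (A - z%:M) ^+ m = 0 ->
    v *m M = \sum_(k < m)
      (derive1n k (f : R[i]^o -> R[i]^o) z / (k`!)%:R)
        *: (v *m (A - z%:M) ^+ k).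

Definition cplx_mx (n : nat) (A : 'M[R]_n) : 'M[R[i]]_n :=
  map_mx (real_complex R) A.

Variable V : vectType R.

Definition mx_of (A : 'End(V)) : 'M[R]_(\dim {:V}) :=
  passmx.mxof (vbasis {:V}) (vbasis {:V}) A.

Definition ceigenvalue (A : 'End(V)) (z : R[i]) : bool :=
  eigenvalue (cplx_mx (mx_of A)) z.

(* the real endomorphism f(A); junk value if there is none *)
Definition lfun_fun (f : R[i] -> R[i]) (A : 'End(V)) : 'End(V) :=
  passmx.hommx (vbasis {:V}) (vbasis {:V})
    (xget 0 [set M | is_matrix_fun f (cplx_mx (mx_of A)) (cplx_mx M)]).

End FunctionalCalculus.

Section ComplexFunctions.
Variable R : realType.

Definition cexp (z : R[i]) : R[i] :=
  (expR (complex.Re z) * cos (complex.Im z))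
    +i* (expR (complex.Re z) * sin (complex.Im z)).

Definition ccoth (z : R[i]) : R[i] :=
  (cexp z + cexp (- z)) / (cexp z - cexp (- z)).

(* the singularity of coth(z/2)/2 - 1/z at 0 is removable, with value 0 *)
Definition f_cdybe (z : R[i]) : R[i] :=
  if z == 0 then 0 else 2^-1 * ccoth (z / 2) - z^-1.

Definition poles : set R[i] :=
  [set z | exists2 k : int, k != 0 & z = 0 +i* (2 * pi * k%:~R)].

End ComplexFunctions.

Definition r_domain (R : realType) (g : quadLie R) : set g :=
  [set mu | forall z, ceigenvalue (ad mu) z -> ~ poles z].

Definition r_cdybe (R : realType) (g : quadLie R) (n : nat)
    (e e' : n.-tuple g) (mu : g) : ext R n :=
  lambda_ext e e' (lfun_fun (@f_cdybe R) (ad mu)).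

(* Main.v *)
Require Import Defs.
From HB Require Import structures.
From mathcomp Require Import all_boot all_order all_algebra.
From mathcomp Require Import complex ring lra.
From mathcomp Require Import all_classical all_reals all_analysis.
Import Order.TTheory GRing.Theory Num.Theory.
Import numFieldNormedType.Exports.
Set Implicit Arguments.
Unset Strict Implicit.
Unset Printing Implicit Defensive.
Local Open Scope classical_set_scope.
Local Open Scope ring_scope.


(** Write [j z = sinh (z / 2) / (z / 2)], an entire even function.  Its
    logarithmic derivative is [f = j' / j], so that with [A = ad mu],
    [J = j (A)] and [K = j' (A)] one has [f (A) = J^-1 K]: the poles of the
    r-matrix are the zeros of [det J], and this already gives the meromorphy,
    [det J] being a denominator and [adj J * K] the numerator.

    In terms of the invariant form [tau x y z = B [x, y] z] and of the skew
    operator [T = f (A)], the dynamical Yang-Baxter equation is the cyclic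
    identity
      [tau (T x) (T y) z + cyclic + tau x y z / 4 = B ((d_x T) y) z + cyclic].
    Formally, [A] acts on the three arguments of [tau] by commuting operators
    [a], [b], [c] with [a + b + c = 0], the derivative of [T] is a divided
    difference, and the identity reads
      [f a f b + f b f c + f c f a + 1/4 = - sum (f b + f c) / a],
    which is the addition theorem of coth.  But [A] always has a kernel, so the
    divisions by [a], [b], [c] make no sense.  They are avoided by scaling: put
    [s A] for [A].  The equation [z j'' + 2 j' = z j / 4] becomes a linear
    differential equation in [s] for [J], [K] and their derivatives [DJ], [DK] in
    the direction [ad x], and it follows, without any division, that
      [s^3 (KKJ + KJK + JKK + JJJ / 4) - s^2 sum m (x J; y, z)],
      [m (x; y, z) = B (y DK) (z J) + B (y DJ) (z K)],
    is constant in [s] ([first_integral_deriv]).  It vanishes at [s = 0]; at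
    [s = 1], after division by the invertible [J], this is the cyclic identity
    ([trilinear_identity]).

    Power series of matrices carry all the analysis.  The derivative of a series
    in the direction [X] is the corner of its value at a block triangular matrix,
    so that algebraic identities between series differentiate by themselves, and
    one second-order estimate ([mpser_taylor]) provides every derivative, real or
    complex, complex numbers being seen as real two by two matrices.

    It remains to identify [J^-1 K] with the functional calculus.  On a
    generalized eigenvector a power series in [A] is its Taylor expansion at the
    eigenvalue ([geneig_mpser]), the Taylor coefficients of [f] are those of the
    quotient [j' / j] ([quotient_leibniz]), and generalized eigenvectors span
    ([geneig_ind]).  Finally, both sides of the equation are sums of a trilinear
    form over the basis trivectors, where only the cyclic antisymmetric part of
    the form survives ([cdybe_of_trilinear]). *)

(** * Finite sums, powers and norms of matrices *)

Section FiniteSums.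

Lemma sum_ord_vanish (V : zmodType) (F : nat -> V) a b :
  (forall i, (a <= i)%N -> F i = 0) -> \sum_(i < a + b) F i = \sum_(i < a) F i.
Proof.
move=> h; rewrite big_split_ord /= [X in _ + X]big1 ?addr0 // => i _.
by rewrite h // leq_addr.
Qed.

(** Cauchy's rearrangement of a product of two finite expansions in powers [w p]
    of an operator that vanish from degree [m] on. *)
Lemma truncated_cauchy (F : fieldType) (V : lmodType F) (m : nat) (a b : nat -> F)
    (w : nat -> V) : (forall p, (m <= p)%N -> w p = 0) ->
  \sum_(k < m) \sum_(l < m) (a k * b l) *: w (k + l)%N =
  \sum_(p < m) (\sum_(k < p.+1) a k * b (p - k)%N) *: w p.
Proof.
move=> hw.
transitivity (\sum_(k < m) \sum_(p < m | (k <= p)%N) (a k * b (p - k)%N) *: w p).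
  apply: eq_bigr => k _.
  pose G p := (a k * b (p - k)%N) *: w p.
  transitivity (\sum_(l < m) G (k + l)%N).
    by apply: eq_bigr => l _; rewrite /G addKn.
  have km : (k <= m)%N := ltnW (ltn_ord k).
  transitivity (\sum_(l < m - k) G (k + l)%N).
    have := @sum_ord_vanish V (fun l => G (k + l)%N) (m - k) k.
    rewrite subnK // => -> // l hl.
    by rewrite /G hw ?scaler0 // -leq_subLR.
  rewrite -(big_mkord (fun p => (k <= p)%N) G).
  rewrite -(big_mkord xpredT (fun l => G (k + l)%N)).
  rewrite [RHS](big_cat_nat (n := k)) //= [X in _ = X + _]big_nat_cond.
  rewrite [X in _ = X + _]big1 ?add0r.
    have := @big_addn _ 0 +%R 0%N m k (fun p => (k <= p)%N) G.
    rewrite add0n => ->; apply: congr_big_nat => // l _ /=.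
    + by rewrite leq_addl.
    + by rewrite addnC.
  by move=> p /andP[/andP[_ pk]]; rewrite leqNgt pk.
rewrite (exchange_big_dep xpredT) //=; apply: eq_bigr => p _.
by rewrite scaler_suml (big_ord_widen_cond m (fun k => true)
  (fun k => (a k * b (p - k)%N) *: w p)).
Qed.

End FiniteSums.

Section MatrixPowers.
Variables (R : comNzRingType) (n : nat).
Implicit Types A : 'M[R]_n.

Lemma expmx0 A : A ^+ 0 = 1%:M. Proof. by []. Qed.

Lemma expmxS A k : A ^+ k.+1 = A *m A ^+ k. Proof. exact: exprS. Qed.

Lemma expmxSr A k : A ^+ k.+1 = A ^+ k *m A. Proof. exact: exprSr. Qed.

Lemma expmxD A k l : A ^+ (k + l) = A ^+ k *m A ^+ l. Proof. exact: exprD. Qed.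

Lemma expmxZ (c : R) A k : (c *: A) ^+ k = c ^+ k *: A ^+ k.
Proof.
elim: k => [|k IH]; first by rewrite scale1r.
by rewrite expmxS IH -scalemxAl -scalemxAr scalerA expmxS exprS.
Qed.

End MatrixPowers.

Section MatrixNorm.
Variable R : realType.

Definition mnorm m n (A : 'M[R]_(m, n)) : R := \sum_i \sum_j `|A i j|.

Lemma mnorm_ge0 m n (A : 'M[R]_(m, n)) : 0 <= mnorm A.
Proof. by apply: sumr_ge0 => i _; apply: sumr_ge0. Qed.

Lemma entry_le_mnorm m n (A : 'M[R]_(m, n)) i j : `|A i j| <= mnorm A.
Proof.
rewrite /mnorm (bigD1 i) //= (bigD1 j) //= -addrA lerDl addr_ge0 ?sumr_ge0 //.
by move=> k _; apply: sumr_ge0.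
Qed.

Lemma mnormD m n (A B : 'M[R]_(m, n)) : mnorm (A + B) <= mnorm A + mnorm B.
Proof.
rewrite /mnorm -big_split; apply: ler_sum => i _.
by rewrite -big_split; apply: ler_sum => j _; rewrite mxE ler_normD.
Qed.

Lemma mnormZ m n (c : R) (A : 'M[R]_(m, n)) : mnorm (c *: A) = `|c| * mnorm A.
Proof.
rewrite /mnorm mulr_sumr; apply: eq_bigr => i _.
by rewrite mulr_sumr; apply: eq_bigr => j _; rewrite mxE normrM.
Qed.

Lemma mnormM m n p (A : 'M[R]_(m, n)) (B : 'M[R]_(n, p)) :
  mnorm (A *m B) <= mnorm A * mnorm B.
Proof.
rewrite /mnorm mulr_suml; apply: ler_sum => i _.
rewrite mulr_suml.
have -> : \sum_(k < n) `|A i k| * (\sum_k0 \sum_j `|B k0 j|) =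
   \sum_j \sum_(k < n) `|A i k| * (\sum_k0 `|B k0 j|).
  rewrite [RHS]exchange_big /=; apply: eq_bigr => k _.
  by rewrite -mulr_sumr exchange_big.
apply: ler_sum => j _; rewrite mxE (le_trans (ler_norm_sum _ _ _)) //.
apply: ler_sum => k _; rewrite normrM ler_wpM2l //.
by rewrite (bigD1 k) //= lerDl sumr_ge0.
Qed.

Lemma mnorm_exp n (A : 'M[R]_n) r k : mnorm A <= r ->
  mnorm (A ^+ k) <= mnorm (1%:M : 'M[R]_n) * r ^+ k.
Proof.
move=> Ar; have r0 := le_trans (mnorm_ge0 A) Ar.
elim: k => [|k IH]; first by rewrite expmx0 expr0 mulr1.
rewrite expmxS (le_trans (mnormM _ _)) // exprS mulrCA.
by apply: ler_pM; rewrite ?mnorm_ge0.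
Qed.

End MatrixNorm.

Section MatrixLimits.
Variable R : realType.
Implicit Types m n p : nat.

Lemma cvg_fsum (I : Type) (s : seq I) (P : pred I) (F : I -> nat -> R)
    (l : I -> R) :
  (forall i, P i -> F i @ \oo --> l i) ->
  (fun k => \sum_(i <- s | P i) F i k) @ \oo --> \sum_(i <- s | P i) l i.
Proof.
move=> h; elim: s => [|i s IH].
  rewrite big_nil (_ : (fun _ => _) = fun=> 0); first exact: cvg_cst.
  by apply/funext => k; rewrite big_nil.
rewrite big_cons; under eq_fun do rewrite big_cons.
by case: ifP => // Pi; apply: cvgD => //; apply: h.
Qed.

(** Entrywise, so that matrices with an empty dimension need no separate
    treatment. *)
Definition mcvg m n (F : nat -> 'M[R]_(m, n)) (L : 'M[R]_(m, n)) : Prop :=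
  forall i j, (fun k => F k i j) @ \oo --> L i j.

Lemma mcvg_unique m n (F : nat -> 'M[R]_(m, n)) L1 L2 :
  mcvg F L1 -> mcvg F L2 -> L1 = L2.
Proof.
by move=> h1 h2; apply/matrixP => i j; apply: cvg_unique (h1 i j) (h2 i j).
Qed.

Lemma mcvgD m n (F G : nat -> 'M[R]_(m, n)) L1 L2 :
  mcvg F L1 -> mcvg G L2 -> mcvg (fun k => F k + G k) (L1 + L2).
Proof.
move=> h1 h2 i j; rewrite mxE.
rewrite (_ : (fun _ => _) = (fun k => F k i j) \+ (fun k => G k i j)).
  exact: cvgD.
by apply/funext => k; rewrite mxE.
Qed.

Lemma mcvgMl m n p (B : 'M[R]_(m, n)) (F : nat -> 'M[R]_(n, p)) L :
  mcvg F L -> mcvg (fun k => B *m F k) (B *m L).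
Proof.
move=> h i j; rewrite mxE.
rewrite (_ : (fun _ => _) = fun k => \sum_l B i l * F k l j); last first.
  by apply/funext => k; rewrite mxE.
by apply: cvg_fsum => l _; apply: cvgMl_tmp.
Qed.

Lemma mcvgMr m n p (F : nat -> 'M[R]_(m, n)) L (B : 'M[R]_(n, p)) :
  mcvg F L -> mcvg (fun k => F k *m B) (L *m B).
Proof.
move=> h i j; rewrite mxE.
rewrite (_ : (fun _ => _) = fun k => \sum_l F k i l * B l j); last first.
  by apply/funext => k; rewrite mxE.
by apply: cvg_fsum => l _; apply: cvgMr_tmp.
Qed.

Lemma mcvgZ m n (c : R) (F : nat -> 'M[R]_(m, n)) L :
  mcvg F L -> mcvg (fun k => c *: F k) (c *: L).
Proof.
move=> h i j; rewrite mxE.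
rewrite (_ : (fun _ => _) = fun k => c * F k i j); first exact: cvgMl_tmp.
by apply/funext => k; rewrite mxE.
Qed.

End MatrixLimits.

(** * Power series of matrices *)

Section MatrixPowerSeries.
Variable R : realType.
Implicit Types (u v : nat -> R) (n : nat).

(** A class of coefficients that contains those of [exp] and of [j] and is
    stable under differentiation; it makes every series entire. *)
Definition exp_bounded u := forall k, `|u k| <= k`!%:R^-1.

Definition mpsum u n (A : 'M[R]_n) (N : nat) : 'M[R]_n :=
  \sum_(k < N) u k *: A ^+ k.

Definition mpser u n (A : 'M[R]_n) : 'M[R]_n :=
  \matrix_(i, j) limn (fun N => mpsum u A N i j).

Lemma mpsum_entry u n (A : 'M[R]_n) N i j :
  mpsum u A N i j = series (fun k => u k * (A ^+ k) i j) N.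
Proof.
rewrite /mpsum summxE /series /= big_mkord.
by apply: eq_bigr => k _; rewrite mxE.
Qed.

Lemma exp_partial_sum_le (r : R) N : 0 <= r ->
  \sum_(k < N) r ^+ k / k`!%:R <= expR r.
Proof.
move=> r0; rewrite /expR.
have := @nondecreasing_cvgn_le R (series (exp_coeff r)).
rewrite /series /= => h; rewrite -(big_mkord xpredT (fun k => r ^+ k / k`!%:R)).
apply: h; last exact: is_cvg_series_exp_coeff.
apply/nondecreasing_seqP => k; rewrite big_nat_recr //= lerDl.
exact: exp_coeff_ge0.
Qed.

Lemma mpser_cvg u n (A : 'M[R]_n) : exp_bounded u -> mcvg (mpsum u A) (mpser u A).
Proof.
move=> hu i j; rewrite mxE.
have -> : (fun N => mpsum u A N i j) = series (fun k => u k * (A ^+ k) i j).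
  by apply/funext => N; rewrite mpsum_entry.
apply/cvg_ex; apply/cvg_ex; apply: normed_cvg.
pose c := mnorm (1%:M : 'M[R]_n).
apply: (@series_le_cvg _ _ (c *: exp_coeff (mnorm A) : R^nat)).
- by move=> k; rewrite /=.
- move=> k; apply: mulr_ge0; first exact: mnorm_ge0.
  by apply: exp_coeff_ge0; apply: mnorm_ge0.
- move=> k /=; rewrite normrM /exp_coeff /= fctE.
  rewrite -[_ *: _]/(c * _) mulrA [leRHS]mulrC; apply: ler_pM => //.
  by rewrite (le_trans (entry_le_mnorm _ _ _)) // mnorm_exp.
- by apply: is_cvg_seriesZ; apply: is_cvg_series_exp_coeff.
Qed.

Lemma mpser_lim u n (A L : 'M[R]_n) : exp_bounded u ->
  mcvg (mpsum u A) L -> mpser u A = L.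
Proof. by move=> hu; apply: mcvg_unique; apply: mpser_cvg. Qed.

(** Rectangular intertwiners make this lemma serve for commutation, for
    adjunction with respect to a bilinear form, and for block matrices. *)
Lemma mpser_intertwine u m n (A : 'M[R]_m) (B : 'M[R]_n) (P : 'M[R]_(m, n)) :
  exp_bounded u -> A *m P = P *m B -> mpser u A *m P = P *m mpser u B.
Proof.
move=> hu AP; apply: (@mcvg_unique _ _ _ (fun N => mpsum u A N *m P)).
  by apply: mcvgMr; apply: mpser_cvg.
have hk k : A ^+ k *m P = P *m B ^+ k.
  elim: k => [|k IH].
    by rewrite !expmx0 mul1mx mulmx1.
  by rewrite !expmxSr -mulmxA AP mulmxA IH mulmxA.
rewrite (_ : (fun _ => _) = fun N => P *m mpsum u B N).
  by apply: mcvgMl; apply: mpser_cvg.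
apply/funext => N; rewrite /mpsum mulmx_suml mulmx_sumr.
by apply: eq_bigr => k _; rewrite -scalemxAl -scalemxAr hk.
Qed.

Lemma mpser_comm u n (A : 'M[R]_n) : exp_bounded u ->
  mpser u A *m A = A *m mpser u A.
Proof. by move=> hu; apply: mpser_intertwine. Qed.

Lemma mpser_tr u n (M : 'M[R]_n) : exp_bounded u -> mpser u M^T = (mpser u M)^T.
Proof.
move=> hu; apply: mpser_lim => // i k; rewrite mxE.
rewrite (_ : (fun _ => _) = fun N => mpsum u M N k i).
  exact: (@mpser_cvg u _ M hu k i).
have trX l : M^T ^+ l = (M ^+ l)^T.
  elim: l => [|l IH]; first by rewrite !expmx0 trmx1.
  by rewrite expmxSr expmxS IH trmx_mul.
apply/funext => N; rewrite /mpsum !summxE; apply: eq_bigr => l _.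
by rewrite trX !mxE.
Qed.

Lemma mpser0 u n : exp_bounded u -> mpser u (0 : 'M[R]_n) = (u 0%N)%:M.
Proof.
move=> hu; apply: mpser_lim => // i j.
apply: cvg_near_cst; exists 1%N => // -[|N] //= _;
rewrite /mpsum big_ord_recl big1 ?addr0; last first.
  by move=> k _; rewrite expr0n /= scaler0.
by rewrite expmx0 scalemx1.
Qed.

End MatrixPowerSeries.

(** * Derivatives of matrix power series *)

Section PowerSeriesDerivative.
Variable R : realType.
Implicit Types (u v : nat -> R) (n : nat).

(** The derivative of [A ^+ k] in the direction [X], that is the sum of the
    [A ^+ i X A ^+ (k - 1 - i)]. *)
Fixpoint dpow n (A X : 'M[R]_n) k : 'M[R]_n :=
  if k is k'.+1 then A *m dpow A X k' + X *m A ^+ k' else 0.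

Lemma block_triag_exp n (A X : 'M[R]_n) k :
  block_mx A X 0 A ^+ k = block_mx (A ^+ k) (dpow A X k) 0 (A ^+ k).
Proof.
elim: k => [|k IH]; first by rewrite !expmx0 -scalar_mx_block.
rewrite expmxS IH mulmx_block !mul0mx !mulmx0 !addr0 add0r /=.
by rewrite -!expmxS.
Qed.

Lemma dpowP n (A X Y : 'M[R]_n) (c : R) k :
  dpow A (c *: X + Y) k = c *: dpow A X k + dpow A Y k.
Proof.
elim: k => [|k IH] /=; first by rewrite scaler0 addr0.
rewrite IH mulmxDr mulmxDl -scalemxAr -scalemxAl scalerDr.
by rewrite !addrA; congr (_ + _); rewrite -!addrA; congr (_ + _); rewrite addrC.
Qed.

(** The derivative of [mpser u] at [A] in the direction [X], read off from
    the value of the same series at a block triangular matrix: this makes every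
    algebraic identity between power series an identity between derivatives. *)
Definition mpserD u n (A X : 'M[R]_n) : 'M[R]_n :=
  ursubmx (mpser u (block_mx A X 0 A)).

Lemma mpsum_block u n (A X : 'M[R]_n) N :
  mpsum u (block_mx A X 0 A) N =
    block_mx (mpsum u A N) (\sum_(k < N) u k *: dpow A X k) 0 (mpsum u A N).
Proof.
rewrite /mpsum; elim: N => [|N IH]; first by rewrite !big_ord0 block_mx_const.
rewrite !big_ord_recr /= IH block_triag_exp scale_block_mx add_block_mx.
by rewrite scaler0 addr0.
Qed.

Lemma mpserD_cvg u n (A X : 'M[R]_n) : exp_bounded u ->
  mcvg (fun N => \sum_(k < N) u k *: dpow A X k) (mpserD u A X).
Proof.
move=> hu i j; rewrite !mxE.
rewrite (_ : (fun _ => _) =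
    (fun N => mpsum u (block_mx A X 0 A) N (lshift n i) (rshift n j))).
  by have := @mpser_cvg _ u _ (block_mx A X 0 A) hu (lshift n i) (rshift n j); rewrite mxE.
by apply/funext => N; rewrite mpsum_block block_mxEur.
Qed.

Lemma mpser_block u n (A X : 'M[R]_n) : exp_bounded u ->
  mpser u (block_mx A X 0 A) =
    block_mx (mpser u A) (mpserD u A X) 0 (mpser u A).
Proof.
move=> hu; apply: mpser_lim => // i j.
rewrite (_ : (fun _ => _) = (fun N => block_mx (mpsum u A N)
    (\sum_(k < N) u k *: dpow A X k) 0 (mpsum u A N) i j)); last first.
  by apply/funext => N; rewrite mpsum_block.
case: (split_ordP i) => k ->; case: (split_ordP j) => l ->.
- rewrite block_mxEul; under eq_fun do rewrite block_mxEul; exact: mpser_cvg.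
- rewrite block_mxEur; under eq_fun do rewrite block_mxEur; exact: mpserD_cvg.
- rewrite block_mxEdl; under eq_fun do rewrite block_mxEdl.
  by rewrite mxE; exact: cvg_cst.
- rewrite block_mxEdr; under eq_fun do rewrite block_mxEdr; exact: mpser_cvg.
Qed.

Lemma mpserDP u n (A X Y : 'M[R]_n) (c : R) : exp_bounded u ->
  mpserD u A (c *: X + Y) = c *: mpserD u A X + mpserD u A Y.
Proof.
move=> hu; apply: (@mcvg_unique _ _ _ (fun N => \sum_(k < N) u k *: dpow A (c *: X + Y) k)).
  exact: mpserD_cvg.
rewrite (_ : (fun _ => _) = fun N => c *: (\sum_(k < N) u k *: dpow A X k) +
   \sum_(k < N) u k *: dpow A Y k).
  by apply: mcvgD; [apply: mcvgZ|]; apply: mpserD_cvg.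
apply/funext => N; rewrite scaler_sumr -big_split; apply: eq_bigr => k _ /=.
by rewrite dpowP scalerDr !scalerA mulrC.
Qed.

Lemma mpserDZ u n (A X : 'M[R]_n) (c : R) : exp_bounded u ->
  mpserD u A (c *: X) = c *: mpserD u A X.
Proof.
move=> hu; have h0 : mpserD u A 0 = 0.
  have := mpserDP A 0 0 (-1) hu; rewrite scaler0 addr0 scaleN1r.
  by rewrite addNr.
by have := mpserDP A X 0 c hu; rewrite h0 !addr0.
Qed.

(** Conjugation by a unipotent block matrix moves [diag(A, A)] in the direction
    of a commutator with [A]. *)
Lemma mpserD_commutator u n (A X : 'M[R]_n) : exp_bounded u ->
  mpserD u A (A *m X - X *m A) = mpser u A *m X - X *m mpser u A.
Proof.
move=> hu.
have h : row_mx 1%:M X *m block_mx A (A *m X - X *m A) 0 A = A *m row_mx 1%:M X.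
  rewrite mul_row_block mul_mx_row !mul1mx !mulmx1 mulmx0 addr0.
  by rewrite subrK.
have := mpser_intertwine hu (esym h).
rewrite mpser_block // mul_row_block mul_mx_row !mul1mx => /(congr1 rsubmx).
by rewrite !row_mxKr => ->; rewrite addrK.
Qed.

Lemma mnorm_dpow n (A X : 'M[R]_n) r k : 1 <= r -> mnorm A <= r ->
  mnorm (dpow A X k) <= mnorm X * (mnorm (1%:M : 'M[R]_n) * (k%:R * r ^+ k)).
Proof.
move=> r1 Ar; have r0 : 0 <= r by apply: le_trans r1.
elim: k => [|k IH] /=.
  rewrite !mul0r !mulr0 /mnorm big1 // => i _; rewrite big1 // => j _.
  by rewrite mxE normr0.
apply: le_trans (mnormD _ _) _.
have h1 : mnorm (A *m dpow A X k) <=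
    r * (mnorm X * (mnorm (1%:M : 'M[R]_n) * (k%:R * r ^+ k))).
  by apply: le_trans (mnormM _ _) _; apply: ler_pM; rewrite ?mnorm_ge0.
have h2 : mnorm (X *m A ^+ k) <= mnorm X * (mnorm (1%:M : 'M[R]_n) * r ^+ k.+1).
  apply: le_trans (mnormM _ _) _; apply: ler_wpM2l; first exact: mnorm_ge0.
  apply: le_trans (mnorm_exp _ Ar) _; apply: ler_wpM2l; first exact: mnorm_ge0.
  by rewrite exprS ler_peMl // exprn_ge0.
apply: le_trans (lerD h1 h2) _; rewrite le_eqVlt; apply/orP; left; apply/eqP.
by rewrite -natr1 exprS; ring.
Qed.

(** Induction on [k]: the remainder [E k] of the first-order expansion satisfies
    [E (k + 1) = (A + X) E k + X dpow k]. *)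
Lemma mnorm_exp_second_order n (A X : 'M[R]_n) r k : 1 <= r ->
  mnorm A + mnorm X <= r ->
  mnorm ((A + X) ^+ k - A ^+ k - dpow A X k) <=
    mnorm X ^+ 2 * (mnorm (1%:M : 'M[R]_n) * (k%:R ^+ 2 * r ^+ k)).
Proof.
move=> r1 AXr; have r0 : 0 <= r by apply: le_trans r1.
have Ar : mnorm A <= r by apply: le_trans AXr; rewrite lerDl mnorm_ge0.
elim: k => [|k IH] /=.
  rewrite !expmx0 subrr subr0 expr0n /= !mul0r !mulr0 /mnorm big1 // => i _.
  by rewrite big1 // => j _; rewrite mxE normr0.
set E := (A + X) ^+ k - A ^+ k - dpow A X k in IH.
have -> : (A + X) ^+ k.+1 - A ^+ k.+1 - (A *m dpow A X k + X *m A ^+ k) =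
    (A + X) *m E + X *m dpow A X k.
  rewrite /E !expmxS !mulmxBr !mulmxDl.
  move: (A *m (A + X) ^+ k) (X *m (A + X) ^+ k) (A *m A ^+ k) (X *m A ^+ k).
  move: (A *m dpow A X k) (X *m dpow A X k) => a b c d e f.
  by apply/matrixP => i j; rewrite !mxE; ring.
have h1 : mnorm ((A + X) *m E) <=
    r * (mnorm X ^+ 2 * (mnorm (1%:M : 'M[R]_n) * (k%:R ^+ 2 * r ^+ k))).
  apply: le_trans (mnormM _ _) _; apply: ler_pM; rewrite ?mnorm_ge0 //.
  exact: le_trans (mnormD _ _) AXr.
have h2 : mnorm (X *m dpow A X k) <=
    mnorm X ^+ 2 * (mnorm (1%:M : 'M[R]_n) * (k%:R * r ^+ k.+1)).
  apply: le_trans (mnormM _ _) _; rewrite expr2 -mulrA.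
  apply: ler_wpM2l; first exact: mnorm_ge0.
  apply: le_trans (mnorm_dpow _ _ r1 Ar) _; apply: ler_wpM2l; first exact: mnorm_ge0.
  apply: ler_wpM2l; first exact: mnorm_ge0.
  apply: ler_wpM2l => //; by rewrite exprS ler_peMl // exprn_ge0.
apply: le_trans (mnormD _ _) _; apply: le_trans (lerD h1 h2) _.
rewrite -subr_ge0 (_ : _ - _ = mnorm X ^+ 2 * (mnorm (1%:M : 'M[R]_n) *
    (k.+1%:R * r ^+ k.+1))).
  by rewrite !mulr_ge0 ?exprn_ge0 ?mnorm_ge0.
by rewrite -natr1 [r ^+ k.+1]exprS; ring.
Qed.

Lemma sqr_le_exp4 k : (k%:R ^+ 2 : R) <= 4 ^+ k.
Proof.
rewrite -natrX (_ : 4 = (2 ^ 2)%:R) // -natrX ler_nat -expnM mulnC expnM.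
by rewrite leq_exp2r // ltnW // ltn_expl.
Qed.

(** The factor [k ^ 2] of [mnorm_exp_second_order] is absorbed in [4 ^ k], so that
    the remainder is bounded by an exponential. *)
Lemma mpser_taylor u n (A X : 'M[R]_n) r i j : exp_bounded u -> 1 <= r ->
  mnorm A + mnorm X <= r ->
  `|mpser u (A + X) i j - mpser u A i j - mpserD u A X i j| <=
    mnorm X ^+ 2 * (mnorm (1%:M : 'M[R]_n) * expR (4 * r)).
Proof.
move=> hu r1 AXr; have r0 : 0 <= r by apply: le_trans r1.
set C := leRHS.
pose F N : 'M[R]_n := \sum_(k < N) u k *: ((A + X) ^+ k - A ^+ k - dpow A X k).
have hF : mcvg F (mpser u (A + X) - mpser u A - mpserD u A X).
  rewrite (_ : F = fun N => mpsum u (A + X) N + (-1) *: mpsum u A N +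
       (-1) *: (\sum_(k < N) u k *: dpow A X k)); last first.
    apply/funext => N; rewrite !scaleN1r /F -!sumrB; apply: eq_bigr => k _.
    by rewrite !scalerBr.
  rewrite -[- mpser u A]scaleN1r -[- mpserD _ _ _]scaleN1r.
  apply: mcvgD; last by apply: mcvgZ; apply: mpserD_cvg.
  by apply: mcvgD; last apply: mcvgZ; apply: mpser_cvg.
have bF N : `|F N i j| <= C.
  rewrite /F summxE (le_trans (ler_norm_sum _ _ _)) //.
  apply: (@le_trans _ _ (\sum_(k < N)
     (mnorm X ^+ 2 * mnorm (1%:M : 'M[R]_n)) * ((4 * r) ^+ k / k`!%:R))).
  2: { rewrite -mulr_sumr /C mulrA ler_wpM2l //.
      by rewrite mulr_ge0 ?exprn_ge0 ?mnorm_ge0.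
    by apply: exp_partial_sum_le; rewrite mulr_ge0. }
  apply: ler_sum => k _; rewrite mxE normrM [leRHS]mulrA [leRHS]mulrC.
  apply: ler_pM => //; apply: le_trans (entry_le_mnorm _ _ _) _.
  apply: le_trans (mnorm_exp_second_order _ r1 AXr) _.
  rewrite -mulrA; apply: ler_wpM2l; first by rewrite exprn_ge0 ?mnorm_ge0.
  apply: ler_wpM2l; first exact: mnorm_ge0.
  by rewrite exprMn ler_wpM2r ?exprn_ge0 ?sqr_le_exp4.
have := hF i j; rewrite !mxE => /cvg_norm h.
apply: cvgr_to_le h _; exists 0%N => // N _ /=; exact: bF.
Qed.

End PowerSeriesDerivative.

(** Stated over any numeric field, to serve for the real derivatives along lines
    and for the complex derivatives. *)
Lemma is_derive_quadratic (K : numFieldType) (f : K^o -> K^o) (x d C : K) :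
  (forall h : K, `|h| <= 1 -> `|f (x + h) - f x - h * d| <= C * `|h| ^+ 2) ->
  is_derive (x : K^o) (1 : K^o) f d.
Proof.
move=> hf; have C0 : 0 <= C.
  by have := hf 1; rewrite normr1 expr1n mulr1 => /(_ (lexx _)); apply: le_trans.
suff h : (fun h : K^o => h^-1 *: ((f \o shift x) (h *: (1 : K^o)) - f x)) @ 0^'
    --> (d : K^o).
  by apply: DeriveDef; [apply/cvg_ex; exists d|apply/cvg_lim].
apply/cvgrPdist_le => e e0; near=> h.
have h0 : h != 0 by near: h; exact: nbhs_dnbhs_neq.
have h1 : `|h| <= 1 by near: h; apply: dnbhs0_le.
have h2 : `|h| <= e / (C + 1).
  by near: h; apply: dnbhs0_le; rewrite divr_gt0 // ltr_wpDl.
rewrite /= -[h *: 1]/(h * 1) mulr1 distrC.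
have -> : h^-1 *: (f (h + x) - f x) - d = h^-1 * (f (x + h) - f x - h * d).
  by rewrite mulrBr mulKf // [x + h]addrC.
rewrite normrM normfV ler_pdivrMl ?normr_gt0 //.
apply: le_trans (hf h h1) _; rewrite expr2 mulrCA ler_wpM2l //.
apply: (@le_trans _ _ ((C + 1) * `|h|)); first by rewrite ler_wpM2r // lerDl.
by rewrite mulrC -ler_pdivlMr // ltr_wpDl.
Unshelve. all: by end_near. Qed.

Section LineDerivative.
Variable R : realType.
Implicit Types (u : nat -> R) (n : nat).

Lemma mpser_is_derive u n (A X : 'M[R]_n) (s : R) i j : exp_bounded u ->
  is_derive s (1 : R) (fun t => mpser u (A + t *: X) i j)
    (mpserD u (A + s *: X) X i j).
Proof.
move=> hu; set B := A + s *: X; pose r := 1 + mnorm B + mnorm X.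
apply: (@is_derive_quadratic _ _ _ _
  (mnorm X ^+ 2 * (mnorm (1%:M : 'M[R]_n) * expR (4 * r)))) => t t1.
rewrite scalerDl addrA -/B.
have r1 : 1 <= r by rewrite /r -addrA lerDl addr_ge0 ?mnorm_ge0.
have h : mnorm B + mnorm (t *: X) <= r.
  rewrite mnormZ /r -addrA; apply: (@le_trans _ _ (mnorm B + mnorm X)).
    by rewrite lerD2l ler_piMl // mnorm_ge0.
  by rewrite lerDr.
have := mpser_taylor i j hu r1 h.
rewrite mpserDZ // [X in _ - X]mxE mnormZ => /le_trans; apply.
by rewrite exprMn -mulrA mulrC.
Qed.

End LineDerivative.

(** * Calculus of matrix-valued functions *)

Section DerivativeRules.
Variable K : numFieldType.

Lemma is_derive_prod (f g : K^o -> K^o) (f' g' s : K^o) :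
  is_derive s (1 : K^o) f f' -> is_derive s (1 : K^o) g g' ->
  is_derive s (1 : K^o) (fun t => (f t * g t : K)) (f' * g s + f s * g' : K).
Proof.
move=> hf hg; have := is_deriveM hf hg => /is_derive_eq; apply.
by rewrite -![_ *: _]/(_ * _) addrC mulrC.
Qed.

Lemma is_derive_fsum (n : nat) (F : 'I_n -> K^o -> K^o) (F' : 'I_n -> K^o) (s : K^o) :
  (forall i, is_derive s (1 : K^o) (F i) (F' i)) ->
  is_derive s (1 : K^o) (fun t => (\sum_i F i t : K^o)) (\sum_i F' i).
Proof.
move=> h; rewrite (_ : (fun t => _) = \sum_i F i); first exact: is_derive_sum.
by apply/funext => t; rewrite fct_sumE.
Qed.

End DerivativeRules.

Section MatrixDerivative.
Variable R : realType.

Definition mderiv m n (F : R -> 'M[R]_(m, n)) (s : R) (F' : 'M[R]_(m, n)) :=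
  forall i j, is_derive s (1 : R) (fun t => F t i j) (F' i j).

Lemma mderiv_cst m n (A : 'M[R]_(m, n)) s : mderiv (fun=> A) s 0.
Proof. by move=> i j; rewrite mxE; apply: is_derive_cst. Qed.

Lemma mderivM m n p (F : R -> 'M[R]_(m, n)) (G : R -> 'M[R]_(n, p)) s F' G' :
  mderiv F s F' -> mderiv G s G' ->
  mderiv (fun t => F t *m G t) s (F' *m G s + F s *m G').
Proof.
move=> hF hG i j; rewrite !mxE -big_split /=; under eq_fun do rewrite mxE.
by apply: is_derive_fsum => k; apply: is_derive_prod.
Qed.

Lemma mderivMl m n p (A : 'M[R]_(m, n)) (G : R -> 'M[R]_(n, p)) s G' :
  mderiv G s G' -> mderiv (fun t => A *m G t) s (A *m G').
Proof.
by move=> hG; have := mderivM (mderiv_cst A s) hG; rewrite mul0mx add0r.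
Qed.

Lemma mderivMr m n p (F : R -> 'M[R]_(m, n)) (A : 'M[R]_(n, p)) s F' :
  mderiv F s F' -> mderiv (fun t => F t *m A) s (F' *m A).
Proof.
by move=> hF; have := mderivM hF (mderiv_cst A s); rewrite mulmx0 addr0.
Qed.

Lemma mderivT m n (F : R -> 'M[R]_(m, n)) s F' :
  mderiv F s F' -> mderiv (fun t => (F t)^T) s (F'^T).
Proof. by move=> hF i j; rewrite mxE; under eq_fun do rewrite mxE; exact: hF. Qed.

(** A parameter may enter a matrix both through a linear argument and
    directly. *)
Lemma mderiv_linear_arg d m n (L : 'rV[R]_d -> R -> 'M[R]_(m, n))
    (L' : 'rV[R]_d -> 'M[R]_(m, n)) (p : R -> 'rV[R]_d) (p' : 'rV[R]_d) s :
  (forall c x y t, L (c *: x + y) t = c *: L x t + L y t) ->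
  (forall x, mderiv (L x) s (L' x)) -> mderiv p s p' ->
  mderiv (fun t => L (p t) t) s (L p' s + L' (p s)).
Proof.
move=> linL dL dp.
have L0 t : L 0 t = 0.
  by have := linL (-1) 0 0 t; rewrite scaler0 addr0 scaleN1r addNr.
have expand x t : L x t = \sum_i x 0 i *: L (delta_mx 0 i) t.
  rewrite {1}(row_sum_delta x); elim/big_ind2: _ => [|a b c e <- <-|i _].
  - exact: L0.
  - by have := linL 1 b e t; rewrite !scale1r.
  - by have := linL (x 0 i) (delta_mx 0 i) 0 t; rewrite L0 !addr0.
have expand' x : L' x = \sum_i x 0 i *: L' (delta_mx 0 i).
  apply/matrixP => i j; have h1 := dL x i j.
  have h2 : is_derive s (1 : R) (fun t => L x t i j)
      ((\sum_k x 0 k *: L' (delta_mx 0 k)) i j).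
    under eq_fun do rewrite expand summxE.
    rewrite summxE; apply: is_derive_fsum => k.
    under eq_fun do rewrite mxE; rewrite mxE.
    have := is_derive_prod (is_derive_cst (x 0 k) s 1) (dL (delta_mx 0 k) i j).
    by rewrite mul0r add0r.
  by rewrite -(derive_val (is_derive := h1)) -(derive_val (is_derive := h2)).
move=> i j; rewrite mxE expand expand' !summxE -big_split /=.
under eq_fun do rewrite expand summxE.
apply: is_derive_fsum => k; under eq_fun do rewrite mxE.
by rewrite !mxE; apply: is_derive_prod; [apply: dp | apply: dL].
Qed.

End MatrixDerivative.

Section DerivedSeries.
Variable R : realType.
Implicit Types (u : nat -> R) (n : nat).

Definition dcoef u k : R := k.+1%:R * u k.+1.

Lemma dcoef_bounded u : exp_bounded u -> exp_bounded (dcoef u).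
Proof.
move=> hu k; rewrite /dcoef normrM normr_nat.
have := hu k.+1; rewrite factS natrM invfM => h.
by rewrite -ler_pdivlMl ?ltr0n.
Qed.

Lemma mpsumS u n (A : 'M[R]_n) N :
  mpsum u A N.+1 = (u 0%N)%:M + A *m mpsum (fun k => u k.+1) A N.
Proof.
rewrite /mpsum big_ord_recl expmx0 scalemx1 mulmx_sumr; congr (_ + _).
by apply: eq_bigr => k _; rewrite -scalemxAr -expmxS.
Qed.

Lemma mpser_cvgS u n (A : 'M[R]_n) : exp_bounded u ->
  mcvg (fun N => mpsum u A N.+1) (mpser u A).
Proof.
move=> hu i j; have := @mpser_cvg _ u _ A hu i j.
by rewrite -(cvg_shiftS (fun N => mpsum u A N i j)).
Qed.

Lemma dpow_comm n (A X : 'M[R]_n) k : A *m X = X *m A ->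
  dpow A X k.+1 = k.+1%:R *: (A ^+ k *m X).
Proof.
move=> AX; elim: k => [|k IH].
  by rewrite /= !expmx0 mulmx0 add0r mulmx1 mul1mx scale1r.
have XA : X *m A ^+ k.+1 = A ^+ k.+1 *m X.
  elim: k.+1 => [|l IHl]; first by rewrite !expmx0 mulmx1 mul1mx.
  by rewrite expmxS mulmxA -AX -mulmxA IHl mulmxA.
rewrite -[LHS]/(A *m dpow A X k.+1 + X *m A ^+ k.+1) IH XA -scalemxAr.
by rewrite mulmxA -expmxS -[k.+2]addn1 natrD scalerDl scale1r.
Qed.

(** If [X] commutes with [A], the terms of each [dpow A X k] coincide. *)
Lemma mpserD_along_commutant u n (A X : 'M[R]_n) : exp_bounded u ->
  A *m X = X *m A -> mpserD u A X = mpser (dcoef u) A *m X.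
Proof.
move=> hu AX.
apply: (@mcvg_unique _ _ _ (fun N => \sum_(k < N.+1) u k *: dpow A X k)).
  move=> i j; have := @mpserD_cvg _ u _ A X hu i j.
  by rewrite -(cvg_shiftS (fun N => (\sum_(k < N) u k *: dpow A X k) i j)).
rewrite (_ : (fun _ => _) = fun N => mpsum (dcoef u) A N *m X).
  by apply: mcvgMr; apply: mpser_cvg; apply: dcoef_bounded.
apply/funext => N; rewrite big_ord_recl (_ : dpow A X _ = 0) // scaler0 add0r mulmx_suml.
apply: eq_bigr => k _; rewrite lift0 dpow_comm // scalerA.
by rewrite -scalemxAl /dcoef mulrC.
Qed.

Lemma mderiv_mpser_line u n (A X : 'M[R]_n) s : exp_bounded u ->
  mderiv (fun t => mpser u (A + t *: X)) s (mpserD u (A + s *: X) X).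
Proof. by move=> hu i j; apply: mpser_is_derive. Qed.

(** On the line through [0] and [A] the derivative of a series is [A] times a series
    in [A]: this is why scaling [A] leads to differential equations. *)
Lemma mderiv_mpser_scale u n (A : 'M[R]_n) s : exp_bounded u ->
  mderiv (fun t => mpser u (t *: A)) s (A *m mpser (dcoef u) (s *: A)).
Proof.
move=> hu; have := @mderiv_mpser_line u _ 0 A s hu; rewrite add0r.
rewrite mpserD_along_commutant //; last by rewrite -scalemxAl -scalemxAr.
under eq_fun do rewrite add0r.
rewrite (mpser_intertwine (B := s *: A) (P := A)) //; first exact: dcoef_bounded.
by rewrite -scalemxAl -scalemxAr.
Qed.

End DerivedSeries.

(** * The function sinh (z / 2) / (z / 2) *)

Section SinhcCoefficients.
Variable R : realType.
Implicit Types (n : nat).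

(** Taylor coefficients of [sinh (z / 2) / (z / 2)]. *)
Definition sinhc (k : nat) : R :=
  (2^-1 ^+ k.+1 - (- 2^-1) ^+ k.+1) / k.+1`!%:R.

Lemma sinhc_bounded : exp_bounded sinhc.
Proof.
move=> k; rewrite /sinhc normrM normfV normr_nat ler_pdivrMr ?ltr0n ?fact_gt0 //.
have h : `|2^-1 ^+ k.+1 - (- 2^-1) ^+ k.+1 : R| <= 1.
  apply: le_trans (ler_normB _ _) _; rewrite !normrX normrN.
  have -> : `|2^-1 : R| = 2^-1 by rewrite ger0_norm.
  rewrite -mulr2n exprS -mulrnAl -[2^-1 *+ 2]mulr_natr mulVf // mul1r.
  by rewrite exprn_ile1 // invf_le1 // ler1n.
apply: le_trans h _; rewrite factS natrM mulrC mulfK.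
  by rewrite ler1n.
by rewrite pnatr_eq0 -lt0n fact_gt0.
Qed.

Lemma dsinhc_bounded : exp_bounded (dcoef sinhc).
Proof. exact/dcoef_bounded/sinhc_bounded. Qed.

Lemma ddsinhc_bounded : exp_bounded (dcoef (dcoef sinhc)).
Proof. exact/dcoef_bounded/dsinhc_bounded. Qed.

Lemma sinhcN k : (-1) ^+ k * sinhc k = sinhc k.
Proof.
rewrite /sinhc mulrA; congr (_ / _); rewrite (exprNn 2^-1) !exprS -signr_odd.
by case: (odd k); rewrite ?expr0 ?expr1; ring.
Qed.

Lemma sinhc_rec k : k.+2%:R * k.+3%:R * sinhc k.+2 = 4^-1 * sinhc k.
Proof.
rewrite /sinhc !exprS !factS !natrM !invfM.
have h4 : (k`!%:R : R) != 0 by rewrite pnatr_eq0 -lt0n fact_gt0.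
by field; rewrite h4 nat1r -!natrD !pnatr_eq0.
Qed.

Lemma sinhc0 : sinhc 0 = 1.
Proof. by rewrite /sinhc !expr1 opprK -mulr2n -[_ *+ 2]mulr_natr mulVf // divr1. Qed.

Lemma sinhc1 : sinhc 1 = 0.
Proof. by rewrite /sinhc sqrrN subrr mul0r. Qed.

(** [z j'' + 2 j' = z j / 4], from [(z j)'' = z j / 4]. *)
Lemma sinhc_ode n (A : 'M[R]_n) :
  A *m mpser (dcoef (dcoef sinhc)) A =
    4^-1 *: (A *m mpser sinhc A) - 2 *: mpser (dcoef sinhc) A.
Proof.
apply: (@mcvg_unique _ _ _ (fun N => A *m mpsum (dcoef (dcoef sinhc)) A N)).
  by apply: mcvgMl; apply: mpser_cvg; apply: ddsinhc_bounded.
rewrite (_ : (fun _ => _) = fun N => 4^-1 *: (A *m mpsum sinhc A N) +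
    (- 2) *: mpsum (dcoef sinhc) A N.+1).
  rewrite -scaleNr; apply: mcvgD; apply: mcvgZ.
    by apply: mcvgMl; apply: mpser_cvg; apply: sinhc_bounded.
  exact/mpser_cvgS/dsinhc_bounded.
have d0 : dcoef sinhc 0 = 0 by rewrite /dcoef sinhc1 mulr0.
apply/funext => N; rewrite mpsumS d0 raddf0 add0r !scalemxAr.
rewrite -mulmxDr; congr (_ *m _); rewrite /mpsum !scaler_sumr -big_split.
apply: eq_bigr => k _ /=; rewrite !scalerA -scalerDl; congr (_ *: _).
by have := sinhc_rec k; rewrite /dcoef => <-; rewrite -!natr1; ring.
Qed.

Lemma mpser_sinhcN n (A : 'M[R]_n) : mpser sinhc (- A) = mpser sinhc A.
Proof.
apply: mpser_lim; first exact: sinhc_bounded.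
rewrite (_ : mpsum _ _ = mpsum sinhc A); first exact/mpser_cvg/sinhc_bounded.
apply/funext => N; apply: eq_bigr => k _.
by rewrite -[- A]scaleN1r expmxZ scalerA mulrC sinhcN.
Qed.

Lemma mpser_dsinhcN n (A : 'M[R]_n) :
  mpser (dcoef sinhc) (- A) = - mpser (dcoef sinhc) A.
Proof.
apply: mpser_lim; first exact: dsinhc_bounded.
rewrite (_ : mpsum _ _ = fun N => -1 *: mpsum (dcoef sinhc) A N).
  by rewrite -[- mpser _ _]scaleN1r; apply: mcvgZ; apply: mpser_cvg; apply: dsinhc_bounded.
apply/funext => N; rewrite scaler_sumr; apply: eq_bigr => k _.
rewrite -[- A]scaleN1r expmxZ !scalerA; congr (_ *: _).
by rewrite /dcoef -{2}(sinhcN k.+1) exprS; ring.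
Qed.

End SinhcCoefficients.

(** * The trilinear identity *)

Section TrilinearIdentity.
Variables (R : realType) (d : nat).
Variables (A G : 'M[R]_d) (X : 'rV[R]_d -> 'M[R]_d).

Definition gram_form (y z : 'rV[R]_d) : R := (y *m G *m z^T) 0 0.
Local Notation b := gram_form.

(** With [X x] the matrix of [ad x] and [G] that of the invariant form, this is
    [B [x, y] z].  The section only uses the three properties below. *)
Definition tri (x y z : 'rV[R]_d) : R := b (y *m X x) z.

Hypothesis XP : forall c x y, X (c *: x + y) = c *: X x + X y.
Hypothesis A_skew : A *m G = - (G *m A^T).
Hypothesis X_ad : forall x, X (x *m A) = X x *m A - A *m X x.
Hypothesis tri_cyc : forall x y z, tri x y z = tri y z x.

Local Notation j := (sinhc R).
Local Notation dj := (dcoef j).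
Let hj := @sinhc_bounded R.
Let hdj := @dsinhc_bounded R.
Let hddj := @ddsinhc_bounded R.

Let J s := mpser j (s *: A).
Let K s := mpser dj (s *: A).
Let L s := mpser (dcoef dj) (s *: A).
Let DJ x s := s *: mpserD j (s *: A) (X x).
Let DK x s := s *: mpserD dj (s *: A) (X x).
Let DL x s := s *: mpserD (dcoef dj) (s *: A) (X x).

Lemma gram_formDl y y' z : b (y + y') z = b y z + b y' z.
Proof. by rewrite /b !mulmxDl mxE. Qed.

Lemma gram_formDr y z z' : b y (z + z') = b y z + b y z'.
Proof. by rewrite /b linearD /= mulmxDr mxE. Qed.

Lemma gram_formZl c y z : b (c *: y) z = c * b y z.
Proof. by rewrite /b -!scalemxAl mxE. Qed.

Lemma gram_formZr c y z : b y (c *: z) = c * b y z.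
Proof. by rewrite /b linearZ /= -scalemxAr mxE. Qed.

Lemma gram_formNl y z : b (- y) z = - b y z.
Proof. by rewrite -scaleN1r gram_formZl mulN1r. Qed.

Lemma gram_formNr y z : b y (- z) = - b y z.
Proof. by rewrite -scaleN1r gram_formZr mulN1r. Qed.

Lemma gram_form_adjoint (M N : 'M[R]_d) y z :
  M *m G = G *m N^T -> b (y *m M) z = b y (z *m N).
Proof. by move=> MN; rewrite /b trmx_mul -(mulmxA y M) MN !mulmxA. Qed.

Let A_adj y z : b (y *m A) z = - b y (z *m A).
Proof.
by rewrite -gram_formNr -mulmxN; apply: gram_form_adjoint; rewrite linearN mulmxN.
Qed.

(** [A] is skew for [b] and [j] is even. *)
Lemma J_selfadjoint s y z : b (y *m J s) z = b y (z *m J s).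
Proof.
apply: gram_form_adjoint; rewrite -mpser_tr // -mpser_sinhcN.
apply: mpser_intertwine => //.
by rewrite mulmxN -scalemxAl A_skew linearZ /= -scalemxAr scalerN.
Qed.

(** [A] is skew for [b] and [j'] is odd. *)
Lemma K_skewadjoint s y z : b (y *m K s) z = - b y (z *m K s).
Proof.
rewrite -gram_formNr -mulmxN; apply: gram_form_adjoint.
rewrite linearN /= -mpser_tr // -mpser_dsinhcN.
apply: mpser_intertwine => //.
by rewrite mulmxN -scalemxAl A_skew linearZ /= -scalemxAr scalerN.
Qed.

Let AJ s : A *m J s = J s *m A.
Proof.
by apply/esym/mpser_intertwine => //; rewrite -scalemxAl -scalemxAr.
Qed.

Let AK s : A *m K s = K s *m A.
Proof.
by apply/esym/mpser_intertwine => //; rewrite -scalemxAl -scalemxAr.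
Qed.

Let JK s : J s *m K s = K s *m J s.
Proof.
apply: mpser_intertwine => //; apply/esym/mpser_intertwine => //.
Qed.

(** The relation [a + b + c = 0] between the actions of [A] on the three
    arguments. *)
Lemma tri_invariant x y z :
  tri (x *m A) y z + tri x (y *m A) z + tri x y (z *m A) = 0.
Proof.
rewrite /tri X_ad mulmxBr !mulmxA gram_formDl gram_formNl A_adj.
by rewrite addrNK addNr.
Qed.

Lemma J_deriv s : mderiv J s (A *m K s).
Proof. exact: mderiv_mpser_scale. Qed.

Lemma K_deriv s : mderiv K s (A *m L s).
Proof. exact: mderiv_mpser_scale. Qed.

Lemma L_ode s : s *: (A *m L s) = (4^-1 * s) *: (A *m J s) - 2 *: K s.
Proof. by rewrite scalemxAl /L sinhc_ode // -scalemxAl scalerA. Qed.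

(** The identities of [DJ], [DK], [DL] are the corners of those of [J], [K], [L] at
   this block matrix. *)
Let block u x s := mpser u (s *: block_mx A (X x) 0 A).

Let blockE u x s : exp_bounded u -> block u x s =
  block_mx (mpser u (s *: A)) (s *: mpserD u (s *: A) (X x)) 0 (mpser u (s *: A)).
Proof.
by move=> hu; rewrite /block scale_block_mx scaler0 mpser_block // mpserDZ.
Qed.

Let block_deriv u x s : exp_bounded u ->
  mderiv (fun t => t *: mpserD u (t *: A) (X x)) s
    (A *m (s *: mpserD (dcoef u) (s *: A) (X x)) + X x *m mpser (dcoef u) (s *: A)).
Proof.
move=> hu; have := mderiv_mpser_scale (block_mx A (X x) 0 A) s hu.
rewrite -/(block (dcoef u) x s) blockE; last exact: dcoef_bounded.
rewrite mulmx_block => h i k; have := h (lshift d i) (rshift d k).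
rewrite block_mxEur; congr (is_derive _ _ _ _); apply/funext => t.
by rewrite -/(block u x t) blockE // block_mxEur.
Qed.

Lemma DJ_deriv x s : mderiv (DJ x) s (A *m DK x s + X x *m K s).
Proof. exact: block_deriv. Qed.

Lemma DK_deriv x s : mderiv (DK x) s (A *m DL x s + X x *m L s).
Proof. exact: block_deriv. Qed.

Lemma DL_ode x s : s *: (A *m DL x s + X x *m L s) =
  (4^-1 * s) *: (A *m DJ x s + X x *m J s) - 2 *: DK x s.
Proof.
have := sinhc_ode (s *: block_mx A (X x) 0 A).
rewrite -!scalemxAl scalerA -/(block j x s) -/(block dj x s) -/(block (dcoef dj) x s).
rewrite !blockE // !mulmx_block !scale_block_mx opp_block_mx add_block_mx.
by move/(congr1 ursubmx); rewrite !block_mxKur.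
Qed.

Let DC u x s : exp_bounded u ->
  A *m (s *: mpserD u (s *: A) (X x)) + X x *m mpser u (s *: A) =
  (s *: mpserD u (s *: A) (X x)) *m A + mpser u (s *: A) *m X x.
Proof.
move=> hu.
have := mpser_intertwine (u := u) (A := s *: block_mx A (X x) 0 A)
  (B := s *: block_mx A (X x) 0 A) (P := block_mx A (X x) 0 A) hu.
rewrite -scalemxAl -scalemxAr => /(_ (erefl _)).
rewrite -/(block u x s) blockE // !mulmx_block => /(congr1 ursubmx).
by rewrite !block_mxKur => <-; rewrite addrC.
Qed.

Let X0 : X 0 = 0.
Proof. by have := XP (-1) 0 0; rewrite scaler0 addr0 scaleN1r addNr. Qed.

Let XN x : X (- x) = - X x.
Proof. by have := XP (-1) x 0; rewrite X0 !addr0 !scaleN1r. Qed.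

Let DA u x s : exp_bounded u ->
  s *: mpserD u (s *: A) (X (x *m A)) =
    X x *m mpser u (s *: A) - mpser u (s *: A) *m X x.
Proof.
move=> hu; have := mpserD_commutator (s *: A) (X x) hu.
rewrite -scalemxAl -scalemxAr -scalerBr mpserDZ // => h.
by rewrite X_ad -opprB -scaleN1r mpserDZ // scaleN1r scalerN h opprB.
Qed.

(** Formally, [m (x; y, z) = - (K_b J_c + J_b K_c) / a], where the indices name the
    argument acted on: this is the derivative of [j' / j] multiplied by
    [J_b J_c]. *)
Definition mform s x y z : R :=
  b (y *m DK x s) (z *m J s) + b (y *m DJ x s) (z *m K s).

(** The derivative of [mform] with respect to [s] for a fixed [x]. *)
Let dmform s x y z : R :=
  b (y *m (A *m DL x s + X x *m L s)) (z *m J s) +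
  b (y *m DK x s) (z *m (A *m K s)) +
  (b (y *m (A *m DK x s + X x *m K s)) (z *m K s) +
   b (y *m DJ x s) (z *m (A *m L s))).

(** The division by [a] in the formal expression of [mform] is undone by putting
    [x A] for [x]: the derivative in the direction of a commutator with [A] is a
    commutator. *)
Lemma mform_ad s x y z : mform s (x *m A) y z =
  - tri x (y *m K s) (z *m J s) - tri x (y *m J s) (z *m K s).
Proof.
rewrite /mform /DK /DJ !DA // !mulmxBr !mulmxA !gram_formDl !gram_formNl.
rewrite (K_skewadjoint s (y *m X x)) (J_selfadjoint s (y *m X x)).
by rewrite -!mulmxA -/(K s) -/(J s) JK /tri !mulmxA; ring.
Qed.

(** The commutation rule [DC] produces [DJ A] and [DK A]; as [A] is skew, they cancel
    against the terms where [A] acts on the third argument, and only [J] and [K]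
    remain besides [mform] itself. *)
Lemma mform_ode s x y z : s * dmform s x y z =
  - 2 * mform s x y z + 4^-1 * s * tri x (y *m J s) (z *m J s)
  + s * tri x (y *m K s) (z *m K s).
Proof.
have e1 : s * b (y *m (A *m DL x s + X x *m L s)) (z *m J s) =
    4^-1 * s * b (y *m (A *m DJ x s + X x *m J s)) (z *m J s)
    - 2 * b (y *m DK x s) (z *m J s).
  rewrite -gram_formZl scalemxAr DL_ode mulmxBr -!scalemxAr gram_formDl.
  by rewrite gram_formNl !gram_formZl.
have e2 : s * b (y *m DJ x s) (z *m (A *m L s)) =
    4^-1 * s * b (y *m DJ x s) (z *m (A *m J s)) - 2 * b (y *m DJ x s) (z *m K s).
  rewrite -gram_formZr scalemxAr L_ode mulmxBr -!scalemxAr gram_formDr.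
  by rewrite gram_formNr !gram_formZr.
have e3 : b (y *m (A *m DJ x s + X x *m J s)) (z *m J s) +
    b (y *m DJ x s) (z *m (A *m J s)) = tri x (y *m J s) (z *m J s).
  rewrite DC // AJ mulmxA -[b _ (_ *m A)]opprK -A_adj -gram_formNl -gram_formDl.
  by rewrite mulmxDr !mulmxA addrAC subrr add0r.
have e4 : b (y *m (A *m DK x s + X x *m K s)) (z *m K s) +
    b (y *m DK x s) (z *m (A *m K s)) = tri x (y *m K s) (z *m K s).
  rewrite DC // AK mulmxA -[b _ (_ *m A)]opprK -A_adj -gram_formNl -gram_formDl.
  by rewrite mulmxDr !mulmxA addrAC subrr add0r.
rewrite /dmform !mulrDr e1 e2 -e3 -e4 /mform; ring.
Qed.

Lemma gram_form_deriv (p q : R -> 'rV[R]_d) s p' q' :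
  mderiv p s p' -> mderiv q s q' ->
  is_derive s (1 : R) (fun t => b (p t) (q t)) (b p' (q s) + b (p s) q').
Proof.
move=> hp hq; have := mderivM (mderivMr G hp) (mderivT hq).
by move=> /(_ 0 0); rewrite mxE.
Qed.

Lemma tri_deriv (p q r : R -> 'rV[R]_d) s p' q' r' :
  mderiv p s p' -> mderiv q s q' -> mderiv r s r' ->
  is_derive s (1 : R) (fun t => tri (p t) (q t) (r t))
    (tri p' (q s) (r s) + tri (p s) q' (r s) + tri (p s) (q s) r').
Proof.
move=> hp hq hr.
have hX : mderiv (fun t => X (p t)) s (X p').
  rewrite -[X p']addr0.
  by apply: (mderiv_linear_arg (L := fun x _ => X x) (L' := fun=> 0)) => // x;
    apply: mderiv_cst.
have := gram_form_deriv (mderivM hq hX) hr; rewrite gram_formDl /tri.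
by rewrite [X in X + _]addrC.
Qed.

(** In [m (x J (s); y, z)] the parameter also enters through the first argument. *)
Lemma mform_deriv (p : R -> 'rV[R]_d) s p' y z : mderiv p s p' ->
  is_derive s (1 : R) (fun t => mform t (p t) y z)
    (mform s p' y z + dmform s (p s) y z).
Proof.
move=> hp.
have linD u : exp_bounded u -> forall c x y0 t,
    t *: mpserD u (t *: A) (X (c *: x + y0)) =
    c *: (t *: mpserD u (t *: A) (X x)) + t *: mpserD u (t *: A) (X y0).
  by move=> hu c x y0 t; rewrite XP mpserDP // scalerDr !scalerA mulrC.
have hK : mderiv (fun t => DK (p t) t) s (DK p' s + (A *m DL (p s) s + X (p s) *m L s)).
  apply: (mderiv_linear_arg (L := DK)
    (L' := fun x => A *m DL x s + X x *m L s)) => //; first exact: linD.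
  by move=> x; apply: DK_deriv.
have hJ : mderiv (fun t => DJ (p t) t) s (DJ p' s + (A *m DK (p s) s + X (p s) *m K s)).
  apply: (mderiv_linear_arg (L := DJ)
    (L' := fun x => A *m DK x s + X x *m K s)) => //; first exact: linD.
  by move=> x; apply: DJ_deriv.
have h1 := gram_form_deriv (mderivMl y hK) (mderivMl z (J_deriv s)).
have h2 := gram_form_deriv (mderivMl y hJ) (mderivMl z (K_deriv s)).
have := is_deriveD h1 h2 => /is_derive_eq; apply.
by rewrite /mform /dmform !(mulmxDr y) !gram_formDl; ring.
Qed.

Let triZ1 c x y z : tri (c *: x) y z = c * tri x y z.
Proof. by rewrite /tri -[c *: x]addr0 XP X0 addr0 -scalemxAr gram_formZl. Qed.

Let triZ2 c x y z : tri x (c *: y) z = c * tri x y z.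
Proof. by rewrite /tri -scalemxAl gram_formZl. Qed.

Let triZ3 c x y z : tri x y (c *: z) = c * tri x y z.
Proof. by rewrite /tri gram_formZr. Qed.

Let triB1 x x' y z : tri (x - x') y z = tri x y z - tri x' y z.
Proof.
rewrite /tri -[x]scale1r XP XN !scale1r mulmxDr mulmxN.
by rewrite gram_formDl gram_formNl.
Qed.

Let triB2 x y y' z : tri x (y - y') z = tri x y z - tri x y' z.
Proof. by rewrite /tri mulmxBl gram_formDl gram_formNl. Qed.

Let triB3 x y z z' : tri x y (z - z') = tri x y z - tri x y z'.
Proof. by rewrite /tri gram_formDr gram_formNr. Qed.

(** Euler's operator on the quadratic part.  The terms where [A] meets [J] in two
    arguments and [K] in the third add up, by invariance, to the derivative of
    [tri (x J) (y J) (z J)]. *)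
Lemma quadratic_scaling s xj xk xl yj yk yl zj zk zl :
  s *: xl = (4^-1 * s) *: (xj *m A) - 2 *: xk ->
  s *: yl = (4^-1 * s) *: (yj *m A) - 2 *: yk ->
  s *: zl = (4^-1 * s) *: (zj *m A) - 2 *: zk ->
  s * (tri xl yk zj + tri xk yl zj + tri xk yk (zk *m A)
       + (tri (xk *m A) yk zk + tri xj yl zk + tri xj yk zl)
       + (tri xl yj zk + tri xk (yk *m A) zk + tri xk yj zl)) =
  - 4 * (tri xk yk zj + tri xj yk zk + tri xk yj zk)
  - 4^-1 * s * (tri (xk *m A) yj zj + tri xj (yk *m A) zj + tri xj yj (zk *m A)).
Proof.
move=> hx hy hz.
have l1 v w : s * tri xl v w = 4^-1 * s * tri (xj *m A) v w - 2 * tri xk v w.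
  by rewrite -(triZ1 s xl) hx triB1 !triZ1.
have l2 v w : s * tri v yl w = 4^-1 * s * tri v (yj *m A) w - 2 * tri v yk w.
  by rewrite -(triZ2 s v yl) hy triB2 !triZ2.
have l3 v w : s * tri v w zl = 4^-1 * s * tri v w (zj *m A) - 2 * tri v w zk.
  by rewrite -(triZ3 s v w zl) hz triB3 !triZ3.
have solve a b c : tri (a *m A) b c = - tri a (b *m A) c - tri a b (c *m A).
  by have := tri_invariant a b c => /(canRL (addrK _))/(canRL (addrK _)) ->; rewrite sub0r addrC.
by rewrite !mulrDr !l1 !l2 !l3 !solve; ring.
Qed.

Section Scaling.
Variables x y z : 'rV[R]_d.

Let q s := tri (x *m K s) (y *m K s) (z *m J s) +
  tri (x *m J s) (y *m K s) (z *m K s) + tri (x *m K s) (y *m J s) (z *m K s).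
Let p s := tri (x *m J s) (y *m J s) (z *m J s).
Let M s := mform s (x *m J s) y z + mform s (y *m J s) z x + mform s (z *m J s) x y.

Let first_integral s := s ^+ 3 * (q s + 4^-1 * p s) - s ^+ 2 * M s.

(** With [' = d / ds]: [s (q + p / 4)' = - 4 q] and
    [s M' = - 2 M + s (3 p / 4 - q)], so that both [(s ^ 3 (q + p / 4))'] and
    [(s ^ 2 M)'] are [s ^ 2 (3 p / 4 - q)]. *)
Lemma first_integral_deriv s : is_derive s (1 : R) first_integral 0.
Proof.
have dJ (w : 'rV[R]_d) := mderivMl w (J_deriv s).
have dK (w : 'rV[R]_d) := mderivMl w (K_deriv s).
have q1 := tri_deriv (dK x) (dK y) (dJ z).
have q2 := tri_deriv (dJ x) (dK y) (dK z).
have q3 := tri_deriv (dK x) (dJ y) (dK z).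
have p1 := tri_deriv (dJ x) (dJ y) (dJ z).
have m1 := mform_deriv y z (dJ x).
have m2 := mform_deriv z x (dJ y).
have m3 := mform_deriv x y (dJ z).
have dq := is_deriveD (is_deriveD q1 q2) q3.
have dM := is_deriveD (is_deriveD m1 m2) m3.
have d2 : is_derive s (1 : R) (fun t : R => t ^+ 2) (2 * s).
  have := is_derive_prod (@is_derive_id _ _ s 1) (@is_derive_id _ _ s 1).
  by move=> /is_derive_eq; apply; ring.
have d3 : is_derive s (1 : R) (fun t : R => t ^+ 3) (3 * s ^+ 2).
  have := is_derive_prod (@is_derive_id _ _ s 1) d2.
  by move=> /is_derive_eq; apply; ring.
have dp := is_derive_prod (is_derive_cst (4^-1 : R) s 1) p1.
have dqp := is_deriveD dq dp.
have dI := is_deriveB (is_derive_prod d3 dqp) (is_derive_prod d2 dM).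
set Dq := (X in is_derive _ _ _ X) in dq.
set DM := (X in is_derive _ _ _ X) in dM.
set Dp := (X in is_derive _ _ _ X) in p1.
have hL w : s *: (w *m (A *m L s)) = (4^-1 * s) *: (w *m J s *m A) - 2 *: (w *m K s).
  by rewrite scalemxAr L_ode AJ mulmxBr -!scalemxAr mulmxA.
have ax w : w *m (A *m K s) = w *m K s *m A by rewrite AK mulmxA.
have sDq : s * Dq = - 4 * q s - 4^-1 * s * Dp.
  by rewrite /Dq /Dp !ax; apply: quadratic_scaling.
have sDM : s * DM = - 2 * M s + s * (3 * 4^-1 * p s - q s).
  rewrite /DM !ax !mform_ad /M /q /p.
  have := mform_ode s (x *m J s) y z; have := mform_ode s (y *m J s) z x.
  have := mform_ode s (z *m J s) x y.
  move: (dmform s _ y z) (dmform s _ z x) (dmform s _ x y) => n1 n2 n3.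
  move: (mform s _ y z) (mform s _ z x) (mform s _ x y) => m1' m2' m3' e3 e2 e1.
  have cyc u v w : tri u v (x *m w) = tri (x *m w) u v by rewrite -tri_cyc.
  have cyc' u v w : tri u (x *m w) v = tri (x *m w) v u by rewrite tri_cyc.
  rewrite !cyc !cyc' in e1 e2 e3 *.
  rewrite (_ : s * _ = s * n1 + s * n2 + s * n3 - 2 * s * q s).
    by rewrite e1 e2 e3 /q; ring.
  by rewrite /q; ring.
move: dI => /is_derive_eq; apply.
rewrite -/Dq -/DM -/Dp.
change (3 * s ^+ 2 * (q s + 4^-1 * p s) + s ^+ 3 * (Dq + (0 * p s + 4^-1 * Dp))
  - (2 * s * M s + s ^+ 2 * DM) = 0).
move: sDq sDM; move: (q s) (p s) (M s) (Dq : R) (DM : R) (Dp : R).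
move=> qs ps Ms cq cM cp e1 e2.
rewrite (_ : _ - _ = 3 * s ^+ 2 * (qs + 4^-1 * ps) + s ^+ 2 * (s * cq)
   + s ^+ 3 * (4^-1 * cp) - 2 * s * Ms - s * (s * cM)); last by ring.
by rewrite e1 e2; ring.
Qed.

Lemma scaled_identity : q 1 + 4^-1 * p 1 = M 1.
Proof.
have := is_derive_0_is_cst 1 0 first_integral_deriv.
rewrite /first_integral !expr1n !expr0n /= !mul1r !mul0r subr0 => /eqP.
by rewrite subr_eq0 => /eqP.
Qed.

End Scaling.

Let J1 := mpser j A.
Let K1 := mpser dj A.
Hypothesis J_unit : J1 \in unitmx.
Let F1 := invmx J1 *m K1.

Let E x : 'M[R]_d :=
  invmx J1 *m (mpserD dj A (X x) - mpserD j A (X x) *m F1).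

Let J_1 : J 1 = J1. Proof. by rewrite /J scale1r. Qed.
Let K_1 : K 1 = K1. Proof. by rewrite /K scale1r. Qed.

Let invJ_adj y z : b (y *m invmx J1) z = b y (z *m invmx J1).
Proof.
rewrite -{1}(mulmxKV J_unit z) -J_1 -J_selfadjoint J_1.
by rewrite mulmxKV.
Qed.

Lemma quotient_skewadjoint y z : b (y *m F1) z = - b y (z *m F1).
Proof.
have JK1 : K1 *m invmx J1 = invmx J1 *m K1.
  have := JK 1; rewrite J_1 K_1 => h.
  by rewrite -[LHS](mulKmx J_unit) (mulmxA J1) h mulmxK.
by rewrite /F1 mulmxA -K_1 K_skewadjoint K_1 invJ_adj -mulmxA JK1.
Qed.

(** [scaled_identity] at [x J^-1], [y J^-1], [z J^-1]; [E x] is the derivative of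
    [J^-1 K] in the direction [X x]. *)
Lemma trilinear_identity x y z :
  tri (x *m F1) (y *m F1) z + tri x (y *m F1) (z *m F1)
  + tri (x *m F1) y (z *m F1) + 4^-1 * tri x y z =
  b (y *m E x) z + b (z *m E y) x + b (x *m E z) y.
Proof.
have := scaled_identity (x *m invmx J1) (y *m invmx J1) (z *m invmx J1).
rewrite J_1 K_1 !(mulmxKV J_unit) -!mulmxA -/F1 => ->.
have h u v w : mform 1 u (v *m invmx J1) (w *m invmx J1) = b (v *m E u) w.
  rewrite /mform /DK /DJ !scale1r J_1 K_1 mulmxKV // -!mulmxA -/F1.
  rewrite /E !mulmxBr gram_formDl gram_formNl; congr (_ + _).
  by rewrite (mulmxA (invmx J1)) (mulmxA v (_ *m _)) quotient_skewadjoint opprK.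
by rewrite !h.
Qed.

End TrilinearIdentity.

(** * Power series of a complex variable *)

Section ComplexSeries.
Import ComplexField.Normc.
Local Open Scope complex_scope.
Variable R : realType.
Implicit Types (u : nat -> R) (z w : R[i]).
Local Notation Re := complex.Re.
Local Notation Im := complex.Im.

(** Multiplication by [z] on the real plane, acting on row vectors. *)
Definition rho z : 'M[R]_2 := \matrix_(i < 2, j < 2)
  (if i == j then Re z else if i == 0 then Im z else - Im z).

Lemma rhoD z w : rho (z + w) = rho z + rho w.
Proof.
case: z w => a b [c e]; apply/matrixP => i j; rewrite !mxE /=.
by do 2?case: ifP => _; rewrite ?opprD.
Qed.

Lemma rhoZ (c : R) z : rho (c%:C * z) = c *: rho z.
Proof.
case: z => a b; apply/matrixP => i j; rewrite !mxE /= !mul0r subr0 addr0.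
by do 2?case: ifP => _; rewrite ?mulrN.
Qed.

Lemma rho1 : rho 1 = 1%:M.
Proof.
by apply/matrixP => i j; rewrite !mxE /=; case: eqP => //= _; case: ifP;
  rewrite ?oppr0.
Qed.

Lemma rhoM z w : rho (z * w) = rho z *m rho w.
Proof.
case: z w => a b [c e]; apply/matrixP => i j.
rewrite !mxE !big_ord_recl big_ord0 !mxE /=.
case: i j => [[|[|i]] //= hi] [[|[|j]] //= hj]; rewrite /eq_op /=; ring.
Qed.

Lemma rhoX z k : rho (z ^+ k) = rho z ^+ k.
Proof.
elim: k => [|k IH]; first by rewrite expr0 expmx0 rho1.
by rewrite exprS rhoM IH expmxS.
Qed.

Lemma rho_inj : injective rho.
Proof.
move=> [a b] [c e] /matrixP h; have := h 0 0; have := h 0 1.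
by rewrite !mxE /= => -> ->.
Qed.

Lemma rhoN z : rho (- z) = - rho z.
Proof.
have -> : - z = (-1)%:C * z by rewrite rmorphN1 mulN1r.
by rewrite rhoZ scaleN1r.
Qed.

(** The sum of the series with real coefficients [u] at a complex number, read off
    from the first row of the real matrix. *)
Definition cser u z : R[i] := mpser u (rho z) 0 0 +i* mpser u (rho z) 0 1.

Lemma rho_sum (I : Type) (s : seq I) (F : I -> R[i]) :
  rho (\sum_(i <- s) F i) = \sum_(i <- s) rho (F i).
Proof.
have rho0 : rho 0 = 0.
  by have := rhoZ 0 0; rewrite mulr0 scale0r.
by elim/big_ind2: _ => // [x1 x2 y1 y2 <- <-]; rewrite rhoD.
Qed.

Lemma mpsum_rho u z N :
  mpsum u (rho z) N = rho (\sum_(k < N) (u k)%:C * z ^+ k).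
Proof. by rewrite rho_sum; apply: eq_bigr => k _; rewrite rhoZ rhoX. Qed.

Lemma rho_cser u z : exp_bounded u -> mpser u (rho z) = rho (cser u z).
Proof.
move=> hu; apply: mpser_lim => // i j; rewrite mxE /cser /=.
have h k l := @mpser_cvg _ u _ (rho z) hu k l.
have e : mpsum u (rho z) = fun N => rho (\sum_(k < N) (u k)%:C * z ^+ k).
  by apply/funext => N; rewrite mpsum_rho.
have h00 := h 0 0; have h01 := h 0 1; rewrite e in h00 h01.
rewrite e; under eq_fun do rewrite mxE.
case: ifP => ij.
  apply: cvg_trans h00; apply: near_eq_cvg; apply: nearW => N /=.
  by rewrite mxE eqxx.
case: ifP => i0.
  apply: cvg_trans h01; apply: near_eq_cvg; apply: nearW => N /=.
  by rewrite mxE.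
apply: cvgN; apply: cvg_trans h01; apply: near_eq_cvg; apply: nearW => N /=.
by rewrite mxE.
Qed.

Lemma cserM_matrix u z w : exp_bounded u ->
  (mpser u (rho z) *m rho w) 0 0 +i* (mpser u (rho z) *m rho w) 0 1 =
  cser u z * w.
Proof.
move=> hu; rewrite rho_cser // -rhoM !mxE /=.
by case: (_ * _).
Qed.

Lemma mnorm_rho_le w : mnorm (rho w) <= 4 * normc w.
Proof.
have hR : `|Re w| <= normc w.
  case: w => a b /=; rewrite -sqrtr_sqr; apply: ler_wsqrtr.
  by rewrite lerDl sqr_ge0.
have hI : `|Im w| <= normc w.
  case: w {hR} => a b /=; rewrite -sqrtr_sqr; apply: ler_wsqrtr.
  by rewrite lerDr sqr_ge0.
rewrite /mnorm !big_ord_recl !big_ord0 !mxE /= normrN !addr0.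
have -> : 4 * normc w = (normc w + normc w) + (normc w + normc w) by ring.
by rewrite !lerD.
Qed.

Lemma normc_le_entries (a b : R) : normc (a +i* b) <= `|a| + `|b|.
Proof.
rewrite /=; have h : 0 <= `|a| + `|b| by rewrite addr_ge0.
rewrite -(ger0_norm h) -sqrtr_sqr; apply: ler_wsqrtr.
rewrite sqrrD !real_normK ?num_real // addrAC lerDl.
by rewrite mulrn_wge0 // mulr_ge0.
Qed.

(** The second-order estimate for matrices, along the directions [rho h], which
    commute with [rho z]. *)
Lemma cser_is_derive u z : exp_bounded u ->
  is_derive (z : R[i]^o) (1 : R[i]^o) (cser u : R[i]^o -> R[i]^o) (cser (dcoef u) z).
Proof.
move=> hu; pose r := 1 + mnorm (rho z) + 4.
pose C := 32 * (mnorm (1%:M : 'M[R]_2) * expR (4 * r)).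
apply: (@is_derive_quadratic _ _ _ _ C%:C) => h.
have -> : `|h| = (normc h)%:C by [].
rewrite lecR => h1.
have r1 : 1 <= r by rewrite /r -addrA lerDl addr_ge0 ?mnorm_ge0.
have hr : mnorm (rho z) + mnorm (rho h) <= r.
  rewrite /r [1 + _]addrC -addrA lerD2l (le_trans (mnorm_rho_le h)) //.
  by rewrite -[4]add0r -[0 + 4]addrC; lra.
have comm : rho z *m rho h = rho h *m rho z by rewrite -!rhoM mulrC.
have key k : `|mpser u (rho z + rho h) 0 k - mpser u (rho z) 0 k -
   (mpser (dcoef u) (rho z) *m rho h) 0 k| <= 16 * normc h ^+ 2 *
    (mnorm (1%:M : 'M[R]_2) * expR (4 * r)).
  rewrite -mpserD_along_commutant //.
  apply: le_trans (mpser_taylor 0 k hu r1 hr) _.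
  apply: ler_wpM2r; first by rewrite mulr_ge0 ?mnorm_ge0 ?expR_ge0.
  have -> : 16 * normc h ^+ 2 = (4 * normc h) ^+ 2 by ring.
  have h0 : 0 <= 4 * normc h := le_trans (mnorm_ge0 _) (mnorm_rho_le h).
  by rewrite ler_sqr ?nnegrE ?mnorm_ge0 ?mnorm_rho_le.
rewrite mulrC -cserM_matrix; last exact: dcoef_bounded.
rewrite /cser rhoD.
have -> : forall a b a' b' a2 b2 : R, (a +i* b) - (a' +i* b') - (a2 +i* b2) =
   (a - a' - a2) +i* (b - b' - b2) by [].
rewrite -rmorphXn -rmorphM /= lecR.
apply: le_trans (normc_le_entries _ _) _; apply: le_trans (lerD (key 0) (key 1)) _.
by rewrite le_eqVlt; apply/orP; left; apply/eqP; rewrite /C; ring.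
Qed.

End ComplexSeries.

(** * The complex exponential *)

Section ComplexExponential.
Local Open Scope complex_scope.
Variable R : realType.
Implicit Types (u : nat -> R) (z w : R[i]).
Local Notation Re := complex.Re.
Local Notation Im := complex.Im.

Definition expc (k : nat) : R := k`!%:R^-1.

Lemma expc_bounded : exp_bounded expc.
Proof. by move=> k; rewrite /expc ger0_norm // invr_ge0. Qed.

Lemma dcoef_expc : dcoef expc = expc.
Proof.
apply/funext => k; rewrite /dcoef /expc factS natrM invfM mulrA divff ?mul1r //.
Qed.

Lemma is_derive_line_comp (F : R -> R) (F' c s : R) :
  is_derive (c * s) (1 : R) F F' ->
  is_derive s (1 : R) (fun t => F (c * t)) (F' * c).
Proof.
move=> hF; have hc : is_derive s (1 : R) (fun t => c * t) c.
  have := is_derive_prod (is_derive_cst c s 1) (@is_derive_id _ _ s 1).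
  by move=> /is_derive_eq; apply; rewrite mul0r mulr1 add0r.
exact: (@is_derive1_comp _ F (fun t => c * t) s _ _ hF hc).
Qed.

(** On the ray [s z], both sides solve the same linear differential equation: the
    quotient of the series by [exp], [cos] and [sin] has derivative zero, in real
    and imaginary parts [a] and [b]. *)
Lemma cexp_series z : cexp z = cser expc z.
Proof.
set x := Re z; set y := Im z.
pose P (s : R) := mpser expc (s *: rho z) 0 0.
pose Q (s : R) := mpser expc (s *: rho z) 0 1.
have M s : mpser expc (s *: rho z) = rho (P s +i* Q s).
  by rewrite -rhoZ rho_cser ?/cser ?rhoZ //; exact: expc_bounded.
have hd s := mderiv_mpser_scale (rho z) s expc_bounded.
have dP s : is_derive s (1 : R) P (x * P s - y * Q s).
  have := hd s 0 0; rewrite dcoef_expc M -rhoM => /is_derive_eq; apply.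
  by rewrite mxE eqxx /x /y; case: (z).
have dQ s : is_derive s (1 : R) Q (y * P s + x * Q s).
  have := hd s 0 1; rewrite dcoef_expc M -rhoM => /is_derive_eq; apply.
  by rewrite mxE /x /y; case: (z) => a b /=; rewrite addrC.
have de s : is_derive s (1 : R) (fun t => expR (- x * t)) (expR (- x * s) * - x).
  exact: is_derive_line_comp.
have dc s : is_derive s (1 : R) (fun t => cos (y * t)) (- sin (y * s) * y).
  exact: is_derive_line_comp.
have ds s : is_derive s (1 : R) (fun t => sin (y * t)) (cos (y * s) * y).
  exact: is_derive_line_comp.
pose a s := expR (- x * s) * (P s * cos (y * s) + Q s * sin (y * s)).
pose b s := expR (- x * s) * (Q s * cos (y * s) - P s * sin (y * s)).
have da s : is_derive s (1 : R) a 0.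
  have h := is_derive_prod (de s) (is_deriveD (is_derive_prod (dP s) (dc s))
     (is_derive_prod (dQ s) (ds s))).
  apply: (is_derive_eq h); rewrite !fctE. ring.
have db s : is_derive s (1 : R) b 0.
  have h := is_derive_prod (de s) (is_deriveB (is_derive_prod (dQ s) (dc s))
     (is_derive_prod (dP s) (ds s))).
  apply: (is_derive_eq h); rewrite !fctE. ring.
have P0 : P 0 = 1.
  by rewrite /P scale0r mpser0 ?mxE ?/expc ?invr1 //; exact: expc_bounded.
have Q0 : Q 0 = 0.
  by rewrite /Q scale0r mpser0 ?mxE //; exact: expc_bounded.
have ha : a 1 = 1.
  rewrite (is_derive_0_is_cst 1 0 da) /a !mulr0 expR0 cos0 sin0 P0 Q0; ring.
have hb : b 1 = 0.
  rewrite (is_derive_0_is_cst 1 0 db) /b !mulr0 expR0 cos0 sin0 P0 Q0; ring.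
have e1 := cos2Dsin2 y.
have hP : P 1 = expR x * cos y.
  have -> : P 1 = P 1 * (cos y ^+ 2 + sin y ^+ 2) by rewrite e1 mulr1.
  have -> : P 1 * (cos y ^+ 2 + sin y ^+ 2) = expR x * (a 1 * cos y - b 1 * sin y).
    rewrite /a /b !mulr1.
    have := expRxMexpNx_1 x; move: (expR x) (expR (- x)) => E E' EE.
    rewrite -[P 1 in LHS]mul1r -EE; ring.
  by rewrite ha hb; ring.
have hQ : Q 1 = expR x * sin y.
  have -> : Q 1 = Q 1 * (cos y ^+ 2 + sin y ^+ 2) by rewrite e1 mulr1.
  have -> : Q 1 * (cos y ^+ 2 + sin y ^+ 2) = expR x * (a 1 * sin y + b 1 * cos y).
    rewrite /a /b !mulr1.
    have := expRxMexpNx_1 x; move: (expR x) (expR (- x)) => E E' EE.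
    rewrite -[Q 1 in LHS]mul1r -EE; ring.
  by rewrite ha hb; ring.
by rewrite /cexp /cser -/x -/y -hP -hQ /P /Q scale1r.
Qed.

Lemma sinhc_exp n (A : 'M[R]_n) : A *m mpser (sinhc R) A =
  mpser expc (2^-1 *: A) - mpser expc (- 2^-1 *: A).
Proof.
apply: (@mcvg_unique _ _ _ (fun N => A *m mpsum (sinhc R) A N)).
  by apply: mcvgMl; apply: mpser_cvg; apply: sinhc_bounded.
rewrite (_ : (fun _ => _) = fun N => mpsum expc (2^-1 *: A) N.+1 +
    (-1) *: mpsum expc (- 2^-1 *: A) N.+1).
  rewrite -[X in _ - X]scale1r -scaleNr; apply: mcvgD; last apply: mcvgZ.
    exact/mpser_cvgS/expc_bounded.
  exact/mpser_cvgS/expc_bounded.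
apply/funext => N; rewrite scaleN1r /mpsum -sumrB big_ord_recl !expmx0 subrr add0r.
rewrite mulmx_sumr; apply: eq_bigr => k _ /=.
rewrite -scalemxAr -expmxS !expmxZ !scalerA -scalerBl; congr (_ *: _).
by rewrite /sinhc /expc; ring.
Qed.

Lemma coshc_exp n (A : 'M[R]_n) : mpser (sinhc R) A + A *m mpser (dcoef (sinhc R)) A =
  2^-1 *: (mpser expc (2^-1 *: A) + mpser expc (- 2^-1 *: A)).
Proof.
apply: (@mcvg_unique _ _ _ (fun N => mpsum (sinhc R) A N.+1 +
    A *m mpsum (dcoef (sinhc R)) A N)).
  apply: mcvgD; first exact/mpser_cvgS/sinhc_bounded.
  by apply: mcvgMl; apply: mpser_cvg; apply: dsinhc_bounded.
rewrite (_ : (fun _ => _) = fun N => 2^-1 *: (mpsum expc (2^-1 *: A) N.+1 +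
    mpsum expc (- 2^-1 *: A) N.+1)).
  by apply: mcvgZ; apply: mcvgD; exact/mpser_cvgS/expc_bounded.
apply/funext => N.
have -> : A *m mpsum (dcoef (sinhc R)) A N =
    \sum_(k < N.+1) (k%:R * sinhc R k) *: A ^+ k.
  rewrite big_ord_recl mul0r scale0r add0r mulmx_sumr.
  by apply: eq_bigr => k _; rewrite -scalemxAr -expmxS.
rewrite /mpsum -!big_split scaler_sumr; apply: eq_bigr => k _ /=.
rewrite !expmxZ !scalerA -!scalerDl scalerA; congr (_ *: _).
rewrite /sinhc /expc !exprS factS natrM invfM.
have h4 : (k`!%:R : R) != 0 by rewrite pnatr_eq0 -lt0n fact_gt0.
by field; rewrite h4 nat1r pnatr_eq0.
Qed.

End ComplexExponential.

(** * Derivatives of a quotient *)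

Section NumFieldDerivative.
Local Open Scope complex_scope.
Variable K : numFieldType.

Lemma is_derive_near_neq0 (f : K^o -> K^o) (z d : K^o) :
  is_derive z (1 : K^o) f d -> f z != 0 -> \near z, f z != 0.
Proof.
move=> [hf _] fz; have /differentiable_continuous hc : differentiable f z.
  exact/derivable1_diffP.
exact: cvgr_neq0 hc fz.
Qed.

(** Leibniz' rule for [f g = h], solved recursively for the derivatives of [f]:
    [f] is infinitely differentiable where [g 0] does not vanish, and its
    Taylor coefficients are those of the formal quotient. *)
Lemma quotient_leibniz (f : K^o -> K^o) (g h : nat -> K^o -> K^o) :
  (forall k z, is_derive z (1 : K^o) (g k) (g k.+1 z)) ->
  (forall k z, is_derive z (1 : K^o) (h k) (h k.+1 z)) ->
  (forall z, g 0%N z != 0 -> f z * g 0%N z = h 0%N z) ->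
  forall k z, g 0%N z != 0 ->
  (forall i, (i < k)%N -> derivable (derive1n i f) z 1) /\
  \sum_(i < k.+1) (derive1n i f z / i`!%:R) * (g (k - i)%N z / (k - i)`!%:R) =
    h k z / k`!%:R.
Proof.
move=> dg dh fg; elim=> [|k IH] z gz.
  by split => //; rewrite big_ord_recl big_ord0 /= subnn fact0 !divr1 addr0 fg.
have fact_neq0 l : l`!%:R != 0 :> K by rewrite pnatr_eq0 -lt0n fact_gt0.
have near_g : \near z, g 0%N z != 0 := is_derive_near_neq0 (dg 0%N z) gz.
have [der _] := IH z gz.
have dF i : (i < k)%N -> is_derive z (1 : K^o) (derive1n i f) (derive1n i.+1 f z).
  by move=> ik; rewrite derive1nS derive1E; apply: derivableP; apply: der.
have dG i c : is_derive z (1 : K^o) (fun t => (g i t * c : K)) (g i.+1 z * c).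
  have := is_derive_prod (dg i z) (is_derive_cst (c : K^o) z 1).
  by move=> /is_derive_eq; apply; rewrite mulr0 addr0.
have dH i c : is_derive z (1 : K^o) (fun t => (h i t * c : K)) (h i.+1 z * c).
  have := is_derive_prod (dh i z) (is_derive_cst (c : K^o) z 1).
  by move=> /is_derive_eq; apply; rewrite mulr0 addr0.
have dFc i c : derivable (derive1n i f) z 1 ->
    is_derive z (1 : K^o) (fun t => (derive1n i f t * c : K)) (derive1n i.+1 f z * c).
  move=> hi.
  have di : is_derive z (1 : K^o) (derive1n i f) (derive1n i.+1 f z).
    by rewrite derive1nS derive1E; apply: derivableP.
  have := is_derive_prod di (is_derive_cst (c : K^o) z 1).
  by move=> /is_derive_eq; apply; rewrite mulr0 addr0.
have derk : derivable (derive1n k f) z 1.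
  pose F (t : K^o) : K^o := (h k t / k`!%:R - \sum_(i < k) (derive1n i f t / i`!%:R) *
      (g (k - i)%N t / (k - i)`!%:R)) * (k`!%:R / g 0%N t).
  have hF : \near z, F z = derive1n k f z.
    near=> t; have gt : g 0%N t != 0 by near: t.
    have [_] := IH t gt; rewrite big_ord_recr /= subnn fact0 divr1 /F => <-.
    by rewrite addrAC subrr add0r; field; rewrite gt fact_neq0.
  have hsum := is_derive_fsum (fun i : 'I_k => is_derive_prod
    (dFc i i`!%:R^-1 (der i (ltn_ord i))) (dG (k - i)%N (k - i)`!%:R^-1)).
  have hB := is_deriveB (dH k k`!%:R^-1) hsum.
  have hV : derivable (fun t => (k`!%:R / g 0%N t : K^o)) z 1.
    apply: derivableM; first exact: derivable_cst.
    by apply: derivableV => //; have [] := dg 0%N z.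
  have dF' : derivable F z 1 by apply: derivableM => //; case: hB.
  exact: near_eq_derivable hF dF'.
have der' i : (i < k.+1)%N -> derivable (derive1n i f) z 1.
  by rewrite ltnS leq_eqVlt => /predU1P[-> //|]; exact: der.
split=> //.
have hL := is_derive_fsum (fun i : 'I_k.+1 => is_derive_prod
    (dFc i i`!%:R^-1 (der' i (ltn_ord i))) (dG (k - i)%N (k - i)`!%:R^-1)).
have hR : is_derive z (1 : K^o) (fun t => (\sum_(i < k.+1)
    derive1n i f t / i`!%:R * (g (k - i)%N t / (k - i)`!%:R) : K^o)) (h k.+1 z / k`!%:R).
  apply: near_eq_is_derive (dH k k`!%:R^-1).
  by near=> t; have gt : g 0%N t != 0 by [near: t]; have [_ ->] := IH t gt.
have /esym := etrans (esym (derive_val (is_derive := hR))) (derive_val (is_derive := hL)).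
move=> E; apply: (@mulfI _ k.+1%:R); first by rewrite pnatr_eq0.
have -> : k.+1%:R * (h k.+1 z / k.+1`!%:R) = h k.+1 z / k`!%:R.
  by rewrite factS natrM; field; rewrite fact_neq0 nat1r pnatr_eq0.
rewrite -E.
pose c i l : K := derive1n i f z / i`!%:R * (g l z / l`!%:R).
have split_sum : k.+1%:R * \sum_(i < k.+2) c i (k.+1 - i)%N =
   \sum_(i < k.+1) i.+1%:R * c i.+1 (k - i)%N +
   \sum_(i < k.+1) (k - i).+1%:R * c i (k - i).+1.
  transitivity (\sum_(i < k.+2) i%:R * c i (k.+1 - i)%N +
      \sum_(i < k.+2) (k.+1 - i)%:R * c i (k.+1 - i)%N).
    rewrite mulr_sumr -big_split; apply: eq_bigr => i _ /=.
    by rewrite -mulrDl -natrD subnKC // -ltnS.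
  congr (_ + _).
    rewrite big_ord_recl mul0r add0r; apply: eq_bigr => i _.
    by rewrite lift0 subSS.
  rewrite big_ord_recr /= subnn mul0r addr0; apply: eq_bigr => i _.
  by rewrite subSn // -ltnS.
rewrite split_sum -big_split; apply: eq_bigr => i _ /=.
rewrite /c; have i0 := fact_neq0 i; have ki0 := fact_neq0 (k - i)%N.
move: i0 ki0; move: (k - i)%N => l i0 ki0; rewrite !factS !natrM.
rewrite -derive1nS.
by field; rewrite i0 ki0 !nat1r !pnatr_eq0.
Unshelve. all: by end_near. Qed.

End NumFieldDerivative.

(** * The functions j and f on the complex numbers *)

Section SinhcOnComplex.
Local Open Scope complex_scope.
Variable R : realType.
Implicit Types (z w : R[i]).
Local Notation Re := complex.Re.
Local Notation Im := complex.Im.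

Definition jcoef k : nat -> R := iter k (@dcoef R) (sinhc R).

Lemma jcoef_bounded k : exp_bounded (jcoef k).
Proof.
elim: k => [|k IH]; [exact: sinhc_bounded | exact: dcoef_bounded].
Qed.

(** The [k]-th derivative of [j = sinh (z / 2) / (z / 2)]. *)
Definition jder k z : R[i] := cser (jcoef k) z.

Lemma jder_is_derive k z :
  is_derive (z : R[i]^o) (1 : R[i]^o) (jder k : R[i]^o -> R[i]^o) (jder k.+1 z).
Proof. exact/cser_is_derive/jcoef_bounded. Qed.

Lemma half_real z : z / 2 = (2^-1)%:C * z.
Proof. by rewrite mulrC rmorphV ?unitfE ?pnatr_eq0 // rmorph_nat. Qed.

Lemma rho_half z : rho (z / 2) = 2^-1 *: rho z.
Proof. by rewrite half_real rhoZ. Qed.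

Lemma rho_Nhalf z : rho (- (z / 2)) = - 2^-1 *: rho z.
Proof. by rewrite rhoN rho_half scaleNr. Qed.

Lemma jder0_sinh z : z * jder 0 z = cexp (z / 2) - cexp (- (z / 2)).
Proof.
apply: rho_inj; have eb := @expc_bounded R.
rewrite rhoM -rho_cser ?sinhc_exp; last exact: jcoef_bounded.
rewrite !cexp_series rhoD rhoN -(rho_cser (z / 2) eb) -(rho_cser (- (z / 2)) eb).
by rewrite rho_half rho_Nhalf.
Qed.

Lemma jder_cosh z :
  jder 0 z + z * jder 1 z = (cexp (z / 2) + cexp (- (z / 2))) / 2.
Proof.
apply: rho_inj; have eb := @expc_bounded R.
rewrite half_real rhoZ !cexp_series rhoD rhoM rhoD.
rewrite -(rho_cser (z / 2) eb) -(rho_cser (- (z / 2)) eb).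
rewrite -(rho_cser z (jcoef_bounded 0)) -(rho_cser z (jcoef_bounded 1)).
by rewrite rho_half rho_Nhalf -coshc_exp.
Qed.

(** [f] is the logarithmic derivative of [j]; at [0] both sides vanish because
    [j'] is odd. *)
Lemma f_cdybe_mul z : jder 0 z != 0 -> f_cdybe z * jder 0 z = jder 1 z.
Proof.
rewrite /f_cdybe; have [-> _|z0 jz] := eqVneq z 0.
  rewrite mul0r; apply: rho_inj; rewrite -rho_cser; last exact: jcoef_bounded.
  have r0 : rho (0 : R[i]) = 0 by rewrite -(subrr 0) rhoD rhoN subrr.
  rewrite r0 mpser0; last exact: jcoef_bounded.
  by rewrite /jcoef /= /dcoef sinhc1 mulr0 raddf0.
apply: (mulfI z0); have c := jder_cosh z; have s := jder0_sinh z.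
rewrite /ccoth -s.
have -> : cexp (z / 2) + cexp (- (z / 2)) = 2 * (jder 0 z + z * jder 1 z).
  by rewrite c mulrCA divff ?mulr1 // pnatr_eq0.
by field; rewrite z0 jz.
Qed.

Lemma sin_int (k : int) : sin (pi * k%:~R) = 0 :> R.
Proof.
have sk (n : nat) : sin (pi * n%:R) = 0 :> R.
  elim: n => [|n IH]; first by rewrite mulr0 sin0.
  by rewrite -natr1 mulrDr mulr1 sinDpi IH oppr0.
case: k => n; first exact: sk.
by rewrite NegzE mulrNz mulrN sinN sk oppr0.
Qed.

Lemma sin_eq0_int (x : R) : sin x = 0 -> exists k : int, x = pi * k%:~R.
Proof.
move=> sx; have pi0 : 0 < pi :> R := pi_gt0 R.
pose k := Num.floor (x / pi); exists k.
pose y := x - pi * k%:~R.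
have sy : sin y = 0 by rewrite /y sinB sx sin_int mul0r mulr0 subr0.
have y0 : 0 <= y.
  by rewrite /y subr_ge0 mulrC -ler_pdivlMr // floor_le_tmp.
have y1 : y < pi.
  rewrite /y ltrBlDl -[X in _ + X]mulr1 -mulrDr mulrC -ltr_pdivrMr //.
  by have := floorD1_gt (x / pi); rewrite intrD.
have := y0; rewrite le_eqVlt => /predU1P[/esym /eqP|y0'].
  by rewrite subr_eq0 => /eqP.
have : 0 < sin y by apply: sin_gt0_pi; rewrite y0' y1.
by rewrite sy ltxx.
Qed.

Lemma jder0_0 : jder 0 0 = 1 :> R[i].
Proof.
apply: rho_inj; rewrite -rho_cser; last exact: jcoef_bounded.
have -> : rho (0 : R[i]) = 0 by rewrite -(subrr 0) rhoD rhoN subrr.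
by rewrite mpser0 ?rho1 /jcoef /= ?sinhc0 //; apply: sinhc_bounded.
Qed.

(** [sinh (z / 2)] vanishes on [2 pi i k], and dividing by [z / 2] removes the zero
    at the origin. *)
Lemma jder0_eq0 z : jder 0 z = 0 <-> poles z.
Proof.
split=> [jz|[k k0 ->]]; last first.
  set w := 0 +i* _; have w0 : w != 0.
    rewrite eq_complex /= eqxx /= !mulf_neq0 ?intr_eq0 ?pnatr_eq0 //.
    by rewrite gt_eqF // pi_gt0.
  apply: (mulfI w0); rewrite jder0_sinh mulr0 half_real /w /cexp /=.
  rewrite !mul0r !mulr0 subr0 addr0 oppr0 expR0 sinN cosN.
  have -> : 2^-1 * (2 * pi * k%:~R) = pi * k%:~R :> R by field.
  by rewrite sin_int oppr0 subrr.
have z0 : z != 0.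
  by apply/eqP => z0; move: jz; rewrite z0 jder0_0 => /eqP; rewrite oner_eq0.
have := jder0_sinh z; rewrite jz mulr0 => /esym /eqP; rewrite subr_eq0.
rewrite half_real; case: z z0 {jz} => x y z0.
rewrite /cexp /= !mul0r subr0 addr0 sinN cosN => /eqP [].
set X := 2^-1 * x; set Y := 2^-1 * y => hc hs.
have sY : sin Y = 0.
  have : (expR X + expR (- X)) * sin Y = 0 by rewrite mulrDl hs; ring.
  move/eqP; rewrite mulf_eq0 => /orP[|/eqP //].
  by rewrite gt_eqF // addr_gt0 ?expR_gt0.
have cY : cos Y != 0.
  apply/eqP => cY; have := cos2Dsin2 Y; rewrite cY sY !expr0n /= addr0 => /esym /eqP.
  by rewrite oner_eq0.
have X0 : x = 0.
  have /expR_inj h := mulIf cY hc.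
  have : X + X = 0 by rewrite {2}h subrr.
  by rewrite /X -mulrDl -[2^-1 + _]mulr2n -[_ *+ 2]mulr_natr mulVf ?mul1r.
have [k hk] := sin_eq0_int sY.
exists k; last by rewrite X0 -mulrA -hk /Y mulVKf.
apply/eqP => k0; move: z0; rewrite X0 eq_complex /= eqxx /=.
have -> : y = 2 * Y by rewrite /Y mulVKf.
by rewrite hk k0 !mulr0 eqxx.
Qed.

End SinhcOnComplex.

(** * Power series on generalized eigenvectors *)

Section ComplexLimits.
Local Open Scope complex_scope.
Variable R : realType.

(** Convergence of complex sequences, transported to real matrices. *)
Definition ccvg (w : nat -> R[i]) (l : R[i]) := mcvg (fun N => rho (w N)) (rho l).

Lemma ccvg_unique w l1 l2 : ccvg w l1 -> ccvg w l2 -> l1 = l2.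
Proof. by move=> h1 h2; apply/rho_inj/(mcvg_unique h1 h2). Qed.

Lemma ccvgMr w l c : ccvg w l -> ccvg (fun N => w N * c) (l * c).
Proof.
move=> h; rewrite /ccvg rhoM; under eq_fun do rewrite rhoM.
exact: mcvgMr.
Qed.

Lemma ccvg_sum (I : Type) (s : seq I) (w : I -> nat -> R[i]) (l : I -> R[i]) :
  (forall i, ccvg (w i) (l i)) ->
  ccvg (fun N => \sum_(i <- s) w i N) (\sum_(i <- s) l i).
Proof.
move=> h a b; rewrite rho_sum summxE.
under eq_fun do rewrite rho_sum summxE.
by apply: cvg_fsum => i _; apply: h.
Qed.

Lemma ccvg_real (x : nat -> R) (l : R) :
  x @ \oo --> l -> ccvg (fun N => (x N)%:C) l%:C.
Proof.
move=> h i j; have e (c : R) : rho c%:C i j = c * (rho 1 i j).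
  by rewrite -[c%:C]mulr1 rhoZ mxE.
by rewrite e; under eq_fun do rewrite e; apply: cvgMr_tmp.
Qed.

Lemma ccvg_shift k w l : ccvg (fun N => w (k + N)%N) l -> ccvg w l.
Proof.
move=> h i j; have := h i j.
rewrite -(cvg_shiftn k (fun N => rho (w N) i j)).
by under eq_fun do rewrite addnC.
Qed.

End ComplexLimits.

Section GeneralizedEigenvectors.
Local Open Scope complex_scope.
Variables (R : realType) (n : nat).
Implicit Types (u : nat -> R) (A : 'M[R]_n) (z : R[i]) (v : 'rV[R[i]]_n).

Lemma geneig_exp (B : 'M[R[i]]_n) z v m l : v *m (B - z%:M) ^+ m = 0 ->
  v *m B ^+ l = \sum_(k < m) ('C(l, k)%:R * z ^+ (l - k)) *: (v *m (B - z%:M) ^+ k).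
Proof.
set N := B - z%:M => vN.
have comm : GRing.comm (z%:M : 'M[R[i]]_n) N.
  by rewrite /GRing.comm; apply: esym; apply: scalar_mxC.
have -> : B = z%:M + N by rewrite /N addrC subrK.
rewrite exprDn_comm // mulmx_sumr.
pose F k := ('C(l, k)%:R * z ^+ (l - k)) *: (v *m N ^+ k).
have zX k : z%:M ^+ k = (z ^+ k)%:M :> 'M[R[i]]_n.
  elim: k => [|k IH]; first by rewrite expmx0.
  by rewrite expmxS IH exprS -scalar_mxM.
transitivity (\sum_(k < l.+1) F k).
  apply: eq_bigr => k _; rewrite /F zX -[_%:M * _]/(_%:M *m _) mul_scalar_mx.
  by rewrite -scaler_nat scalerA -scalemxAr.
have F1 k : (l.+1 <= k)%N -> F k = 0 by move=> lk; rewrite /F bin_small // mul0r scale0r.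
have F2 k : (m <= k)%N -> F k = 0.
  move=> mk; rewrite /F -(subnKC mk) expmxD mulmxA vN mul0mx.
  by rewrite scaler0.
by rewrite -(sum_ord_vanish m F1) addnC (sum_ord_vanish l.+1 F2).
Qed.

Lemma iter_dcoefE u k l :
  iter k (@dcoef R) u l = (k + l)`!%:R / l`!%:R * u (k + l)%N.
Proof.
elim: k l => [|k IH] l; first by rewrite add0n divff ?mul1r // pnatr_eq0 -lt0n fact_gt0.
rewrite /= /dcoef IH addnS addSn !factS !natrM.
have h4 : (l`!%:R : R) != 0 by rewrite pnatr_eq0 -lt0n fact_gt0.
by field; rewrite h4 nat1r pnatr_eq0.
Qed.

Lemma iter_dcoef_bounded u k : exp_bounded u -> exp_bounded (iter k (@dcoef R) u).
Proof. by move=> hu; elim: k => //= k IH; apply: dcoef_bounded. Qed.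

(** These are the coefficients of [(z + N) ^+ l] on [N ^+ k], weighted by [u]. *)
Lemma taylor_coef_cvg u k z : exp_bounded u ->
  ccvg (fun N => \sum_(l < N) (u l)%:C * ('C(l, k)%:R * z ^+ (l - k)))
    (cser (iter k (@dcoef R) u) z / k`!%:R).
Proof.
move=> hu; apply: (@ccvg_shift _ k).
have -> : (fun N => \sum_(l < k + N) (u l)%:C * ('C(l, k)%:R * z ^+ (l - k))) =
    (fun N => (\sum_(l < N) (iter k (@dcoef R) u l)%:C * z ^+ l) * k`!%:R^-1).
  apply/funext => N; rewrite big_split_ord /= big1 ?add0r => [|l _]; last first.
    by rewrite bin_small // mul0r mulr0.
  rewrite mulr_suml; apply: eq_bigr => l _; rewrite iter_dcoefE addKn.
  rewrite rmorphM rmorphM fmorphV !rmorph_nat -(bin_fact (leq_addr l k)) addKn !natrM.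
  have h1 : (k`!%:R : R[i]) != 0 by rewrite pnatr_eq0 -lt0n fact_gt0.
  have h2 : (l`!%:R : R[i]) != 0 by rewrite pnatr_eq0 -lt0n fact_gt0.
  by field; rewrite h1 h2.
apply: ccvgMr; rewrite /ccvg -rho_cser; last exact: iter_dcoef_bounded.
under eq_fun do rewrite -mpsum_rho.
exact/mpser_cvg/iter_dcoef_bounded.
Qed.

Lemma cplx_mpsum u A N :
  cplx_mx (mpsum u A N) = \sum_(l < N) (u l)%:C *: cplx_mx A ^+ l.
Proof.
rewrite /mpsum /cplx_mx raddf_sum; apply: eq_bigr => l _.
rewrite /= map_mxZ; congr (_ *: _); elim: (nat_of_ord l) => [|k IH].
  by rewrite !expmx0 map_mx1.
by rewrite !expmxS map_mxM IH.
Qed.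

(** Expand [A ^+ l = (z + N) ^+ l] in powers of the nilpotent part [N], then sum
    over [l]: the coefficient of [N ^+ k] is a Taylor coefficient. *)
Lemma geneig_mpser u A z v m : exp_bounded u ->
  v *m (cplx_mx A - z%:M) ^+ m = 0 ->
  v *m cplx_mx (mpser u A) = \sum_(k < m)
    (cser (iter k (@dcoef R) u) z / k`!%:R) *: (v *m (cplx_mx A - z%:M) ^+ k).
Proof.
move=> hu vN; apply/rowP => j.
have h1 : ccvg (fun N => (v *m cplx_mx (mpsum u A N)) 0 j)
    ((v *m cplx_mx (mpser u A)) 0 j).
  rewrite mxE; under eq_fun do rewrite mxE.
  apply: ccvg_sum => i; rewrite mulrC; under eq_fun do rewrite mulrC.
  apply: ccvgMr; rewrite mxE; under eq_fun do rewrite mxE.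
  by apply: ccvg_real; apply: mpser_cvg.
apply: (ccvg_unique h1).
have -> : (fun N => (v *m cplx_mx (mpsum u A N)) 0 j) = fun N => \sum_(k < m)
    (\sum_(l < N) (u l)%:C * ('C(l, k)%:R * z ^+ (l - k))) *
      (v *m (cplx_mx A - z%:M) ^+ k) 0 j.
  apply/funext => N; rewrite cplx_mpsum mulmx_sumr summxE.
  under [RHS]eq_bigr do rewrite mulr_suml.
  rewrite exchange_big /=; apply: eq_bigr => l _.
  rewrite -scalemxAr (geneig_exp _ vN) mxE summxE mulr_sumr.
  apply: eq_bigr => k _; rewrite mxE; exact: mulrA.
have e (c : R[i]) (w : 'rV[R[i]]_n) : (c *: w) 0 j = c * w 0 j by rewrite mxE.
rewrite summxE.
apply: ccvg_sum => k.
rewrite e.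
apply: ccvgMr.
exact: taylor_coef_cvg.
Qed.

End GeneralizedEigenvectors.

(** * The functional calculus of f *)

Section GeneralizedEigenspaces.
Local Open Scope complex_scope.
Variables (C : closedFieldType) (n : nat).
Implicit Types (B : 'M[C]_n).

Lemma split_annihilator B : exists s : seq C, \prod_(z <- s) (B - z%:M) = 0.
Proof.
case: n B => [|m] B.
  by exists [::]; apply/matrixP => -[].
have [s hs] := closed_field_poly_normal (char_poly B).
exists s; have := Cayley_Hamilton B; rewrite hs (monicP (char_poly_monic B)) scale1r.
rewrite rmorph_prod /= => <-; apply: eq_bigr => z _.
by rewrite rmorphB /= horner_mx_X horner_mx_C.
Qed.

(** Generalized eigenvectors span.  Induct on the degree of a polynomial [p]
    annihilating the vector: splitting off a root [z] as
    [p = q * ('X - z) ^+ l] with [q] prime to the second factor, Bezout writes the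
    vector as a generalized eigenvector for [z] plus a vector killed by [q]. *)
Lemma geneig_ind B (P : 'rV[C]_n -> Prop) :
  P 0 -> (forall v w, P v -> P w -> P (v + w)) ->
  (forall z m v, v *m (B - z%:M) ^+ m = 0 -> P v) -> forall v, P v.
Proof.
case: n B P => [|m] B P P0 PD PE v.
  by rewrite (_ : v = 0) //; apply/rowP => -[].
have main : forall d (p : {poly C}) w, (size p <= d)%N -> p != 0 ->
    w *m horner_mx B p = 0 -> P w.
  elim=> [p w|d IH p w sp p0 wp]; first by
    rewrite leqn0 size_poly_eq0 => /eqP ->; rewrite eqxx.
  have [p1|/closed_rootP[z pz]] := eqVneq (size p) 1%N.
    have /eqP/size_poly1P[c c0 pc] := p1.
    suff -> : w = 0 by [].
    move: wp; rewrite pc horner_mx_C mul_mx_scalar => /eqP.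
    by rewrite scaler_eq0 (negPf c0) => /eqP.
  have [l [q qz pq]] := multiplicity_XsubC p z.
  rewrite p0 /= in qz.
  have cop : coprimep q (('X - z%:P) ^+ l).
    by apply: coprimep_expr; rewrite coprimep_XsubC.
  have /Bezout_eq1_coprimepP[[a b] /= ab] := cop.
  have l0 : (0 < l)%N.
    rewrite lt0n; apply/eqP => l0; move: pz; rewrite pq l0 expr0 mulr1.
    by rewrite (negPf qz).
  have q0 : q != 0 by apply/eqP => q0; move: p0; rewrite pq q0 mul0r eqxx.
  have -> : w = w *m horner_mx B (a * q) + w *m horner_mx B (b * ('X - z%:P) ^+ l).
    by rewrite -mulmxDr -rmorphD /= ab rmorph1 mulmx1.
  apply: PD.
    apply: (PE z l).
    have -> : (B - z%:M) ^+ l = horner_mx B (('X - z%:P) ^+ l).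
      by rewrite rmorphXn rmorphB /= horner_mx_X horner_mx_C.
    rewrite -mulmxA mulmxE -rmorphM /= -mulrA -pq mulrC rmorphM /= -mulmxE mulmxA.
    by rewrite wp mul0mx.
  apply: (IH q) => //.
    rewrite -ltnS (leq_trans _ sp) // pq size_Mmonic ?monic_exp ?monicXsubC //.
    rewrite size_exp_XsubC addnS /= -addn1 leq_add2l //.
  rewrite -mulmxA mulmxE -rmorphM /= mulrC mulrCA mulrC -pq rmorphM /= -mulmxE mulmxA.
  by rewrite wp mul0mx.
apply: (main (size (char_poly B)) (char_poly B)) => //.
  by rewrite monic_neq0 // char_poly_monic.
by rewrite Cayley_Hamilton mulmx0.
Qed.

End GeneralizedEigenspaces.

Section SinhcFunctionalCalculus.
Local Open Scope complex_scope.
Variables (R : realType) (n : nat).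
Implicit Types (A : 'M[R]_n) (z : R[i]) (v : 'rV[R[i]]_n).

Lemma matrix_fun_unique (f : R[i] -> R[i]) (B M1 M2 : 'M[R[i]]_n) :
  is_matrix_fun f B M1 -> is_matrix_fun f B M2 -> M1 = M2.
Proof.
move=> h1 h2; apply/row_matrixP => i; rewrite !rowE.
pose P (v : 'rV[R[i]]_n) := v *m M1 = v *m M2.
suff h : forall v, P v by exact: h.
apply: (@geneig_ind R[i] n B P); rewrite /P.
- by rewrite !mul0mx.
- by move=> v w hv hw; rewrite !mulmxDl hv hw.
- by move=> z m v hv; rewrite (h1 z m v hv) (h2 z m v hv).
Qed.

Local Notation J A := (mpser (sinhc R) A).
Local Notation K A := (mpser (dcoef (sinhc R)) A).

Lemma eigenvector_J A z v : v *m (cplx_mx A - z%:M) = 0 ->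
  v *m cplx_mx (J A) = jder 0 z *: v.
Proof.
move=> h; rewrite (geneig_mpser (z := z) (m := 1)) ?expr1 //; last exact: sinhc_bounded.
by rewrite big_ord_recl big_ord0 addr0 /= divr1 expmx0 mulmx1.
Qed.

(** [j (A)] acts on an eigenvector by [j (z)], and the poles of [f] are the zeros
    of [j].  A kernel of [j (A)] is stable under [A], hence contains an
    eigenvector as soon as it is not zero. *)
Lemma J_unitP A : J A \in unitmx <->
  (forall z, eigenvalue (cplx_mx A) z -> ~ poles z).
Proof.
split=> [Ju z /eigenvalueP[v vA v0] /jder0_eq0 jz|h].
  have := @eigenvector_J A z v; rewrite mulmxBr vA mul_mx_scalar subrr => /(_ erefl).
  rewrite jz scale0r => vJ; move/eqP: v0; apply.
  have Ju' : cplx_mx (J A) \in unitmx by rewrite map_unitmx.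
  by rewrite -[v](mulmxK Ju') vJ mul0mx.
have ker_trivial v : v *m cplx_mx (J A) = 0 -> v = 0.
  have [s hs] := split_annihilator (cplx_mx A).
  have : v *m \prod_(z <- s) (cplx_mx A - z%:M) = 0 by rewrite hs mulmx0.
  elim: s {hs} v => [|z s IH] v; first by rewrite big_nil mulmx1.
  rewrite big_cons -mulmxE mulmxA => vs vJ.
  have vz : v *m (cplx_mx A - z%:M) = 0.
    apply: IH => //; rewrite -mulmxA mulmxBl.
    have -> : cplx_mx A *m cplx_mx (J A) = cplx_mx (J A) *m cplx_mx A.
      by rewrite -!map_mxM mpser_comm //; exact: sinhc_bounded.
    by rewrite mul_scalar_mx -mul_mx_scalar -mulmxBr mulmxA vJ mul0mx.
  have := eigenvector_J vz; rewrite vJ => /esym/eqP; rewrite scaler_eq0.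
  case/orP => [/eqP jz|/eqP //]; apply/eqP; apply: contraT => v0.
  case: (h z); last exact/jder0_eq0.
  apply/eigenvalueP; exists v => //.
  by move/eqP: vz; rewrite mulmxBr mul_mx_scalar subr_eq0 => /eqP.
rewrite -(map_unitmx (real_complex R)) -row_free_unit -kermx_eq0.
apply/eqP/row_matrixP => i; rewrite row0; apply: ker_trivial.
by rewrite -row_mul mulmx_ker row0.
Qed.

(** The Taylor expansion of [f] times that of [j] is that of [j'], by
    [quotient_leibniz]; on a generalized eigenvector the three expansions are [f (A)],
    [J] and [K]. *)
Lemma f_matrix_fun A : J A \in unitmx ->
  is_matrix_fun (@f_cdybe R) (cplx_mx A) (cplx_mx (invmx (J A) *m K A)).
Proof.
move=> Ju z m v vN; set N := cplx_mx A - z%:M in vN *.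
have [ev|nev] := boolP (eigenvalue (cplx_mx A) z); last first.
  have Nu : N \in unitmx.
    by rewrite -row_free_unit -kermx_eq0; move: nev; rewrite negbK.
  have -> : v = 0.
    elim: m vN => [|m IH]; first by rewrite mulmx1.
    by rewrite expmxSr mulmxA => h; apply: IH; rewrite -[LHS](mulmxK Nu) h mul0mx.
  by rewrite mul0mx big1 // => k _; rewrite mul0mx scaler0.
have jz : jder 0 z != 0.
  by apply/eqP => /jder0_eq0; apply: (proj1 (J_unitP A)).
pose a k := derive1n k (@f_cdybe R : R[i]^o -> R[i]^o) z / k`!%:R.
pose b k := jder k z / k`!%:R.
pose w p := v *m N ^+ p.
have hw p : (m <= p)%N -> w p = 0.
  by move=> mp; rewrite /w -(subnKC mp) expmxD mulmxA vN mul0mx.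
have Ju' : cplx_mx (J A) \in unitmx by rewrite map_unitmx.
have JK : J A *m K A = K A *m J A.
  apply: mpser_intertwine; first exact: sinhc_bounded.
  by rewrite mpser_comm //; exact: dsinhc_bounded.
have vK : v *m cplx_mx (K A) = \sum_(p < m) (jder p.+1 z / p`!%:R) *: w p.
  rewrite (geneig_mpser (z := z) (m := m)) //; last exact: dsinhc_bounded.
  by apply: eq_bigr => p _; rewrite /jder /jcoef iterSr.
have wJ k : w k *m cplx_mx (J A) = \sum_(l < m) b l *: w (k + l)%N.
  rewrite (geneig_mpser (z := z) (m := m)); last first.
  - by rewrite -/N /w -mulmxA -expmxD addnC expmxD mulmxA vN mul0mx.
  - exact: sinhc_bounded.
  by apply: eq_bigr => l _; rewrite /w -mulmxA -expmxD.
have key : (\sum_(k < m) a k *: w k) *m cplx_mx (J A) = v *m cplx_mx (K A).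
  rewrite vK mulmx_suml.
  under eq_bigr => k _ do rewrite -scalemxAl wJ scaler_sumr.
  under eq_bigr => k _ do under eq_bigr => l _ do rewrite scalerA.
  rewrite truncated_cauchy //; apply: eq_bigr => p _; congr (_ *: _).
  have := @quotient_leibniz _ (@f_cdybe R : R[i]^o -> R[i]^o)
    (fun k => jder k : R[i]^o -> R[i]^o) (fun k => jder k.+1 : R[i]^o -> R[i]^o).
  move=> /(_ (fun k z => jder_is_derive k z) (fun k z => jder_is_derive k.+1 z)).
  by move=> /(_ (fun z => @f_cdybe_mul R z) p z jz)[_ <-].
rewrite -(mulmxK Ju' (\sum_(k < m) _)) key -mulmxA; congr (_ *m _).
apply: (canRL (mulmxK Ju')).
by rewrite -[LHS]map_mxM -mulmxA -JK mulKmx.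
Qed.

End SinhcFunctionalCalculus.

Section RealFunctionalCalculus.
Local Open Scope complex_scope.
Variables (R : realType) (V : vectType R).
Implicit Types T : 'End(V).

Definition of_mx (M : 'M[R]_(\dim {:V})) : 'End(V) :=
  passmx.hommx (vbasis {:V}) (vbasis {:V}) M.

Lemma lfun_fun_f_cdybe T : mpser (sinhc R) (mx_of T) \in unitmx ->
  lfun_fun (@f_cdybe R) T =
    of_mx (invmx (mpser (sinhc R) (mx_of T)) *m mpser (dcoef (sinhc R)) (mx_of T)).
Proof.
move=> Ju; rewrite /lfun_fun /of_mx; congr (passmx.hommx _ _ _).
set M := invmx _ *m _; have hM := f_matrix_fun Ju.
case: xgetP => [M' _ hM'|/(_ M)]; last by case.
have := matrix_fun_unique hM' hM => /matrixP E; apply/matrixP => i j.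
by have := E i j; rewrite !mxE => /complexI.
Qed.

End RealFunctionalCalculus.

(** * Entire functions *)

Section CauchyProduct.
Variable R : realType.
Implicit Types a b p q : nat -> R.

Definition cauchy a b k : R := \sum_(i < k.+1) a i * b (k - i)%N.

Lemma cauchy_partial_sum a b N : \sum_(k < N) cauchy a b k =
  \sum_(k < N) \sum_(l < N) a k * b l * (k + l < N)%:R.
Proof.
have := @truncated_cauchy R R^o N a b (fun s : nat => (s < N)%:R : R).
move=> ->; last by move=> s; rewrite leqNgt => /negbTE ->.
by apply: eq_bigr => k _; rewrite ltn_ord -[_ *: _]/(_ * _) mulr1.
Qed.

Lemma series_ord a N : series a N = \sum_(k < N) a k.
Proof. by rewrite /series /= big_mkord. Qed.

Lemma cvg_double (u : nat -> R) (l : R) :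
  u @ \oo --> l -> (fun N => u (N + N)%N) @ \oo --> l.
Proof.
move=> h; apply: (cvg_comp _ _ _ h) => A [N _ hN]; exists N => // k /= Nk.
by apply: hN; rewrite /= (leq_trans Nk) // leq_addl.
Qed.

(** Mertens' theorem with explicit majorants [p] and [q].  The triangle
    [i + j < N] lies in the square of side [N], which lies in the triangle of
    side [2 N]; so the terms missing from the triangle go to zero. *)
Lemma cauchy_product a b p q (la lb : R) :
  (forall k, `|a k| <= p k) -> (forall k, `|b k| <= q k) ->
  cvgn (series p) -> cvgn (series q) ->
  series a @ \oo --> la -> series b @ \oo --> lb ->
  cvgn (series (cauchy p q)) /\ series (cauchy a b) @ \oo --> la * lb.
Proof.
move=> ap bq cp cq ha hb.
have p0 k : 0 <= p k by apply: le_trans (ap k).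
have q0 k : 0 <= q k by apply: le_trans (bq k).
have pq0 i j : 0 <= p i * q j by rewrite mulr_ge0.
pose P := series p; pose Q := series q; pose C := series (cauchy p q).
have PQ N : P N * Q N = \sum_(i < N) \sum_(j < N) p i * q j.
  rewrite /P /Q !series_ord mulr_suml; apply: eq_bigr => i _.
  by rewrite mulr_sumr.
have CE N : C N = \sum_(i < N) \sum_(j < N) p i * q j * (i + j < N)%:R.
  by rewrite /C series_ord cauchy_partial_sum.
have CPQ N : C N <= P N * Q N.
  rewrite PQ CE; apply: ler_sum => i _; apply: ler_sum => j _.
  by apply: ler_piMr => //; case: (_ < _)%N.
have PQC N : P N * Q N <= C (N + N)%N.
  rewrite PQ CE big_split_ord /= -[leLHS]addr0; apply: lerD; last first.
    apply: sumr_ge0 => i _; apply: sumr_ge0 => j _.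
    by rewrite mulr_ge0.
  apply: ler_sum => i _; rewrite big_split_ord /= -[leLHS]addr0; apply: lerD; last first.
    by apply: sumr_ge0 => j _; rewrite mulr_ge0.
  by apply: ler_sum => j _; rewrite -addnS leq_add ?mulr1 // ltnW.
have mono (w : nat -> R) : (forall k, 0 <= w k) -> nondecreasing_seq (series w).
  move=> w0; apply/nondecreasing_seqP => k.
  by rewrite /series /= big_nat_recr //= lerDl.
have PQl N : P N * Q N <= limn P * limn Q.
  apply: ler_pM; rewrite ?/P ?/Q ?series_ord ?sumr_ge0 // -series_ord.
    by apply: nondecreasing_cvgn_le => //; apply: mono.
  by apply: nondecreasing_cvgn_le => //; apply: mono.
have cC : cvgn C.
  apply: nondecreasing_is_cvgn.
    by apply: mono => k; apply: sumr_ge0.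
  by exists (limn P * limn Q) => _ [N _ <-]; apply: le_trans (PQl N).
split=> //.
have d0 : (fun N => P N * Q N - C N) @ \oo --> (0 : R).
  apply: (@squeeze_cvgr _ _ _ _ (fun=> 0) (fun N => C (N + N)%N - C N)).
  - by apply: nearW => N; rewrite subr_ge0 CPQ lerD2r PQC.
  - exact: cvg_cst.
  - rewrite -(subrr (limn C)); apply: cvgB => //; exact: cvg_double.
have dab N : `|series a N * series b N - series (cauchy a b) N| <= P N * Q N - C N.
  rewrite PQ CE !series_ord cauchy_partial_sum mulr_suml.
  rewrite -sumrB -sumrB (le_trans (ler_norm_sum _ _ _)) //.
  apply: ler_sum => i _; rewrite mulr_sumr -sumrB -sumrB.
  rewrite (le_trans (ler_norm_sum _ _ _)) //; apply: ler_sum => j _.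
  case: (_ < _)%N; first by rewrite !mulr1 !subrr normr0.
  by rewrite !mulr0 !subr0 normrM ler_pM.
have e0 : (fun N => series a N * series b N - series (cauchy a b) N) @ \oo --> (0 : R).
  apply/norm_cvg0P.
  apply: (@squeeze_cvgr _ _ _ _ (fun=> 0) (fun N => P N * Q N - C N)) => //.
  - by apply: nearW => N; rewrite normr_ge0 dab.
  - exact: cvg_cst.
have -> : series (cauchy a b) = (fun N => series a N * series b N -
    (series a N * series b N - series (cauchy a b) N)).
  by apply/funext => N; rewrite opprB addrC subrK.
by rewrite -[la * lb]subr0; apply: cvgB => //; apply: cvgM.
Qed.

End CauchyProduct.

Section SumsOverWords.
Variables (R : realType) (n : nat).
Implicit Types F G : seq 'I_n -> R.

Definition wsum k F : R := \sum_(t : k.-tuple 'I_n) F t.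

Lemma wsum0 F : wsum 0 F = F [::].
Proof.
rewrite /wsum (bigD1 [tuple]) //= big1 ?addr0 // => t.
by rewrite tuple0 => /eqP.
Qed.

Lemma wsumS k F : wsum k.+1 F = \sum_i wsum k (fun t => F (i :: t)).
Proof.
rewrite /wsum pair_big /=.
rewrite (reindex (fun p : 'I_n * k.-tuple 'I_n => cons_tuple p.1 p.2)) //=.
exists (fun t => (thead t, behead_tuple t)) => [[i t] _|t _] /=.
  by congr pair; apply: val_inj.
by rewrite [RHS]tuple_eta; apply: val_inj.
Qed.

Lemma wsum_cat k l F : wsum (k + l) F = wsum k (fun s => wsum l (fun t => F (s ++ t))).
Proof.
elim: k F => [|k IH] F; first by rewrite wsum0.
by rewrite addSn !wsumS; apply: eq_bigr => i _; rewrite IH.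
Qed.

(** The coefficients of a product of two power series in non-commuting letters:
    a word is cut into a prefix and a suffix in all possible ways. *)
Definition wconv F G (t : seq 'I_n) : R :=
  \sum_(i < (size t).+1) F (take i t) * G (drop i t).

Lemma wsum_wconv k F G :
  wsum k (wconv F G) = cauchy (fun i => wsum i F) (fun i => wsum i G) k.
Proof.
rewrite /cauchy; transitivity (\sum_(i < k.+1)
    wsum k (fun t => F (take i t) * G (drop i t))).
  rewrite /wsum exchange_big /=; apply: eq_bigr => t _.
  by rewrite /wconv size_tuple.
apply: eq_bigr => i _; have ik : (i <= k)%N by rewrite -ltnS.
rewrite -{1}(subnKC ik) wsum_cat /wsum mulr_suml; apply: eq_bigr => s _.
rewrite mulr_sumr; apply: eq_bigr => t _.
by rewrite take_size_cat ?drop_size_cat // size_tuple.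
Qed.

End SumsOverWords.

Section EntireFunctions.
Variables (R : realType) (g : quadLie R) (n : nat) (e : n.-tuple g).
Implicit Types F G : g -> R.

Lemma entire_cst (a : R) : entire e (fun=> a).
Proof.
pose c (t : seq 'I_n) := if t is [::] then a else 0.
exists c => x; pose term (t : seq 'I_n) := c t * monomial e t x.
have c0 (f : R -> R) : f 0 = 0 ->
    series (fun k => wsum k (f \o term)) @ \oo --> f a.
  move=> f0; apply: cvg_near_cst; exists 1%N => // -[|N] //= _.
  rewrite /series /= big_nat_recl // wsum0 /= /term /monomial big_nil mulr1.
  rewrite big1 ?addr0 // => k _; rewrite /wsum big1 // => t _.
  by case/tupleP: t => i t; rewrite /= mul0r.
split; last exact: (c0 idfun).
by apply/cvg_ex; exists `|a|; apply: (c0 Num.norm); rewrite normr0.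
Qed.

Lemma entireD F G : entire e F -> entire e G -> entire e (fun x => F x + G x).
Proof.
move=> [c hc] [d hd]; exists (fun t => c t + d t) => x.
have [c1 c2] := hc x; have [d1 d2] := hd x; split.
  apply: series_le_cvg (is_cvg_seriesD c1 d1) => k.
  - exact: sumr_ge0.
  - by rewrite /= addr_ge0 // sumr_ge0.
  - rewrite addrfctE -big_split; apply: ler_sum => t _ /=.
    by rewrite mulrDl ler_normD.
rewrite (_ : series _ = (fun N =>
  series (fun k => \sum_(t : k.-tuple 'I_n) c t * monomial e t x) N +
  series (fun k => \sum_(t : k.-tuple 'I_n) d t * monomial e t x) N)).
  exact: cvgD.
apply/funext => N; rewrite /series /= -big_split; apply: eq_bigr => k _ /=.
by rewrite -big_split; apply: eq_bigr => t _; rewrite mulrDl.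
Qed.

Lemma entireM F G : entire e F -> entire e G -> entire e (fun x => F x * G x).
Proof.
move=> [c hc] [d hd]; exists (wconv c d) => x.
have [c1 c2] := hc x; have [d1 d2] := hd x.
have mono t : (wconv c d t) * monomial e t x =
    wconv (fun t => c t * monomial e t x) (fun t => d t * monomial e t x) t.
  rewrite /wconv mulr_suml; apply: eq_bigr => i _.
  rewrite [monomial e t x](_ : _ = monomial e (take i t) x * monomial e (drop i t) x).
    by ring.
  by rewrite /monomial -big_cat cat_take_drop.
have bound (f : seq 'I_n -> R) k : `|\sum_(t : k.-tuple 'I_n) f t| <=
    \sum_(t : k.-tuple 'I_n) `|f t| by exact: ler_norm_sum.
have [h1 h2] := cauchy_product (bound (fun t => c t * monomial e t x))
   (bound (fun t => d t * monomial e t x)) c1 d1 c2 d2.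
split; last first.
  rewrite (_ : (fun k => _) = cauchy (fun k => wsum k (fun t => c t * monomial e t x))
     (fun k => wsum k (fun t => d t * monomial e t x))) //.
  apply/funext => k; rewrite -wsum_wconv; apply: eq_bigr => t _.
  exact: mono.
apply: series_le_cvg h1 => k.
- exact: sumr_ge0.
- by apply: sumr_ge0 => i _; rewrite mulr_ge0 // sumr_ge0.
- rewrite -[leRHS](wsum_wconv k (fun t => `|c t * monomial e t x|)
     (fun t => `|d t * monomial e t x|)).
  apply: ler_sum => t _; rewrite mono /wconv (le_trans (ler_norm_sum _ _ _)) //.
  by apply: ler_sum => i _; rewrite normrM.
Qed.

Lemma eq_entire F G : (forall x, F x = G x) -> entire e F -> entire e G.
Proof. by move=> h; rewrite (_ : F = G) //; apply/funext. Qed.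

Lemma entire_sum (I : Type) (s : seq I) (P : pred I) (F : I -> g -> R) :
  (forall i, entire e (F i)) -> entire e (fun x => \sum_(i <- s | P i) F i x).
Proof.
move=> h; elim: s => [|i s IH].
  by apply: eq_entire (entire_cst 0) => x; rewrite big_nil.
case Pi: (P i); last by apply: eq_entire IH => x; rewrite big_cons Pi.
by apply: eq_entire (entireD (h i) IH) => x; rewrite big_cons Pi.
Qed.

Lemma entire_prod (I : Type) (s : seq I) (P : pred I) (F : I -> g -> R) :
  (forall i, entire e (F i)) -> entire e (fun x => \prod_(i <- s | P i) F i x).
Proof.
move=> h; elim: s => [|i s IH].
  by apply: eq_entire (entire_cst 1) => x; rewrite big_nil.
case Pi: (P i); last by apply: eq_entire IH => x; rewrite big_cons Pi.
by apply: eq_entire (entireM (h i) IH) => x; rewrite big_cons Pi.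
Qed.

Definition entire_mx m p (M : g -> 'M[R]_(m, p)) :=
  forall i j, entire e (fun x => M x i j).

Lemma entire_mulmx m p q (M : g -> 'M[R]_(m, p)) (N : g -> 'M[R]_(p, q)) :
  entire_mx M -> entire_mx N -> entire_mx (fun x => M x *m N x).
Proof.
move=> hM hN i j; apply: (@eq_entire (fun x => \sum_k M x i k * N x k j)) => [x|].
  by rewrite mxE.
by apply: entire_sum => k; apply: entireM.
Qed.

Lemma entire_det m (M : g -> 'M[R]_m) : entire_mx M -> entire e (fun x => \det (M x)).
Proof.
move=> hM; apply: entire_sum => s; apply: entireM; first exact: entire_cst.
by apply: entire_prod => i; apply: hM.
Qed.

Lemma entire_adj m (M : g -> 'M[R]_m) : entire_mx M -> entire_mx (fun x => \adj (M x)).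
Proof.
move=> hM i j; apply: (@eq_entire (fun x => cofactor (M x) j i)) => [x|].
  by rewrite mxE.
apply: entireM; first exact: entire_cst.
apply: entire_det => k l.
by apply: eq_entire (hM (lift j k) (lift i l)) => x; rewrite !mxE.
Qed.

(** The coefficient of a word is the product of its matrices times the coefficient
    of the series in that degree. *)
Lemma entire_mpser u m (B : 'I_n -> 'M[R]_m) : exp_bounded u ->
  entire_mx (fun x => mpser u (\sum_i coord e i x *: B i)).
Proof.
move=> hu i j.
pose W (t : seq 'I_n) : 'M[R]_m := foldr (fun k M => B k *m M) 1%:M t.
exists (fun t => u (size t) * W t i j) => x.
pose S : 'M[R]_m := \sum_k coord e k x *: B k.
have powE k i0 : (S ^+ k) i0 j = wsum k (fun t => monomial e t x * W t i0 j).
  elim: k i0 => [|k IH] i0; first by rewrite wsum0 /monomial big_nil mul1r expmx0.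
  rewrite wsumS expmxS /S mulmx_suml summxE; apply: eq_bigr => l _.
  rewrite -scalemxAl mxE mxE mulr_sumr.
  under eq_bigr => p _ do rewrite -/S IH /wsum mulr_sumr mulr_sumr.
  rewrite exchange_big /=; apply: eq_bigr => t _.
  rewrite /monomial big_cons /= mxE mulr_sumr.
  by apply: eq_bigr => p _; ring.
have termE k : \sum_(t : k.-tuple 'I_n) u (size t) * W t i j * monomial e t x =
    u k * (S ^+ k) i j.
  rewrite powE /wsum mulr_sumr; apply: eq_bigr => t _.
  by rewrite size_tuple; ring.
pose r := \sum_k `|coord e k x| * mnorm (B k).
have r0 : 0 <= r by apply: sumr_ge0 => k _; rewrite mulr_ge0 ?mnorm_ge0.
have absE k : wsum k (fun t => `|monomial e t x| * mnorm (W t)) <=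
    r ^+ k * mnorm (1%:M : 'M[R]_m).
  elim: k => [|k IH]; first by rewrite wsum0 /monomial big_nil normr1.
  rewrite wsumS exprS -mulrA /r mulr_suml; apply: ler_sum => l _.
  apply: le_trans (_ : `|coord e l x| * mnorm (B l) *
     wsum k (fun t => `|monomial e t x| * mnorm (W t)) <= _); last first.
    by apply: ler_wpM2l IH; rewrite mulr_ge0 ?mnorm_ge0.
  rewrite /wsum mulr_sumr; apply: ler_sum => t _.
  rewrite /monomial big_cons normrM -/(monomial e t x).
  have := mnormM (B l) (W t); rewrite -[B l *m W t]/(W (l :: t)) => h.
  have -> : `|coord e l x| * mnorm (B l) * (`|monomial e t x| * mnorm (W t)) =
     `|coord e l x| * `|monomial e t x| * (mnorm (B l) * mnorm (W t)) by ring.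
  by apply: ler_wpM2l => //; rewrite mulr_ge0.
split.
  pose c := mnorm (1%:M : 'M[R]_m).
  apply: (@series_le_cvg _ _ (c *: exp_coeff r : R^nat)).
  - by move=> k; apply: sumr_ge0.
  - by move=> k; apply: mulr_ge0; [exact: mnorm_ge0 | exact: exp_coeff_ge0].
  - move=> k; rewrite -[leRHS]/(c * (r ^+ k / k`!%:R)).
    apply: le_trans (_ : k`!%:R^-1 *
        wsum k (fun t => `|monomial e t x| * mnorm (W t)) <= _).
      rewrite /wsum mulr_sumr; apply: ler_sum => t _; rewrite size_tuple !normrM.
      rewrite -mulrA; apply: ler_pM => //; rewrite mulrC.
      by apply: ler_wpM2l => //; apply: entry_le_mnorm.
    have -> : c * (r ^+ k / k`!%:R) = k`!%:R^-1 * (r ^+ k * c) by ring.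
    by apply: ler_wpM2l; [rewrite invr_ge0 | exact: absE].
  - by apply: is_cvg_seriesZ; apply: is_cvg_series_exp_coeff.
under eq_fun do rewrite termE.
have := @mpser_cvg _ u _ S hu i j.
by under eq_fun do rewrite mpsum_entry.
Qed.

End EntireFunctions.

(** * Associativity of the exterior product *)

Section ExteriorAssociativity.
Import mathcomp.boot.finset.
Local Open Scope set_scope.
Variables (R : comNzRingType) (n : nat).
Implicit Types (S T U V : {set 'I_n}) (x y z : ext R n).

(** A sign for each inversion: in this form the sign is multiplicative in both
    arguments, which is all that associativity needs. *)
Lemma shuffle_sign_prod S T :
  shuffle_sign R S T = \prod_(s in S) \prod_(t in T) (-1) ^+ (t < s)%N.
Proof.
rewrite /shuffle_sign pair_big /= -sum1_card prodrXr; congr (_ ^+ _).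
rewrite [RHS]big_mkcond [LHS]big_mkcond; apply: eq_bigr => p _ /=.
by rewrite !inE; case: (_ \in S); case: (_ \in T) => //=; case: (_ < _)%N.
Qed.

Lemma prod_disjointU S T (F : 'I_n -> R) : S :&: T = set0 ->
  \prod_(i in S :|: T) F i = (\prod_(i in S) F i) * \prod_(i in T) F i.
Proof.
move=> dST; rewrite -bigU /=; last by rewrite -setI_eq0 dST.
by apply: eq_bigl => i; rewrite !inE.
Qed.

Lemma shuffle_signUl S T U : S :&: T = set0 ->
  shuffle_sign R (S :|: T) U = shuffle_sign R S U * shuffle_sign R T U.
Proof. by move=> dST; rewrite !shuffle_sign_prod prod_disjointU. Qed.

Lemma shuffle_signUr S T U : S :&: T = set0 ->
  shuffle_sign R U (S :|: T) = shuffle_sign R U S * shuffle_sign R U T.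
Proof.
move=> dST; rewrite !shuffle_sign_prod -big_split; apply: eq_bigr => s _ /=.
by rewrite prod_disjointU.
Qed.

(** Both sides are sums over the ways to cut [S] into three parts; [U] is the union
    [T :|: V] of the first two. *)
Lemma wedgeA x y z : x *w y *w z = x *w (y *w z).
Proof.
apply/ffunP => S; rewrite !ffunE.
under eq_bigr => U _ do rewrite ffunE mulr_sumr mulr_suml.
rewrite (exchange_big_dep (fun T : {set 'I_n} => T \subset S)) /=; last first.
  by move=> U T US TU; apply: fintype.subset_trans TU US.
apply: eq_bigr => T TS; rewrite ffunE mulr_sumr.
rewrite (reindex_onto (fun V => T :|: V) (fun U => U :\: T)) /=; last first.
  move=> U /andP[_ /fintype.subsetP TU]; apply/setP => i; rewrite !inE.
  by case: (boolP (i \in T)) => //= /TU ->.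
have disjP V : (V \subset S :\: T) = (V \subset S) && ((T :|: V) :\: T == V).
  apply/idP/andP => [/fintype.subsetP h|[/fintype.subsetP VS /eqP h]].
    split; first by apply/fintype.subsetP => i /h; rewrite inE => /andP[].
    apply/eqP/setP => i; rewrite !inE; case: (boolP (i \in V)) => [/h|_].
      by rewrite inE => /andP[-> _]; rewrite orbT.
    by rewrite orbF; case: (i \in T).
  apply/fintype.subsetP => i iV; rewrite inE (VS _ iV) andbT.
  by move: iV; rewrite -h inE => /andP[].
have cond V : ((T :|: V \subset S) && (T \subset T :|: V)) && ((T :|: V) :\: T == V) =
    (V \subset S :\: T).
  by rewrite disjP finset.subUset TS finset.subsetUl /= andbT.
apply: eq_big => [V|V]; rewrite cond // => VST.
have /andP[VS /eqP VT] : (V \subset S) && ((T :|: V) :\: T == V) by rewrite -disjP.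
rewrite VT -setDDl.
have dTV : T :&: V = set0.
  apply/setP => i; rewrite -VT !inE.
  by case: (i \in T).
rewrite shuffle_signUl //.
have eV : S :\: T = V :|: (S :\: T) :\: V.
  apply/setP => i; rewrite in_setU !in_setD; case: (boolP (i \in V)) => //=.
  by move/(fintype.subsetP VST); rewrite in_setD.
have dV : V :&: ((S :\: T) :\: V) = set0.
  by apply/setP => i; rewrite in_setI in_setD in_set0; case: (i \in V).
have -> : shuffle_sign R T (S :\: T) =
    shuffle_sign R T V * shuffle_sign R T ((S :\: T) :\: V).
  by rewrite {1}eV shuffle_signUr.
move: (shuffle_sign R T V) (shuffle_sign R T _) (shuffle_sign R V _) => s1 s2 s3.
move: (x T) (y V) (z _) => xT yV zU; rewrite -![_ * _]/(GRing.mul (s := R) _ _).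
ring.
Qed.

End ExteriorAssociativity.

(** * From the trilinear identity to the exterior algebra *)

Section TripleSums.
Variables (R : comNzRingType) (n : nat).
Implicit Types T U : 'I_n -> 'I_n -> 'I_n -> R.

(** Only the totally antisymmetric part of [T] matters: see [triple_sum_rot] and
    [triple_sum_swap]. *)
Definition triple_sum T : ext R n := \sum_(a < n) \sum_(b < n) \sum_(c < n)
  T a b c *: (ext_gen R a *w ext_gen R b *w ext_gen R c).

Lemma wedgeNl (x y : ext R n) : (- x) *w y = - (x *w y).
Proof. by rewrite -scaleN1r wedgeZl scaleN1r. Qed.

Lemma wedgeNr (x y : ext R n) : x *w (- y) = - (x *w y).
Proof. by rewrite -scaleN1r wedgeZr scaleN1r. Qed.

Lemma wedge_gen3_swap (a b c : 'I_n) :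
  ext_gen R a *w ext_gen R b *w ext_gen R c =
  - (ext_gen R a *w ext_gen R c *w ext_gen R b).
Proof. by rewrite wedgeA wedge_genC wedgeNr -wedgeA. Qed.

Lemma wedge_gen3_rot (a b c : 'I_n) :
  ext_gen R a *w ext_gen R b *w ext_gen R c =
  ext_gen R b *w ext_gen R c *w ext_gen R a.
Proof. by rewrite (wedge_genC R a b) wedgeNl wedge_gen3_swap opprK. Qed.

Lemma triple_sum_rot T : triple_sum (fun a b c => T b c a) = triple_sum T.
Proof.
rewrite /triple_sum exchange_big /=; apply: eq_bigr => b _.
rewrite exchange_big /=; apply: eq_bigr => c _; apply: eq_bigr => a _.
by rewrite wedge_gen3_rot.
Qed.

Lemma triple_sum_swap T : triple_sum (fun a b c => T a c b) = - triple_sum T.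
Proof.
rewrite /triple_sum -sumrN; apply: eq_bigr => a _.
rewrite exchange_big /= -sumrN; apply: eq_bigr => c _.
by rewrite -sumrN; apply: eq_bigr => b _; rewrite wedge_gen3_swap scalerN.
Qed.

Lemma eq_triple_sum T U : (forall a b c, T a b c = U a b c) ->
  triple_sum T = triple_sum U.
Proof.
by move=> h; do 3!(apply: eq_bigr => ? _); rewrite h.
Qed.

Lemma triple_sumD T U :
  triple_sum (fun a b c => T a b c + U a b c) = triple_sum T + triple_sum U.
Proof.
rewrite /triple_sum -big_split; apply: eq_bigr => a _.
rewrite -big_split; apply: eq_bigr => b _.
by rewrite -big_split; apply: eq_bigr => c _; rewrite scalerDl.
Qed.

Lemma triple_sumZ k T :
  triple_sum (fun a b c => k * T a b c) = k *: triple_sum T.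
Proof.
rewrite /triple_sum scaler_sumr; apply: eq_bigr => a _.
rewrite scaler_sumr; apply: eq_bigr => b _.
by rewrite scaler_sumr; apply: eq_bigr => c _; rewrite scalerA.
Qed.

End TripleSums.

Section DualBases.
Variables (R : realType) (g : quadLie R) (n : nat) (e e' : n.-tuple g).
Hypothesis he : basis_of {:g} e.
Hypothesis hdual : forall a b : 'I_n, Bform e`_a e'`_b = (a == b)%:R.
Local Notation B := (@Bform R g).

Lemma BformC (x y : g) : B x y = B y x.
Proof. by rewrite /Bform /polar [x + y]addrC addrAC. Qed.

Lemma BformP c (x y z : g) : B (c *: x + y) z = c * B x z + B y z.
Proof. exact: (@qform_polar R g).1. Qed.

Lemma BformDl (x y z : g) : B (x + y) z = B x z + B y z.
Proof. by have := BformP 1 x y z; rewrite scale1r mul1r. Qed.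

Lemma Bform0l (z : g) : B 0 z = 0.
Proof.
by have := BformDl 0 0 z; rewrite addr0 => /esym/(canRL (addrK _)); rewrite subrr.
Qed.

Lemma BformZl c (x z : g) : B (c *: x) z = c * B x z.
Proof. by have := BformP c x 0 z; rewrite addr0 Bform0l addr0. Qed.

Lemma BformNl (x z : g) : B (- x) z = - B x z.
Proof. by rewrite -scaleN1r BformZl mulN1r. Qed.

Lemma Bform_suml (I : Type) (s : seq I) (P : pred I) (F : I -> g) z :
  B (\sum_(i <- s | P i) F i) z = \sum_(i <- s | P i) B (F i) z.
Proof. by elim/big_rec2: _ => [|i u v _ <-]; rewrite ?Bform0l ?BformDl. Qed.

Lemma bracketPl c (x y z : g) : bracket (c *: x + y) z = c *: bracket x z + bracket y z.
Proof. exact: (@bracket_bilinear R g).1. Qed.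

Lemma bracketPr c (x y z : g) : bracket z (c *: x + y) = c *: bracket z x + bracket z y.
Proof. exact: (@bracket_bilinear R g).2. Qed.

Lemma bracketDl (x y z : g) : bracket (x + y) z = bracket x z + bracket y z.
Proof. by have := bracketPl 1 x y z; rewrite !scale1r. Qed.

Lemma bracketDr (x y z : g) : bracket z (x + y) = bracket z x + bracket z y.
Proof. by have := bracketPr 1 x y z; rewrite !scale1r. Qed.

Lemma bracketC (x y : g) : bracket x y = - bracket y x.
Proof.
apply/eqP; rewrite -addr_eq0; apply/eqP.
have := bracket_alt (x + y); rewrite bracketDl !bracketDr !bracket_alt addr0 add0r.
by [].
Qed.

Lemma adE (x y : g) : ad x y = bracket x y.
Proof.
rewrite /ad; have lin : linear (bracket x) by move=> c u v; rewrite bracketPr.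
pose f : {linear g -> g} := HB.pack (bracket x) (GRing.isLinear.Build _ _ _ _ _ lin).
exact: (lfunE f).
Qed.

Lemma coord_dual v (a : 'I_n) : coord e a v = B v e'`_a.
Proof.
rewrite [v in RHS](coord_basis he) ?memvf // Bform_suml (bigD1 a) //=.
rewrite BformZl hdual eqxx mulr1 big1 ?addr0 // => i ia.
by rewrite BformZl hdual (negbTE ia) mulr0.
Qed.

Lemma dual_expand v : v = \sum_(a < n) B v e'`_a *: e`_a.
Proof.
rewrite {1}(coord_basis he (memvf v)).
by apply: eq_bigr => a _; rewrite coord_dual.
Qed.

Lemma ext_injE v : ext_inj e v = \sum_(a < n) B v e'`_a *: ext_gen R a.
Proof. by apply: eq_bigr => a _; rewrite coord_dual. Qed.

Lemma ext_inj_basis (a : 'I_n) : ext_inj e e`_a = ext_gen R a.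
Proof.
rewrite ext_injE (bigD1 a) //= hdual eqxx scale1r big1 ?addr0 // => b ba.
by rewrite hdual eq_sym (negbTE ba) scale0r.
Qed.

(** The sum over [a] in [lambda_ext] is the expansion of [e'_b] in the basis [e]. *)
Lemma lambda_ext_coef (A : 'End(g)) : lambda_ext e e' A =
  2^-1 *: \sum_(a < n) \sum_(b < n)
    B (A e'`_b) e'`_a *: (ext_gen R a *w ext_gen R b).
Proof.
rewrite /lambda_ext; congr (_ *: _).
under eq_bigr => c _ do rewrite !ext_injE wedge_suml.
rewrite exchange_big /=; apply: eq_bigr => a _.
under eq_bigr => c _ do rewrite wedge_sumr.
rewrite exchange_big /=; apply: eq_bigr => b _.
under eq_bigr => c _ do rewrite wedgeZl wedgeZr scalerA.
rewrite -scaler_suml; congr (_ *: _).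
rewrite [e'`_b in RHS](dual_expand e'`_b) linear_sum Bform_suml.
by apply: eq_bigr => c _; rewrite linearZ BformZl mulrC BformC.
Qed.

Lemma Bform_invariant (m x y : g) : B (bracket m x) y = - B x (bracket m y).
Proof. exact: qform_inv. Qed.

Definition tau (x y z : g) : R := B (bracket x y) z.

Lemma tau_rot x y z : tau x y z = tau y z x.
Proof. by rewrite /tau bracketC BformNl Bform_invariant opprK BformC. Qed.

Lemma Theta_triple : Theta_ext e e' =
  - (6^-1 *: triple_sum (fun a b c : 'I_n => tau e'`_a e'`_b e'`_c)).
Proof.
rewrite /Theta_ext; congr (- (_ *: _)).
do 3!(apply: eq_bigr => ? _); rewrite !ext_inj_basis; congr (_ *: _).
by rewrite tau_rot /tau BformC.
Qed.

Section SkewOperator.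
Variable T : 'End(g).
Hypothesis T_skew : forall x y, B (T x) y = - B x (T y).

Lemma schouten_lambda : schouten e (lambda_ext e e' T) (lambda_ext e e' T) =
  triple_sum (fun a b c : 'I_n => tau (T e'`_a) (T e'`_b) e'`_c).
Proof.
pose r (a b : 'I_n) := B (T e'`_b) e'`_a.
have rC a b : r b a = - r a b by rewrite /r T_skew BformC.
rewrite lambda_ext_coef -/(r _ _) schouten_bivector //.
rewrite -[RHS]opprK -triple_sum_swap -[RHS]scaleN1r -triple_sumZ.
transitivity (triple_sum (fun a b c : 'I_n => \sum_(k < n) \sum_(l < n)
    r a k * coord e b (bracket e`_k e`_l) * r l c)).
  do 3!(apply: eq_bigr => ? _); rewrite scaler_suml.
  by apply: eq_bigr => k _; rewrite scaler_suml.
apply: eq_triple_sum => a b c.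
have hl (k : 'I_n) : \sum_(l < n) r a k * coord e b (bracket e`_k e`_l) * r l c =
    r a k * B (ad e`_k (T e'`_c)) e'`_b.
  rewrite [T e'`_c in RHS](dual_expand (T e'`_c)) linear_sum Bform_suml mulr_sumr.
  by apply: eq_bigr => l _; rewrite linearZ BformZl /= adE coord_dual /r; ring.
under eq_bigr => k _ do rewrite hl adE bracketC BformNl mulrN -mulNr -adE /r T_skew opprK.
rewrite /tau bracketC BformNl mulN1r opprK -adE [T e'`_a in RHS](dual_expand (T e'`_a)).
rewrite linear_sum Bform_suml; apply: eq_bigr => k _.
by rewrite linearZ BformZl -BformC.
Qed.

(** [D x] stands for the derivative of the operator in the direction [x].  The
    three terms of the equation are the [triple_sum] of [- B (D x y) z / 2], of
    [tau (T x) (T y) z / 2] and of [- tau / 24]; rotating the arguments turns each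
    of the first two into a third of the cyclic sum in the hypothesis. *)
Lemma cdybe_of_trilinear (D : g -> 'End(g)) :
  (forall c x y, D (c *: x + y) = c *: D x + D y) ->
  (forall x y z, tau (T x) (T y) z + tau x (T y) (T z) + tau (T x) y (T z)
     + 4^-1 * tau x y z = B (D x y) z + B (D y z) x + B (D z x) y) ->
  \sum_(a < n) lambda_ext e e' (D e`_a) *w ext_inj e e'`_a
    + 2^-1 *: schouten e (lambda_ext e e' T) (lambda_ext e e' T)
  = 4^-1 *: Theta_ext e e'.
Proof.
move=> DP key.
have D0 : D 0 = 0 by have := DP (-1) 0 0; rewrite scaler0 addr0 scaleN1r addNr.
have DZ c x : D (c *: x) = c *: D x by rewrite -[c *: x]addr0 DP D0 addr0.
have D_sum (s : seq 'I_n) (F : 'I_n -> g) : D (\sum_(i <- s) F i) = \sum_(i <- s) D (F i).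
  by elim/big_rec2: _ => // i u v _ <-; have := DP 1 (F i) v; rewrite !scale1r.
pose ts (F : g -> g -> g -> R) := triple_sum (fun a b c : 'I_n => F e'`_a e'`_b e'`_c).
have rot F : ts (fun x y z => F y z x) = ts F.
  exact: (triple_sum_rot (fun a b c : 'I_n => F e'`_a e'`_b e'`_c)).
have e1 : \sum_(a < n) lambda_ext e e' (D e`_a) *w ext_inj e e'`_a =
    - (2^-1 *: ts (fun x y z => B (D x y) z)).
  pose U (b c d : 'I_n) := B (D e'`_d e'`_c) e'`_b.
  have -> : ts (fun x y z => B (D x y) z) = - triple_sum U.
    by rewrite -triple_sum_swap -(triple_sum_rot (fun a b c => U a c b)).
  rewrite scalerN opprK.
  under eq_bigr => a _ do rewrite lambda_ext_coef wedgeZl wedge_suml.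
  rewrite -scaler_sumr exchange_big /=; congr (_ *: _); apply: eq_bigr => b _.
  under eq_bigr => a _ do rewrite wedge_suml.
  rewrite exchange_big /=; apply: eq_bigr => c _.
  under eq_bigr => a _ do rewrite ext_injE wedge_sumr.
  rewrite exchange_big /=; apply: eq_bigr => d _.
  under eq_bigr => a _ do rewrite wedgeZl wedgeZr scalerA.
  rewrite -scaler_suml; congr (_ *: _).
  rewrite /U [e'`_d in RHS](dual_expand e'`_d) D_sum sum_lfunE Bform_suml.
  by apply: eq_bigr => a _; rewrite DZ scale_lfunE BformZl mulrC BformC.
have e2 : 3 *: ts (fun x y z => tau (T x) (T y) z) + 4^-1 *: ts tau =
    3 *: ts (fun x y z => B (D x y) z).
  have m3 (v : ext R n) : 3 *: v = v + (v + v).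
    by rewrite scaler_nat !mulrS mulr0n addr0.
  rewrite !m3.
  have tsD F F' : ts F + ts F' = ts (fun x y z => F x y z + F' x y z).
    by rewrite /ts -triple_sumD.
  have tsZ c F : c *: ts F = ts (fun x y z => c * F x y z) by rewrite /ts -triple_sumZ.
  pose F1 x y z := tau (T x) (T y) z; pose F2 x y z := B (D x y) z.
  rewrite -/F1 -/F2.
  rewrite -{2}(rot F1) -{2}(rot F1) -{2}(rot (fun x y z => F1 y z x)).
  rewrite -{2}(rot F2) -{2}(rot F2) -{2}(rot (fun x y z => F2 y z x)).
  rewrite tsZ !tsD /ts; apply: eq_triple_sum => a b c.
  rewrite [RHS]addrA -key /F1 -(tau_rot e'`_a) (tau_rot (T e'`_c)).
  by rewrite !addrA.
rewrite e1 schouten_lambda Theta_triple -/(ts (fun x y z => tau (T x) (T y) z)) -/(ts tau).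
move: (ts _) (ts _) (ts _) e2 => s1 s2 s3 e2.
apply/ffunP => S; move/ffunP: e2 => /(_ S); rewrite !ffunE.
move: (s1 S) (s2 S) (s3 S) => u v w.
rewrite -![_ *: _]/(GRing.mul (s := R) _ _) => e2.
lra.
Qed.

End SkewOperator.

End DualBases.

(** * The r-matrix of a quadratic Lie algebra *)

Section QuotientDerivative.
Variable R : realType.

Definition mderivable m n (F : R -> 'M[R]_(m, n)) (s : R) :=
  forall i j, derivable (fun t => F t i j) s 1.

Lemma mderiv_derivable m n (F : R -> 'M[R]_(m, n)) s F' :
  mderiv F s F' -> mderivable F s.
Proof. by move=> h i j; case: (h i j). Qed.

Lemma mderivableP m n (F : R -> 'M[R]_(m, n)) s : mderivable F s ->
  mderiv F s (\matrix_(i, j) 'D_1 (fun t => F t i j) s).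
Proof. by move=> h i j; rewrite mxE; apply: derivableP. Qed.

Lemma derivable_fsum (I : Type) (r : seq I) (F : I -> R -> R) (s : R) :
  (forall i, derivable (F i) s 1) -> derivable (fun t => \sum_(i <- r) F i t) s 1.
Proof.
move=> h; elim: r => [|i r IH].
  by under eq_fun do rewrite big_nil; apply: derivable_cst.
under eq_fun do rewrite big_cons; exact: (derivableD (h i) IH).
Qed.

Lemma derivable_fprod (I : Type) (r : seq I) (F : I -> R -> R) (s : R) :
  (forall i, derivable (F i) s 1) -> derivable (fun t => \prod_(i <- r) F i t) s 1.
Proof.
move=> h; elim: r => [|i r IH].
  by under eq_fun do rewrite big_nil; apply: derivable_cst.
under eq_fun do rewrite big_cons; exact: (derivableM (h i) IH).
Qed.

Lemma derivable_det n (F : R -> 'M[R]_n) (s : R) :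
  mderivable F s -> derivable (fun t => \det (F t)) s 1.
Proof.
move=> h; apply: derivable_fsum => p; apply: derivableM; first exact: derivable_cst.
by apply: derivable_fprod => i; apply: h.
Qed.

Lemma mderivable_adj n (F : R -> 'M[R]_n) (s : R) :
  mderivable F s -> mderivable (fun t => \adj (F t)) s.
Proof.
move=> h i j; under eq_fun do rewrite mxE /cofactor.
apply: derivableM; first exact: derivable_cst.
apply: derivable_det => k l; under eq_fun do rewrite !mxE.
exact: h.
Qed.

Lemma mderivable_mul m n p (F : R -> 'M[R]_(m, n)) (G : R -> 'M[R]_(n, p)) s :
  mderivable F s -> mderivable G s -> mderivable (fun t => F t *m G t) s.
Proof.
move=> hF hG i j; under eq_fun do rewrite mxE.
by apply: derivable_fsum => k; exact: (derivableM (hF i k) (hG k j)).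
Qed.

Lemma near_unitmx n (F : R -> 'M[R]_n) (s : R) : mderivable F s ->
  F s \in unitmx -> \forall t \near s, F t \in unitmx.
Proof.
move=> hF Fs; have hd := derivableP (derivable_det hF).
have := @is_derive_near_neq0 R (fun t => \det (F t)) s _ hd.
rewrite -unitfE -/(unitmx _) => /(_ Fs); apply: filterS => t.
by rewrite unitmxE unitfE.
Qed.

(** Differentiability comes from Cramer's rule; the value of the derivative then
    follows by differentiating [F * (F^-1 G) = G]. *)
Lemma mderiv_quotient n (F G : R -> 'M[R]_n) (s : R) F' G' :
  mderiv F s F' -> mderiv G s G' -> F s \in unitmx ->
  mderiv (fun t => invmx (F t) *m G t) s
    (invmx (F s) *m (G' - F' *m (invmx (F s) *m G s))).
Proof.
move=> hF hG Fs; have dF := mderiv_derivable hF; have dG := mderiv_derivable hG.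
have nF := near_unitmx dF Fs.
have dQ : mderivable (fun t => invmx (F t) *m G t) s.
  apply: (mderivable_mul _ dG) => i j.
  apply: (@near_eq_derivable _ _ _ (fun t => (\det (F t))^-1 * (\adj (F t)) i j)).
    near=> t; have Ft : F t \in unitmx by near: t.
    by rewrite /invmx Ft [RHS]mxE.
  apply: derivableM; last exact: mderivable_adj.
  apply: derivableV; last exact: derivable_det.
  by rewrite -unitfE -unitmxE.
have hQ := mderivableP dQ; set Q' := (X in mderiv _ _ X) in hQ.
suff <- : Q' = invmx (F s) *m (G' - F' *m (invmx (F s) *m G s)) by [].
have hFQ := mderivM hF hQ.
have E : F' *m (invmx (F s) *m G s) + F s *m Q' = G'.
  apply/matrixP => i j.
  have h1 : is_derive s 1 (fun t => (F t *m (invmx (F t) *m G t)) i j) (G' i j).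
    apply: near_eq_is_derive (hG i j).
    near=> t; have Ft : F t \in unitmx by near: t.
    by rewrite mulKVmx.
  by rewrite -(derive_val (is_derive := h1)) -(derive_val (is_derive := hFQ i j)).
by rewrite -E addrC addKr mulKmx.
Unshelve. all: by end_near. Qed.

End QuotientDerivative.

Section QuadraticLieAlgebra.
Import passmx.
Variables (R : realType) (g : quadLie R).
Local Notation B := (@Bform R g).
Local Notation d := (\dim {:g}).
Local Notation vb := (vbasis {:g}).
Local Notation vec := (passmx.vecof vb).
Local Notation row_of := (passmx.rVof vb).

Let vbP : basis_of {:g} vb := vbasisP _.

Definition mx_ad (x : g) : 'M[R]_d := mx_of (ad x).

Lemma mul_mx_ad y x : y *m mx_ad x = row_of (bracket x (vec y)).
Proof. by rewrite /mx_ad /mx_of passmx.mul_mxof adE. Qed.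

Lemma of_mxE (M : 'M[R]_d) v : of_mx M v = vec (row_of v *m M).
Proof. exact: passmx.hommxE. Qed.

Lemma mx_adP c x y : mx_ad (c *: x + y) = c *: mx_ad x + mx_ad y.
Proof.
apply/row_matrixP => i; rewrite !rowE mulmxDr -scalemxAr !mul_mx_ad.
by rewrite bracketPl linearP.
Qed.

Lemma mx_ad_bracket x y : mx_ad (bracket x y) = mx_ad y *m mx_ad x - mx_ad x *m mx_ad y.
Proof.
apply/row_matrixP => i; rewrite !rowE mulmxBr !mulmxA !mul_mx_ad !passmx.rVofK //.
rewrite -linearB /=; congr (row_of _); set z := vec _.
have := bracket_jacobi x y z.
rewrite (bracketC z (bracket x y)) (bracketC z x).
have -> : bracket y (- bracket x z) = - bracket y (bracket x z).
  by rewrite -!adE linearN.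
by move/eqP; rewrite subr_eq0 => /eqP.
Qed.

Definition gram : 'M[R]_d := \matrix_(i, j) B vb`_i vb`_j.

Lemma gram_formE y z : gram_form gram y z = B (vec y) (vec z).
Proof.
rewrite /gram_form mxE /passmx.vecof Bform_suml.
under eq_bigr => j _ do rewrite !mxE mulr_suml.
rewrite exchange_big /=; apply: eq_bigr => i _.
rewrite BformZl BformC Bform_suml mulr_sumr; apply: eq_bigr => j _.
by rewrite BformZl BformC !mxE; ring.
Qed.

Let Xr (x : 'rV[R]_d) := mx_ad (vec x).

Lemma triE x y z : tri gram Xr x y z = tau (vec x) (vec y) (vec z).
Proof. by rewrite /tri gram_formE mul_mx_ad passmx.rVofK. Qed.

Lemma mx_ad_skew mu : mx_ad mu *m gram = - (gram *m (mx_ad mu)^T).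
Proof.
have ext (M N : 'M[R]_d) :
    (forall y z : 'rV[R]_d, (y *m M *m z^T) 0 0 = (y *m N *m z^T) 0 0) -> M = N.
  move=> h; apply/matrixP => i j; have := h (delta_mx 0 i) (delta_mx 0 j).
  by rewrite -!rowE trmx_delta -!colE !mxE.
apply: ext => y z; rewrite mulmxN mulNmx [RHS]mxE !mulmxA.
rewrite -[LHS]/(gram_form gram (y *m mx_ad mu) z).
rewrite -[y *m gram *m _ *m _]mulmxA -trmx_mul.
rewrite -[X in _ = - X]/(gram_form gram y (z *m mx_ad mu)).
by rewrite !gram_formE !mul_mx_ad !passmx.rVofK // Bform_invariant.
Qed.

Definition J_ad mu := mpser (sinhc R) (mx_ad mu).
Definition K_ad mu := mpser (dcoef (sinhc R)) (mx_ad mu).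

(** The matrices of [f (ad mu)] and of its derivative in the direction [x]. *)
Definition r_mx mu : 'M[R]_d := invmx (J_ad mu) *m K_ad mu.

Definition dr_mx mu x : 'M[R]_d := invmx (J_ad mu) *m
  (mpserD (dcoef (sinhc R)) (mx_ad mu) (mx_ad x)
   - mpserD (sinhc R) (mx_ad mu) (mx_ad x) *m r_mx mu).

Lemma dr_mxP mu c x y : dr_mx mu (c *: x + y) = c *: dr_mx mu x + dr_mx mu y.
Proof.
rewrite /dr_mx mx_adP !mpserDP; [|exact: sinhc_bounded|exact: dsinhc_bounded].
rewrite mulmxDl -scalemxAl opprD addrACA -scalerBr mulmxDr.
by rewrite -scalemxAr.
Qed.

Lemma r_domainP mu : r_domain mu <-> J_ad mu \in unitmx.
Proof. exact: iff_sym (J_unitP _). Qed.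

Lemma r_skew mu (x y : g) : J_ad mu \in unitmx ->
  B (of_mx (r_mx mu) x) y = - B x (of_mx (r_mx mu) y).
Proof.
move=> Ju; have := quotient_skewadjoint (mx_ad_skew mu) Ju (row_of x) (row_of y).
by rewrite !gram_formE -!of_mxE !passmx.rVofK.
Qed.

Lemma r_trilinear mu (x y z : g) : J_ad mu \in unitmx ->
  let T := of_mx (r_mx mu) in let D x := of_mx (dr_mx mu x) in
  tau (T x) (T y) z + tau x (T y) (T z) + tau (T x) y (T z) + 4^-1 * tau x y z =
  B (D x y) z + B (D y z) x + B (D z x) y.
Proof.
move=> Ju T D.
have XP c u v : Xr (c *: u + v) = c *: Xr u + Xr v by rewrite /Xr linearP mx_adP.
have X_ad u : Xr (u *m mx_ad mu) = Xr u *m mx_ad mu - mx_ad mu *m Xr u.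
  by rewrite /Xr mul_mx_ad passmx.rVofK // mx_ad_bracket.
have cyc u v w : tri gram Xr u v w = tri gram Xr v w u by rewrite !triE tau_rot.
have := trilinear_identity XP (mx_ad_skew mu) X_ad cyc Ju (row_of x) (row_of y) (row_of z).
rewrite -/(J_ad mu) -/(K_ad mu) -/(r_mx mu) => key.
have hD u v w : gram_form gram (row_of v *m dr_mx mu (vec (row_of u))) (row_of w) =
    B (D u v) w.
  by rewrite gram_formE !(rVofK vbP) /D of_mxE.
apply: etrans (etrans _ key) _; first by rewrite !triE !(rVofK vbP) /T !of_mxE.
by congr (_ + _ + _); apply: hD.
Qed.

End QuadraticLieAlgebra.

(** * The dynamical Yang-Baxter equation *)

Section DynamicalRMatrix.
Variables (R : realType) (g : quadLie R) (n : nat) (e e' : n.-tuple g).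
Hypothesis he : basis_of {:g} e.
Hypothesis hdual : forall a b : 'I_n, Bform e`_a e'`_b = (a == b)%:R.

Lemma r_cdybeE mu : J_ad mu \in unitmx ->
  r_cdybe e e' mu = lambda_ext e e' (of_mx (r_mx mu)).
Proof. by move=> Ju; rewrite /r_cdybe lfun_fun_f_cdybe. Qed.

Lemma of_mxP c (M N : 'M[R]_(\dim {:g})) :
  of_mx (c *: M + N) = c *: of_mx M + of_mx N :> 'End(g).
Proof. exact: passmx.hommx_linear. Qed.

Lemma lambda_extP c (T U : 'End(g)) :
  lambda_ext e e' (c *: T + U) = c *: lambda_ext e e' T + lambda_ext e e' U.
Proof.
rewrite !(lambda_ext_coef he hdual) scalerA mulrC -scalerA -scalerDr; congr (_ *: _).
rewrite scaler_sumr -big_split; apply: eq_bigr => a _ /=.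
rewrite scaler_sumr -big_split; apply: eq_bigr => b _ /=.
by rewrite add_lfunE scale_lfunE BformP scalerA -scalerDl.
Qed.

Let lam (M : 'M[R]_(\dim {:g})) : ext R n := lambda_ext e e' (of_mx M).

Let lamP c M N : lam (c *: M + N) = c *: lam M + lam N.
Proof. by rewrite /lam of_mxP lambda_extP. Qed.

Lemma lam_entries M S : lam M S = \sum_i \sum_j M i j * lam (delta_mx i j) S.
Proof.
have lam0 : lam 0 = 0 by have := lamP (-1) 0 0; rewrite scaler0 addr0 scaleN1r addNr.
have lamZ c N : lam (c *: N) = c *: lam N by rewrite -[c *: N]addr0 lamP lam0 addr0.
have lamD N N' : lam (N + N') = lam N + lam N' by have := lamP 1 N N'; rewrite !scale1r.
have lam_sum (I : Type) (s : seq I) F : lam (\sum_(i <- s) F i) = \sum_(i <- s) lam (F i).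
  by elim/big_rec2: _ => // i u v _ <-; rewrite lamD.
rewrite {1}[M]matrix_sum_delta lam_sum sum_ffunE; apply: eq_bigr => i _.
rewrite lam_sum sum_ffunE; apply: eq_bigr => j _.
by rewrite lamZ ffunE.
Qed.

Lemma lam_deriv (F : R -> 'M[R]_(\dim {:g})) s F' S : mderiv F s F' ->
  is_derive s (1 : R) (fun t => lam (F t) S : R) (lam F' S).
Proof.
move=> hF; rewrite lam_entries; under eq_fun do rewrite lam_entries.
apply: is_derive_fsum => i; apply: is_derive_fsum => j.
have := is_derive_prod (hF i j) (is_derive_cst (lam (delta_mx i j) S : R) s 1).
by rewrite mulr0 addr0.
Qed.

Lemma mx_ad_series_deriv u (mu x : g) : exp_bounded u ->
  mderiv (fun t => mpser u (mx_ad (mu + t *: x))) 0 (mpserD u (mx_ad mu) (mx_ad x)).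
Proof.
move=> hu; rewrite (_ : (fun t => _) = fun t => mpser u (mx_ad mu + t *: mx_ad x)).
  have := @mderiv_mpser_line R u _ (mx_ad mu) (mx_ad x) 0 hu.
  by rewrite scale0r addr0.
by apply/funext => t; rewrite [mu + _]addrC mx_adP addrC.
Qed.

(** Near [t = 0] the functional calculus is still given by [r_mx], since [det J] does
    not vanish there. *)
Lemma r_derive mu x S : J_ad mu \in unitmx ->
  is_derive (0 : R) (1 : R) (fun t => r_cdybe e e' (mu + t *: x) S : R)
    (lambda_ext e e' (of_mx (dr_mx mu x)) S).
Proof.
move=> Ju; have e0 : mu + 0 *: x = mu by rewrite scale0r addr0.
have dJ := @mx_ad_series_deriv _ mu x (sinhc_bounded R).
have dK := @mx_ad_series_deriv _ mu x (dsinhc_bounded R).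
have Ju0 : mpser (sinhc R) (mx_ad (mu + 0 *: x)) \in unitmx by rewrite e0.
have hr := mderiv_quotient dJ dK Ju0; rewrite e0 in hr.
have nJ := near_unitmx (mderiv_derivable dJ) Ju0.
apply: near_eq_is_derive (lam_deriv S hr).
near=> t; have Jt : J_ad (mu + t *: x) \in unitmx by near: t.
by rewrite (r_cdybeE Jt).
Unshelve. all: by end_near. Qed.

(** By Cramer's rule [det J] is a denominator of [J^-1 K], and it does not vanish
    on the domain. *)
Lemma r_meromorphic : meromorphic e (@r_domain R g) (r_cdybe e e').
Proof.
have mx_adE x : mx_ad x = \sum_(i < n) coord e i x *: mx_ad e`_i.
  rewrite {1}(coord_basis he (memvf x)).
  have ad0 : mx_ad (0 : g) = 0.
    by have := mx_adP (-1) (0 : g) 0; rewrite scaler0 addr0 scaleN1r addNr.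
  by elim/big_rec2: _ => // i u v _ <-; rewrite mx_adP.
have hJ u : exp_bounded u -> entire_mx e (fun x => mpser u (mx_ad x)).
  move=> hu i j; have := entire_mpser e (fun i => mx_ad e`_i) hu i j.
  by apply: eq_entire => x; rewrite -mx_adE.
have hN : entire_mx e (fun x => \adj (J_ad x) *m K_ad x).
  apply: entire_mulmx; last exact: hJ (dsinhc_bounded R).
  by apply: entire_adj; apply: hJ (sinhc_bounded R).
exists (fun x => \det (J_ad x)), (fun x => lam (\adj (J_ad x) *m K_ad x)); split.
- by apply: entire_det; apply: hJ (sinhc_bounded R).
- move=> S; apply: (@eq_entire _ _ _ e (fun x => \sum_i \sum_j
      (\adj (J_ad x) *m K_ad x) i j * lam (delta_mx i j) S)) => [x|].
    by rewrite [RHS]lam_entries.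
  apply: entire_sum => i; apply: entire_sum => j.
  by apply: entireM; [exact: hN | exact: entire_cst].
- move=> x /r_domainP Ju; have dJ : \det (J_ad x) != 0 by rewrite -unitfE -unitmxE.
  split=> //; rewrite r_cdybeE // -/(lam _).
  have -> : \adj (J_ad x) *m K_ad x = \det (J_ad x) *: r_mx x + 0.
    by rewrite addr0 /r_mx /invmx Ju -scalemxAl scalerA divff // scale1r.
  rewrite lamP; have -> : lam 0 = 0; last by rewrite addr0.
  by have := lamP (-1) 0 0; rewrite scaler0 addr0 scaleN1r addNr.
Qed.

Lemma r_partial mu a : J_ad mu \in unitmx ->
  partial e (r_cdybe e e') a mu = lambda_ext e e' (of_mx (dr_mx mu e`_a)).
Proof.
move=> Ju; apply/ffunP => S; rewrite ffunE derive1E.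
exact: (derive_val (is_derive := r_derive e`_a S Ju)).
Qed.

End DynamicalRMatrix.

Theorem theorem4p1 (R : realType) (g : quadLie R) (n : nat)
    (e e' : n.-tuple g)
    (he : basis_of {:g} e)
    (hdual : forall a b : 'I_n, Bform e`_a e'`_b = (a == b)%:R) :
  meromorphic e (@r_domain R g) (r_cdybe e e') /\
  (forall mu : g, r_domain mu ->
    has_partials e (r_cdybe e e') mu /\
    \sum_(a < n) partial e (r_cdybe e e') a mu *w ext_inj e e'`_a
      + 2^-1 *: schouten e (r_cdybe e e' mu) (r_cdybe e e' mu)
    = 4^-1 *: Theta_ext e e').
Proof.
split; first exact: r_meromorphic.
move=> mu /r_domainP Ju; split.
  by move=> a S; case: (r_derive he hdual e`_a S Ju).
under eq_bigr => a _ do rewrite r_partial //.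
rewrite r_cdybeE //.
have T_skew x y := @r_skew R g mu x y Ju.
have DP c x y : of_mx (dr_mx mu (c *: x + y)) =
    c *: of_mx (dr_mx mu x) + of_mx (dr_mx mu y) :> 'End(g).
  by rewrite dr_mxP of_mxP.
exact: (cdybe_of_trilinear he hdual T_skew DP (fun x y z => r_trilinear x y z Ju)).
Qed.
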